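(* Let $d\in\mathbb{N}$, $1<p<\infty$, $0<q,r,r_0,r_1\le\infty$, $-\infty<s,b_0,b_1<\infty$ and $0<\theta<1$. Assume further that $b_0\neq b_1$ and $b_0b_1>0$, and let $b=(1-\theta)b_0+\theta b_1$. Then, with equivalence of quasi-norms, $$\big(T^{b_0}_{r_0}F^s_{p,q}(\mathbb{R}^d),T^{b_1}_{r_1}F^s_{p,q}(\mathbb{R}^d)\big)_{\theta,r}=T^b_rF^s_{p,q}(\mathbb{R}^d).$$
   Context: $\widehat{f}$, $f^\vee$ denote the Fourier transform and its inverse on $\mathcal{S}'(\mathbb{R}^d)$. $(\varphi_j)_{j\ge 0}$ is the usual smooth dyadic resolution of unity: $\varphi_0\in C_c^\infty(\mathbb{R}^d)$, $\varphi_0=1$ for $|\xi|\le 1$, $\operatorname{supp}\varphi_0\subset\{|\xi|\le 2\}$, $\varphi_j(\xi)=\varphi_0(2^{-j}\xi)-\varphi_0(2^{-j+1}\xi)$ for $j\ge1$. The truncated Triebel--Lizorkin space $T^b_rF^s_{p,q}(\mathbb{R}^d)$ consists of all $f\in\mathcal S'(\mathbb{R}^d)$ with $$\|f\|_{T^b_rF^s_{p,q}}=\Big(\sum_{j\ge0}2^{jbr}\Big\|\Big(\sum_{\nu=2^j-1}^{2^{j+1}-2}2^{\nu sq}|(\varphi_\nu\widehat f)^\vee|^q\Big)^{1/q}\Big\|_{L_p}^r\Big)^{1/r}<\infty$$ (usual modifications for infinite exponents). Real interpolation: for a couple of quasi-Banach spaces $(A_0,A_1)$ and $K(t,f)=\inf\{\|f_0\|_{A_0}+t\|f_1\|_{A_1}: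 f=f_0+f_1,\ f_i\in A_i\}$, $(A_0,A_1)_{\theta,r}$ is the set of $f\in A_0+A_1$ with $\|f\|=\big(\int_0^\infty(t^{-\theta}K(t,f))^r\frac{dt}{t}\big)^{1/r}<\infty$ (supremum if $r=\infty$). *)

(* Defs.v *)
From HB Require Import structures.
From mathcomp Require Import all_boot all_order all_algebra.
From mathcomp Require Import all_classical all_reals all_analysis.
From mathcomp Require Import complex.
Set Implicit Arguments.
Unset Strict Implicit.
Unset Printing Implicit Defensive.
Import Order.TTheory GRing.Theory Num.Theory.
Import numFieldNormedType.Exports.
Import ComplexField.
Local Open Scope classical_set_scope.
Local Open Scope ring_scope.
Local Open Scope complex_scope.

Definition mx_display : measure_display -> measure_display.
Proof. exact. Qed.

Section measurable_mx.
Context {disp : measure_display} {T : measurableType disp} {m n : nat}.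

Definition mx_cylinder : set (set 'M[T]_(m, n)) :=
  [set A | exists i j, exists2 B, measurable B & A = (fun M : 'M[T]_(m, n) => M i j) @^-1` B].

Let mx_set0 : <<s mx_cylinder >> set0.
Proof. exact: sigma_algebra0. Qed.

Let mx_setC A : <<s mx_cylinder >> A -> <<s mx_cylinder >> (~` A).
Proof. exact: sigma_algebraC. Qed.

Let mx_bigcup (F : (set _)^nat) : (forall i, <<s mx_cylinder >> (F i)) ->
  <<s mx_cylinder >> (\bigcup_i (F i)).
Proof. exact: sigma_algebra_bigcup. Qed.

HB.instance Definition _ := @isMeasurable.Build (mx_display disp)
  'M[T]_(m, n) <<s mx_cylinder >> mx_set0 mx_setC mx_bigcup.

End measurable_mx.

Lemma measurable_coord disp (T : measurableType disp) m n i j :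
  measurable_fun [set: 'M[T]_(m, n)] (fun M : 'M[T]_(m, n) => M i j).
Proof.
move=> _ B mB; rewrite setTI; apply: sub_sigma_algebra.
by exists i, j, B.
Qed.

Lemma measurable_fun_mx disp disp' (S : measurableType disp')
    (T : measurableType disp) m n (f : S -> 'M[T]_(m, n)) :
  (forall i j, measurable_fun [set: S] (fun x => f x i j)) ->
  measurable_fun [set: S] f.
Proof.
move=> mf; apply: (measurability mx_cylinder) => // _ [_ [i [j [B mB ->]]] <-].
exact: mf.
Qed.

Section lebesgue_rV.
Variable R : realType.

Definition rV_cons n (z : R * 'rV[R]_n) : 'rV[R]_n.+1 :=
  \row_i oapp (z.2 0) z.1 (unlift ord0 i).

Definition rV_uncons n (v : 'rV[R]_n.+1) : R * 'rV[R]_n :=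
  (v 0 0, \row_i v 0 (lift ord0 i)).

Lemma rV_cons0 n (z : R * 'rV[R]_n) i : rV_cons z i 0 = z.1.
Proof. by rewrite mxE unlift_none. Qed.

Lemma rV_consS n (z : R * 'rV[R]_n) i k : rV_cons z i (lift ord0 k) = z.2 i k.
Proof. by rewrite mxE liftK ord1. Qed.

Lemma measurable_rV_cons n : measurable_fun setT (@rV_cons n).
Proof.
apply: measurable_fun_mx => i j; case: (unliftP ord0 j) => [k|] ->.
  under eq_fun do rewrite rV_consS.
  exact: measurableT_comp (measurable_coord _ _) measurable_snd.
by under eq_fun do rewrite rV_cons0; exact: measurable_fst.
Qed.

Lemma measurable_rV_uncons n : measurable_fun setT (@rV_uncons n).
Proof.
apply/measurable_fun_pairP; split; first exact: measurable_coord.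
apply: measurable_fun_mx => i j; rewrite /rV_uncons /=.
by under eq_fun do rewrite mxE; exact: measurable_coord.
Qed.

Lemma rV_consK n : cancel (@rV_cons n) (@rV_uncons n).
Proof.
case=> x v; rewrite /rV_uncons rV_cons0; congr pair.
by apply/rowP => i; rewrite mxE rV_consS.
Qed.

HB.instance Definition _ n :=
  isMeasurableFun.Build _ _ _ _ (@rV_cons n) (@measurable_rV_cons n).

Section step.
Variables (n : nat) (m : {sigma_finite_measure set 'rV[R]_n -> \bar R}).

Definition rV_cons_measure : set 'rV[R]_n.+1 -> \bar R :=
  pushforward ((@lebesgue_measure R) \x m)%E (@rV_cons n).

Let pm : {measure set 'rV[R]_n.+1 -> \bar R} :=
  measure_function_pushforward__canonical__measure_function_Measure
    (lebesgue_measure \x m)%E (@measurable_rV_cons n).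

Let measure0' : rV_cons_measure set0 = 0%E.
Proof. exact: (measure0 pm). Qed.

Let measure_ge0' A : (0 <= rV_cons_measure A)%E.
Proof. exact: (measure_ge0 pm). Qed.

Let measure_sigma_additive' : semi_sigma_additive rV_cons_measure.
Proof. exact: (@measure_semi_sigma_additive _ _ _ pm). Qed.

HB.instance Definition _ := isMeasure.Build _ _ _ rV_cons_measure
  measure0' measure_ge0' measure_sigma_additive'.

Let sigma_finite' : sigma_finite setT rV_cons_measure.
Proof.
have /sigma_finiteP[F [TF ndF Foo]] := sigma_finiteT (@lebesgue_measure R).
have /sigma_finiteP[G [TG ndG Goo]] := sigma_finiteT m.
exists (fun k => @rV_uncons n @^-1` (F k `*` G k)).
  rewrite -preimage_bigcup (_ : \bigcup_k _ = setT) ?preimage_setT //.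
  rewrite -setXTT TF TG predeqE => -[x y]; split.
    by move=> [k _ []/= ? ?]; split; exists k.
  move=> [/= [k _ Fkx] [l _ Gly]]; exists (maxn k l) => //; split.
    by move: x Fkx; exact/subsetPset/ndF/leq_maxl.
  by move: y Gly; exact/subsetPset/ndG/leq_maxr.
move=> k; have [mF ltF] := Foo k; have [mG ltG] := Goo k; split.
  rewrite -[X in measurable X]setTI; apply: measurable_rV_uncons => //.
  exact: measurableX.
rewrite /rV_cons_measure /pushforward (_ : _ @^-1` _ = F k `*` G k).
  by rewrite product_measure1E// lte_mul_pinfty// ge0_fin_numE.
by apply/seteqP; split=> z; rewrite /preimage /mkset rV_consK.
Qed.

HB.instance Definition _ := Measure_isSigmaFinite.Build _ _ _ rV_cons_measure
  sigma_finite'.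

End step.

Fixpoint lebesgue_rV n : {sigma_finite_measure set 'rV[R]_n -> \bar R} :=
  match n with
  | 0 => \d_(0 : 'rV[R]_0)
  | n'.+1 => rV_cons_measure (lebesgue_rV n')
  end.

End lebesgue_rV.

Section schwartz.
Variables (R : realType) (d : nat).
Local Notation E := 'rV[R]_d.
Local Notation C := R[i].
Local Notation Re := (@complex.Re R).
Local Notation Im := (@complex.Im R).
Implicit Types (f g : E -> C) (s : seq 'I_d) (N : nat).

Definition dotv (x y : E) : R := \sum_i x 0 i * y 0 i.

(* The norm of the library on ['rV[R]_d] is the sup norm. *)
Definition enorm (x : E) : R := Num.sqrt (dotv x x).

Definition rpartial s (u : E -> R) : E -> R :=
  foldr (fun i v x => 'D_(delta_mx 0 i) v x) u s.

Definition rsmooth (u : E -> R) : Prop := forall s,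
  continuous (rpartial s u) /\
  forall i x, derivable (rpartial s u) x (delta_mx 0 i).

(* [R[i]] is not a normed module over [R]: complex-valued functions are
   differentiated and integrated through their real and imaginary parts. *)
Definition smooth f : Prop :=
  rsmooth (fun x => Re (f x)) /\ rsmooth (fun x => Im (f x)).

Definition partial s f : E -> C := fun x =>
  rpartial s (fun y => Re (f y)) x +i* rpartial s (fun y => Im (f y)) x.

Definition seminorm N f : \bar R :=
  ereal_sup [set y | exists s x, (size s <= N)%N /\
    y = ((1 + enorm x) ^+ N * Normc.normc (partial s f x))%:E].

Definition is_schwartz f : Prop :=
  smooth f /\ forall N, (seminorm N f < +oo)%E.

Definition schwartz_pred : {pred E -> C} := fun f => `[< is_schwartz f >].

Record schwartz : Type := Schwartz {
  schwartz_fun :> E -> C;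
  schwartzP : schwartz_fun \in schwartz_pred }.

HB.instance Definition _ := [isSub for schwartz_fun].
HB.instance Definition _ := [Choice of schwartz by <:].

(* Re (a f + g) and Im (a f + g) are both of this form. *)
Let lc (a b : R) (u v w : E -> R) := (a *: u + b *: v) + w.

Lemma rpartial_lc (a b : R) (u v w : E -> R) s :
  rsmooth u -> rsmooth v -> rsmooth w ->
  rpartial s (lc a b u v w) = lc a b (rpartial s u) (rpartial s v) (rpartial s w).
Proof.
move=> su sv sw; elim: s => //= i s ->; apply/funext => x.
have [_ du] := su s; have [_ dv] := sv s; have [_ dw] := sw s.
rewrite /lc deriveD; last exact: dw.
  rewrite deriveD; [|exact: derivableZ|exact: derivableZ].
  by rewrite !deriveZ.
by apply: derivableD; exact: derivableZ.
Qed.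

Lemma rsmooth_lc (a b : R) (u v w : E -> R) :
  rsmooth u -> rsmooth v -> rsmooth w -> rsmooth (lc a b u v w).
Proof.
move=> su sv sw s; rewrite (rpartial_lc _ _ _ su sv sw).
have [cu du] := su s; have [cv dv] := sv s; have [cw dw] := sw s.
split=> [x|i x].
  exact: (cvgD (cvgD (cvgZr (cu x)) (cvgZr (cv x))) (cw x)).
apply: derivableD (dw i x).
by apply: derivableD; apply: derivableZ; [exact: du|exact: dv].
Qed.

Let Re_lc (a : C) f g : (fun x => Re ((a *: f + g) x)) =
  lc (Re a) (- Im a) (fun x => Re (f x)) (fun x => Im (f x)) (fun x => Re (g x)).
Proof.
apply/funext => x.
rewrite -[RHS]/(Re a * Re (f x) + - Im a * Im (f x) + Re (g x)).
rewrite -[LHS]/(Re (a * f x + g x)).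
by case: a (f x) (g x) => [? ?] [? ?] [? ?] /=; rewrite mulNr.
Qed.

Let Im_lc (a : C) f g : (fun x => Im ((a *: f + g) x)) =
  lc (Im a) (Re a) (fun x => Re (f x)) (fun x => Im (f x)) (fun x => Im (g x)).
Proof.
apply/funext => x.
rewrite -[RHS]/(Im a * Re (f x) + Re a * Im (f x) + Im (g x)).
rewrite -[LHS]/(Im (a * f x + g x)).
by case: a (f x) (g x) => [? ?] [? ?] [? ?] /=; rewrite [X in X + _ = _]addrC.
Qed.

Lemma partial_lc (a : C) f g s x : smooth f -> smooth g ->
  partial s (a *: f + g) x = a * partial s f x + partial s g x.
Proof.
move=> [rf if_] [rg ig]; rewrite /partial Re_lc Im_lc.
rewrite (rpartial_lc _ _ _ rf if_ rg) (rpartial_lc _ _ _ rf if_ ig).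
move: (rpartial _ _) (rpartial _ _) (rpartial _ _) (rpartial _ _) => v' u' v u.
rewrite -[LHS]/((Re a * u x + - Im a * v x + u' x) +i*
                (Im a * u x + Re a * v x + v' x)).
by case: a => ? ? /=; rewrite mulNr; congr (_ +i* _); rewrite [X in X + _ = _]addrC.
Qed.

Lemma smooth_lc (a : C) f g : smooth f -> smooth g -> smooth (a *: f + g).
Proof.
by move=> [rf if_] [rg ig]; split; rewrite ?Re_lc ?Im_lc; exact: rsmooth_lc.
Qed.

Lemma enorm_ge0 x : 0 <= enorm x. Proof. exact: sqrtr_ge0. Qed.

Lemma seminorm_ge0 N f : (0 <= seminorm N f)%E.
Proof.
apply: ereal_sup_ge; exists ((1 + enorm 0) ^+ N * Normc.normc (partial [::] f 0))%:E.
  by exists [::], 0.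
rewrite lee_fin mulr_ge0 ?exprn_ge0 ?addr_ge0 ?enorm_ge0 //.
by case: (partial _ _ _) => ? ?; exact: sqrtr_ge0.
Qed.

Lemma seminorm_lc N (a : C) f g : smooth f -> smooth g ->
  (seminorm N (a *: f + g)%R <= (Normc.normc a)%:E * seminorm N f + seminorm N g)%E.
Proof.
move=> sf sg; apply: ge_ereal_sup => _ [s [x [sN ->]]].
rewrite partial_lc //.
have w0 : 0 <= (1 + enorm x) ^+ N by rewrite exprn_ge0 ?addr_ge0 ?enorm_ge0.
have a0 : 0 <= Normc.normc a by case: (a) => ? ?; exact: sqrtr_ge0.
apply: (@le_trans _ _ ((Normc.normc a)%:E *
    ((1 + enorm x) ^+ N * Normc.normc (partial s f x))%:E +
    ((1 + enorm x) ^+ N * Normc.normc (partial s g x))%:E)%E).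
  rewrite -EFinM -EFinD lee_fin mulrCA -mulrDr ler_wpM2l //.
  by rewrite -Normc.normcM le_normcD.
apply: leeD; last by apply: ereal_sup_ubound; exists s, x.
by apply: lee_wpmul2l => //; apply: ereal_sup_ubound; exists s, x.
Qed.

Let rpartial0 s : rpartial s (cst 0) = cst 0 :> (E -> R).
Proof.
by elim: s => //= i s ->; apply/funext => x; rewrite derive_cst.
Qed.

Let is_schwartz0 : is_schwartz 0.
Proof.
have s0 : rsmooth (cst 0 : E -> R).
  move=> s; rewrite rpartial0; split=> [|i x]; first exact: cst_continuous.
  exact: derivable_cst.
split=> [|N]; first by split; exact: s0.
apply: (@le_lt_trans _ _ 0%E); last exact: ltry.
apply: ge_ereal_sup => _ [s [x [_ ->]]].
rewrite (_ : partial s 0 x = 0) ?Normc.normc0 ?mulr0 //.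
by rewrite /partial !rpartial0.
Qed.

Lemma schwartz_submod_closed : submod_closed schwartz_pred.
Proof.
split=> [|a f g]; first by apply/asboolP; exact: is_schwartz0.
move=> /asboolP [sf bf] /asboolP [sg bg]; apply/asboolP; split.
  exact: smooth_lc.
move=> N; apply: le_lt_trans (seminorm_lc _ _ sf sg) _.
rewrite lte_add_pinfty // lte_mul_pinfty // ?ge0_fin_numE ?seminorm_ge0 //.
by rewrite lee_fin; case: (a) => ? ?; exact: sqrtr_ge0.
Qed.

HB.instance Definition _ := GRing.isSubmodClosed.Build _ _ schwartz_pred
  schwartz_submod_closed.
HB.instance Definition _ := [SubChoice_isSubLmodule of schwartz by <:].

End schwartz.

Section distributions.
Variables (R : realType) (d : nat).
Local Notation E := 'rV[R]_d.
Local Notation C := R[i].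
Local Notation S := (schwartz R d).
Local Notation Re := (@complex.Re R).
Local Notation Im := (@complex.Im R).
Local Notation normc := (@Normc.normc R).
Local Notation leb := (lebesgue_rV R d).
Implicit Types (f g m : E -> C) (psi : S) (T : S -> C).

(* Continuity for the topology of the increasing family [seminorm N]. *)
Definition tempered T : Prop := linear T /\
  exists (N : nat) (c : R), forall psi,
    ((normc (T psi))%:E <= c%:E * seminorm N psi)%E.

(* [T] extended by 0 to functions outside the Schwartz space. It is only
   applied to Fourier transforms of Schwartz functions and to products of
   Schwartz functions with test functions, which are again in the space. *)
Definition extend0 T f : C := if insub f is Some psi then T psi else 0.

Definition Cintegral f : C :=
  (\int[leb]_x Re (f x)) +i* (\int[leb]_x Im (f x)).

Definition Cmeasurable f : Prop :=
  measurable_fun setT (fun x => Re (f x)) /\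
  measurable_fun setT (fun x => Im (f x)).

Definition Cintegrable f : Prop :=
  leb.-integrable setT (fun x => (Re (f x))%:E) /\
  leb.-integrable setT (fun x => (Im (f x))%:E).

Definition cis (t : R) : C := cos t +i* sin t.

(* Unitary normalization, (2 pi)^(-d/2) on both sides. *)
Definition fourier f : E -> C := fun xi =>
  ((2 * pi) `^ (- (d%:R / 2)))%:C *
  Cintegral (fun x => cis (- dotv x xi) * f x).

Definition inv_fourier f : E -> C := fun x =>
  ((2 * pi) `^ (- (d%:R / 2)))%:C *
  Cintegral (fun xi => cis (dotv x xi) * f xi).

Definition dfourier T : S -> C := fun psi => extend0 T (fourier psi).

Definition inv_dfourier T : S -> C := fun psi => extend0 T (inv_fourier psi).

Definition dmul m T : S -> C := fun psi => extend0 T (fun x => m x * psi x).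

Definition represents g T : Prop := Cmeasurable g /\
  forall psi, Cintegrable (fun x => g x * psi x) /\
    T psi = Cintegral (fun x => g x * psi x).

(* The last condition makes the support of [phi0] compact. *)
Definition resolution_generator (phi0 : E -> C) : Prop :=
  [/\ smooth phi0,
      forall xi, enorm xi <= 1 -> phi0 xi = 1 &
      closure [set xi | phi0 xi != 0] `<=` [set xi | enorm xi <= 2]].

Definition dyadic (phi0 : E -> C) (nu : nat) : E -> C := fun xi =>
  if nu is nu'.+1 then
    phi0 ((2 ^- nu) *: xi) - phi0 ((2 ^- nu') *: xi)
  else phi0 xi.

Definition piece (phi0 : E -> C) (nu : nat) T : S -> C :=
  inv_dfourier (dmul (dyadic phi0 nu) (dfourier T)).

End distributions.

Record qspace (R : realType) (V : Type) := QSpace {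
  carrier : set V;
  qnorm : V -> \bar R }.

Section triebel_lizorkin.
Variables (R : realType) (d : nat) (phi0 : 'rV[R]_d -> R[i]).
Local Notation E := 'rV[R]_d.
Local Notation S := (schwartz R d).

Definition block_lq (q : \bar R) (j : nat) (a : nat -> R) : R :=
  if q is q'%:E then
    (\sum_((2 ^ j).-1 <= nu < (2 ^ j.+1).-1) a nu `^ q') `^ q'^-1
  else \big[Num.max/0]_((2 ^ j).-1 <= nu < (2 ^ j.+1).-1) a nu.

(* The pieces of [f] are distributions, whose moduli are those of functions
   [g nu] representing them. Such functions exist by the Paley-Wiener-Schwartz
   theorem and are unique almost everywhere, so all the families give the same
   norm and the infimum is over a single value. *)
Definition block_norm (s p : R) (q : \bar R) (f : S -> R[i]) (j : nat) : \bar R :=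
  ereal_inf [set y | exists g : nat -> E -> R[i],
    (forall nu, ((2 ^ j).-1 <= nu < (2 ^ j.+1).-1)%N ->
       represents (g nu) (piece phi0 nu f)) /\
    y = Lnorm (lebesgue_rV R d) p%:E (fun x =>
      (block_lq q j (fun nu => 2 `^ (nu%:R * s) * Normc.normc (g nu x)))%:E)].

Definition TF_norm (b : R) (r : \bar R) (s p : R) (q : \bar R)
    (f : S -> R[i]) : \bar R :=
  Lnorm counting r (fun j : nat =>
    ((2 `^ (j%:R * b))%:E * block_norm s p q f j)%E).

Definition TF (b : R) (r : \bar R) (s p : R) (q : \bar R) :
    qspace R (S -> R[i]) :=
  QSpace [set f | tempered f /\ (TF_norm b r s p q f < +oo)%E]
    (TF_norm b r s p q).

End triebel_lizorkin.

Section interpolation.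
Variables (R : realType) (V : zmodType).
Implicit Types (X Y : qspace R V) (f : V).

Definition K_functional X Y (t : R) f : \bar R :=
  ereal_inf [set y | exists f0 f1, [/\ carrier X f0, carrier Y f1,
    f = f0 + f1 & y = (qnorm X f0 + t%:E * qnorm Y f1)%E]].

Definition interp_norm X Y (theta : R) (r : \bar R) f : \bar R :=
  (match r with
  | r'%:E => (\int[lebesgue_measure]_(t in `]0%R, +oo[)
      (((t `^ (- theta))%:E * K_functional X Y t f) `^ r' * (t^-1)%:E))
      `^ r'^-1
  | _ => ereal_sup
      [set (t `^ (- theta))%:E * K_functional X Y t f | t in `]0%R, +oo[]
  end)%E.

Definition real_interp X Y (theta : R) (r : \bar R) : qspace R V :=
  QSpace [set f | (exists f0 f1, [/\ carrier X f0, carrier Y f1 &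
      f = f0 + f1]) /\ (interp_norm X Y theta r f < +oo)%E]
    (interp_norm X Y theta r).

Definition qspace_equiv X Y : Prop :=
  carrier X = carrier Y /\
  exists c1 c2 : R, [/\ 0 < c1, 0 < c2 & forall f, carrier Y f ->
    (c1%:E * qnorm Y f <= qnorm X f <= c2%:E * qnorm Y f)%E].

End interpolation.

(* Main.v *)
Require Import Defs.
From HB Require Import structures.
From mathcomp Require Import all_boot all_order all_algebra.
From mathcomp Require Import all_classical all_reals all_analysis.
From mathcomp Require Import measurable_realfun ess_sup_inf.
From mathcomp Require Import complex.
From mathcomp Require Import ring lra.
From mathcomp Require Import zify.
Set Implicit Arguments.
Unset Strict Implicit.
Unset Printing Implicit Defensive.
Import Order.TTheory GRing.Theory Num.Theory.
Import numFieldNormedType.Exports.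
Import ComplexField.
Local Open Scope classical_set_scope.
Local Open Scope ring_scope.
Local Open Scope complex_scope.

(** Write [a_j(f)] for the [j]-th block norm of a distribution [f], that is the
    [L_p] norm of the [l_q] norm of its weighted pieces of index [nu] with
    [2 ^ j - 1 <= nu <= 2 ^ j.+1 - 2]. A tempered [f] belongs to the space of
    parameters [b] and [r] when the sequence [2 `^ (j * b) * a_j(f)] is in [l_r],
    so the theorem is the interpolation of weighted sequence spaces, as soon as
    distributions can be cut at any block like sequences. Two properties of
    [a_j] say that they can.
    - [block_normD]: [a_j(f0 + f1)] is at most a constant times
      [a_j(f0) + a_j(f1)].
    - [block_splitting]: for every [J], [f = f0 + f1] with [f0] and [f1] tempered,
      [a_j(f0)] and [a_j(f1)] at most [A * a_j(f)] for all [j], [a_j(f0) = 0] for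
      [j > J + 1] and [a_j(f1) = 0] for [j < J]; the constant [A] depends neither
      on [f] nor on [J].

    The low part [f0] is obtained by multiplying the Fourier transform of [f] by
    [phi0 (2 ^- N *: _)], where [N] is the last index of the block [J]. By the
    supports of the functions [dyadic phi0 nu], its pieces are those of [f] when
    [nu < N] and vanish when [nu > N + 1]. The two pieces in between are
    convolutions of those of [f] with the inverse transform of
    [phi0 (2 ^- N *: _)], a dilation of a fixed Schwartz function: its [L_1] norm
    does not depend on [N], and Young's inequality concludes ([Lnorm_filtered],
    [block_norm_lowpass]). The convolution formula itself ([represents_filtered])
    is proved by transposition: the multiplier acts on test functions, through
    Fourier inversion on the Schwartz space ([fourier_inversion]), and Fubini's
    theorem moves the convolution to the representing function. Inversion rests
    on the explicit transform of the exponential of minus a multiple of the [l_1]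
    norm, which is an approximate identity made of Poisson kernels.

    For the interpolation let [u_j = 2 `^ (j * b) * a_j(f)] and
    [t_j = 2 `^ (j * (b0 - b1))]. The quasi-triangle inequality gives
    [u_j <= C * t_j `^ (- theta) * K(t_j, f)]. Conversely, the splitting of [f] at
    the block [J] gives that [t_J `^ (- theta) * K(t_J, f)] is at most
    [C * sup_j mu ^ `|j - J| * u_j] for some [mu < 1]: seen from [J], the terms of
    the norms of [f0] and [f1] decrease geometrically. Such averages are bounded
    in [l_r] ([geometric_majorant]). Since the [t_j] are in geometric progression,
    the interpolation norm over the half-line that they cover is comparable to
    the [l_r] norm of the values at these points. On the other half-line [K(t, f)]
    is at most [t] or [1] times the norm of [f] in the larger of the two spaces,
    which is controlled by the averages at [J = 0]. *)

Local Notation Re := (@complex.Re _).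
Local Notation Im := (@complex.Im _).
Local Notation normc := (@Normc.normc _).

(** * Lebesgue measure on row vectors *)

Section affine1.
Variable R : realType.
Local Notation mu := (@lebesgue_measure R).

Lemma measurable_affine (a e : R) : measurable_fun setT (fun t : R => a + e * t).
Proof. by apply: measurable_funD => //; exact: measurable_funM. Qed.

(** Lebesgue measure is determined by its values on half-open intervals, and an
    affine map sends intervals to intervals. *)
Lemma ge0_integral_affine1 (a e : R) (f : R -> \bar R) : 0 < e ->
  measurable_fun setT f -> (forall t, 0 <= f t)%E ->
  (\int[mu]_t f (a + e * t)%R = (e^-1)%:E * \int[mu]_t f t)%E.
Proof.
move=> e0 mf f0.
pose h := fun t : R => a + e * t.
have mh : measurable_fun [set: measurableTypeR R] (h : measurableTypeR R -> measurableTypeR R) := measurable_affine a e.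
pose pm : {measure set (measurableTypeR R) -> \bar R} :=
  measure_function_pushforward__canonical__measure_function_Measure mu mh.
have e0' : 0 <= e by exact: ltW.
pose nu : {measure set (measurableTypeR R) -> \bar R} := mscale (NngNum e0') pm.
have munu A : measurable A -> mu A = nu A.
  move=> mA; apply: (@lebesgue_measure_unique R nu) => // _ [[u v] /= uv <-].
  rewrite /nu /mscale /= /pushforward.
  rewrite (_ : h @^-1` _ = [set` `](e^-1 * (u - a)), (e^-1 * (v - a))]]); last first.
    apply/seteqP; split => t; rewrite /= /h !in_itv/= ltr_pdivrMl// ler_pdivlMl//;
    by rewrite ltrBlDl lerBrDl.
  rewrite lebesgue_measure_itv lebesgue_measure_itv/= !lte_fin.
  rewrite ltr_pM2l ?invr_gt0// ltrD2r; case: ifPn => // _; last by rewrite mule0.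
  rewrite -!EFinB -EFinM; congr _%:E; field; exact: lt0r_neq0.
have -> : (\int[mu]_t f t = \int[nu]_t f t)%E.
  by apply: eq_measure_integral => A mA _; exact: munu.
rewrite ge0_integral_mscale//= ge0_integral_pushforward//=.
  rewrite muleA -EFinM mulVf ?lt0r_neq0// mul1e.
  by rewrite preimage_setT.
Qed.

End affine1.

Section rV_measurable.
Variable R : realType.

(** The norm is the sup norm, so balls are boxes. *)
Lemma ball_rVE d (x : 'rV[R]_d) e : 0 < e ->
  ball x e = \bigcap_(i : 'I_d) ((fun y : 'rV[R]_d => y 0 i) @^-1` ball (x 0 i) e).
Proof.
move=> e0; apply/seteqP; split => y /=.
  by move=> [_ h] i _; exact: h.
by move=> h; split=> // i j; rewrite ord1; exact: h.
Qed.

Lemma ball_rV_measurable d (x : 'rV[R]_d) e : 0 < e ->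
  measurable (ball x e : set 'rV[R]_d).
Proof.
move=> e0; rewrite ball_rVE//; apply: fin_bigcap_measurable => //.
move=> i _; rewrite -[X in measurable X]setTI.
by apply: measurable_coord => //; exact: measurable_ball.
Qed.

(** An open set is the union of the balls of radius the inverse of an integer and
    of rational centre that it contains; there are countably many of them. *)
Lemma open_measurable_rV d (U : set 'rV[R]_d) : open U -> measurable U.
Proof.
move=> oU.
pose c (z : 'rV[rat]_d) : 'rV[R]_d := \row_i ratr (z 0 i).
pose B (z : 'rV[rat]_d * nat) : set 'rV[R]_d :=
  if `[< ball (c z.1) (z.2.+1%:R^-1) `<=` U >]
  then ball (c z.1) (z.2.+1%:R^-1) else set0.
rewrite (_ : U = \bigcup_z B z); last first.
  apply/seteqP; split => [x Ux|x [z _]]; last first.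
    by rewrite /B; case: ifPn => // /asboolP h /h.
  have /nbhs_ballP[e /= e0 xeU] : nbhs x U by exact: open_nbhs_nbhs.
  have e2 : 0 < e / 2 by rewrite divr_gt0.
  have [N _ /(_ N (leqnn _)) hN] := near_infty_natSinv_lt (PosNum e2).
  rewrite /= in hN.
  have N0 : 0 < N.+1%:R^-1 :> R by rewrite invr_gt0.
  have /choice[q hq] : forall i : 'I_d, exists q : rat, ball (x 0 i) (N.+1%:R^-1) (ratr q : R).
    move=> i.
    have /rat_in_itvoo[q] : x 0 i - N.+1%:R^-1 < x 0 i + N.+1%:R^-1.
      by rewrite ltrBlDr -addrA ltrDl addr_gt0.
    rewrite in_itv/= => /andP[h1 h2]; exists q.
    have : `|x 0 i - ratr q : R| < N.+1%:R^-1 by rewrite ltr_distlC h1 h2.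
    by rewrite -ball_normE.
  have Bx : ball (c (\row_i q i)) (N.+1%:R^-1) x.
    by split=> // i j; rewrite ord1 !mxE; apply: ball_sym; exact: hq.
  exists (\row_i q i, N) => //; rewrite /B /=; case: ifPn => // /asboolP; apply: contra_notP => _.
  move=> y hy; apply: xeU; apply: (@le_ball _ _ _ (N.+1%:R^-1 + N.+1%:R^-1)).
    by rewrite [leRHS]splitr lerD// ltW.
  by apply: ball_triangle hy; exact: ball_sym.
apply: countable_bigcupT_measurable => // z; rewrite /B; case: ifPn => // _.
by apply: ball_rV_measurable; rewrite invr_gt0.
Qed.

Lemma continuous_measurable_rV d (f : 'rV[R]_d -> R) :
  continuous f -> measurable_fun setT f.
Proof.
move=> /continuousP cf; apply: (measurability _ (RGenOpens.measurableE R)) => //.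
move=> _ [_ [a [b ->] <-]]; rewrite setTI; apply: open_measurable_rV.
by apply: cf; exact: interval_open.
Qed.

Lemma measurable_affine_rV d (a : 'rV[R]_d) (e : R) :
  measurable_fun setT (fun x : 'rV[R]_d => a + e *: x).
Proof.
apply: measurable_fun_mx => i j; under eq_fun do rewrite !mxE.
by apply: measurable_funD => //; apply: measurable_funM => //; exact: measurable_coord.
Qed.

Lemma measurable_sub_rV d :
  measurable_fun setT (fun z : 'rV[R]_d * 'rV[R]_d => z.1 - z.2).
Proof.
apply: measurable_fun_mx => i j; under eq_fun do rewrite !mxE.
apply: measurable_funB.
  exact: (measurableT_comp (measurable_coord i j) measurable_fst).
exact: (measurableT_comp (measurable_coord i j) measurable_snd).
Qed.

End rV_measurable.

Section rV_fubini.
Variable R : realType.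
Local Notation leb := (lebesgue_rV R).

Local Notation mu := (@lebesgue_measure R).
Local Notation T1 := (measurableTypeR R).

Let measurable_consT n :
  measurable_fun [set: T1 * 'rV[R]_n] (@rV_cons R n : T1 * 'rV[R]_n -> _).
Proof. exact: measurable_rV_cons. Qed.

Let cons_meas n : {measure set 'rV[R]_n.+1 -> \bar R} :=
  measure_function_pushforward__canonical__measure_function_Measure
    (mu \x leb n)%E (@measurable_consT n).

Let integral_cons_meas n (f : 'rV[R]_n.+1 -> \bar R) :
  (\int[leb n.+1]_u f u = \int[cons_meas n]_u f u)%E.
Proof. by apply: eq_measure_integral. Qed.

Lemma ge0_integral_rV_prod n (f : 'rV[R]_n.+1 -> \bar R) :
  measurable_fun setT f -> (forall x, 0 <= f x)%E ->
  (\int[leb n.+1]_u f u = \int[mu \x leb n]_z f (rV_cons z))%E.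
Proof.
move=> mf f0; rewrite integral_cons_meas /cons_meas.
by rewrite (ge0_integral_pushforward (@measurable_consT n)).
Qed.

Lemma ge0_integral_rV_cons n (f : 'rV[R]_n.+1 -> \bar R) :
  measurable_fun setT f -> (forall x, 0 <= f x)%E ->
  (\int[leb n.+1]_u f u = \int[mu]_x \int[leb n]_v f (rV_cons (x, v)))%E.
Proof.
move=> mf f0; have mc := @measurable_consT n.
by rewrite ge0_integral_rV_prod// fubini_tonelli1//; exact: measurableT_comp.
Qed.

Lemma integral_rV_cons n (f : 'rV[R]_n.+1 -> \bar R) :
  (leb n.+1).-integrable setT f ->
  (\int[leb n.+1]_u f u = \int[mu]_x \int[leb n]_v f (rV_cons (x, v)))%E.
Proof.
move=> fi.
have mf : measurable_fun setT f by exact: measurable_int fi.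
have mc := @measurable_consT n.
have fi' : (mu \x leb n)%E.-integrable setT (fun z => f (rV_cons z)).
  apply/integrableP; split; first exact: measurableT_comp.
  have /integrableP[_] := fi; rewrite ge0_integral_rV_prod//.
  exact: measurableT_comp.
have := integral12_prod_meas1 fi'; rewrite /fubini_F /= => ->.
rewrite integral_cons_meas /cons_meas.
by rewrite (integral_pushforward (@measurable_consT n) mf).
Qed.

Lemma ge0_integral_prod_rV n (h : R -> R) c :
  measurable_fun setT h -> (forall t, 0 <= h t) ->
  (\int[mu]_t (h t)%:E = c%:E)%E ->
  (\int[leb n]_u (\prod_i h (u 0 i))%:E = (c ^+ n)%:E)%E.
Proof.
move=> mh h0 hc; elim: n => [|n ih].
  rewrite integral_dirac//= ?diracE ?in_setT ?mul1e ?big_ord0//.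
  by under eq_fun do rewrite big_ord0; exact: measurable_cst.
have mp m : measurable_fun setT (fun u : 'rV[R]_m => \prod_i h (u 0 i)).
  apply: measurable_prod => i _.
  by apply: measurableT_comp => //; exact: measurable_coord.
rewrite ge0_integral_rV_cons; last 2 first.
- by apply/measurable_EFinP; exact: mp.
- by move=> x; rewrite lee_fin prodr_ge0.
under eq_integral => x _.
  under eq_integral => v _.
    rewrite big_ord_recl rV_cons0 /=.
    under eq_bigr => i _ do rewrite rV_consS.
    rewrite EFinM; over.
  rewrite ge0_integralZl_EFin//=; last 2 first.
  - by move=> v _; rewrite lee_fin prodr_ge0.
  - by apply/measurable_EFinP; exact: mp.
  rewrite ih; over.
rewrite ge0_integralZr//=.
- by rewrite hc -EFinM exprS.
- exact/measurable_EFinP.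
- by move=> t _; rewrite lee_fin.
- rewrite lee_fin exprn_ge0//; rewrite -lee_fin -hc; apply: integral_ge0 => t _.
  by rewrite lee_fin.
Qed.

(** By induction on the dimension, through Tonelli's theorem. *)
Lemma ge0_integral_affine n (a : 'rV[R]_n) (e : R) (f : 'rV[R]_n -> \bar R) :
  0 < e -> measurable_fun setT f -> (forall u, 0 <= f u)%E ->
  (\int[leb n]_u f (a + e *: u)%R = (e ^- n)%:E * \int[leb n]_u f u)%E.
Proof.
move=> e0; elim: n a f => [|n ih] a f mf f0.
  rewrite /= !integral_dirac//= ?diracE ?in_setT ?mul1e ?expr0 ?invr1.
    by rewrite mul1e; congr (f _); apply/rowP; case.
  by apply: measurableT_comp => //; apply: measurable_fun_mx => i [].
rewrite !ge0_integral_rV_cons//; last exact: (measurableT_comp mf (measurable_affine_rV a e)).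
pose a' : 'rV[R]_n := \row_i a 0 (lift ord0 i).
have mc := @measurable_consT n.
have mfc : measurable_fun setT (fun z : T1 * 'rV[R]_n => f (rV_cons z)) by exact: measurableT_comp.
under eq_integral => x _.
  under eq_integral => v _.
    rewrite (_ : f _ = (fun w => f (rV_cons (a 0 0 + e * x, w)))%R (a' + e *: v)); last first.
      congr f; apply/rowP => j; case: (unliftP ord0 j) => [k|] ->.
        by rewrite rV_consS 2!mxE rV_consS !mxE.
      by rewrite rV_cons0 2!mxE rV_cons0.
    over.
  rewrite (ih a' (fun w => f (rV_cons (a 0 0 + e * x, w))))//; last first.
    by apply: measurableT_comp mfc _; exact: measurable_pair1.
  over.
rewrite /=; set F : T1 -> \bar R := fun x => (\int[leb n]_v f (rV_cons (x, v)))%E.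
have mF : measurable_fun setT F.
  exact: (@measurable_fun_fubini_tonelli_F _ _ _ _ R (leb n) _ mfc (fun z => f0 _)).
rewrite ge0_integralZl_EFin//=; last 3 first.
- by move=> *; exact: integral_ge0.
- by apply: (measurableT_comp mF); exact: measurable_affine.
- by rewrite invr_ge0 exprn_ge0// ltW.
rewrite (@ge0_integral_affine1 _ _ _ F)//; last by move=> *; exact: integral_ge0.
by rewrite muleA -EFinM -invfM -exprSr.
Qed.

End rV_fubini.

(** * An integrable weight *)

Section weight.
Variable R : realType.
Local Notation mu := (@lebesgue_measure R).
Local Notation leb := (lebesgue_rV R).

Lemma integral_oneDsqrV : (\int[mu]_t ((1 + t ^+ 2)^-1)%:E = pi%:E)%E.
Proof.
have pos (t : R) : 0 < 1 + t ^+ 2 by rewrite ltr_wpDr// sqr_ge0.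
rewrite (@ge0_symfun_integralT _ (fun t => (1 + t ^+ 2)^-1)).
- rewrite (_ : [set x | _] = `[0, +oo[%classic); last first.
    by apply/seteqP; split => x /=; rewrite in_itv/= andbT.
  by rewrite integral0y_oneDsqr -EFinM; congr _%:E; field.
- by move=> t; rewrite invr_ge0 ltW.
- exact: continuous_oneDsqrV.
- by move=> t /=; rewrite sqrrN.
Qed.

(** A product of Cauchy densities: it has an explicit integral, it decreases like
    a power of the norm, and it is comparable to its translates. *)
Definition weight d (x : 'rV[R]_d) : R := \prod_i (1 + x 0 i ^+ 2)^-1.

Section weight_lemmas.
Variable d : nat.
Implicit Types x y : 'rV[R]_d.

Let pos (t : R) : 0 < 1 + t ^+ 2. Proof. by rewrite ltr_wpDr// sqr_ge0. Qed.

Lemma weight_gt0 x : 0 < weight x.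
Proof. by apply: prodr_gt0 => i _; rewrite invr_gt0. Qed.

Lemma weight_ge0 x : 0 <= weight x. Proof. exact/ltW/weight_gt0. Qed.

Lemma weight_le1 x : weight x <= 1.
Proof.
apply: prodr_ile1 => i _; rewrite invr_ge0 (ltW (pos _))/= invf_le1//.
by rewrite lerDl sqr_ge0.
Qed.

Lemma weightN x : weight (- x) = weight x.
Proof. by apply: eq_bigr => i _; rewrite mxE sqrrN. Qed.

Lemma measurable_weight : measurable_fun setT (@weight d).
Proof.
apply: measurable_prod => i _.
apply: (measurableT_comp (f := fun t : R => (1 + t ^+ 2)^-1)).
  by apply: continuous_measurable_fun; exact: continuous_oneDsqrV.
exact: measurable_coord.
Qed.

Lemma integral_weight : (\int[leb d]_x (weight x)%:E = (pi ^+ d)%:E)%E.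
Proof.
apply: (@ge0_integral_prod_rV _ d (fun t => (1 + t ^+ 2)^-1)).
- by apply: continuous_measurable_fun; exact: continuous_oneDsqrV.
- by move=> t; rewrite invr_ge0 ltW.
- exact: integral_oneDsqrV.
Qed.

Lemma integrable_weight : (leb d).-integrable setT (EFin \o @weight d).
Proof.
apply/integrableP; split; first by apply/measurable_EFinP; exact: measurable_weight.
under eq_integral => x _ do rewrite /= ger0_norm ?weight_ge0//.
by rewrite integral_weight ltry.
Qed.

(** Peetre's inequality, in each coordinate. *)
Lemma weight_shift x y : weight (x - y) * weight y <= 2 ^+ d * weight x.
Proof.
have -> : (2 : R) ^+ d = \prod_(i < d) 2 by rewrite prodr_const card_ord.
rewrite /weight -!big_split/=.
apply: ler_prod => i _.
rewrite mulr_ge0 ?invr_ge0 ?(ltW (pos _))//= !mxE.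
set a := x 0 i; set b := y 0 i.
have a2 : 0 < 2 / (1 + a ^+ 2) by rewrite divr_gt0.
rewrite -invfM -[leRHS]invrK lef_pV2 ?posrE ?invr_gt0//; last by rewrite mulr_gt0.
rewrite invfM invrK mulrC ler_pdivrMr// -subr_ge0.
suff -> : (1 + (a - b) ^+ 2) * (1 + b ^+ 2) * 2 - (1 + a ^+ 2) =
  1 + (a - 2 * b) ^+ 2 + 2 * ((a - b) * b) ^+ 2.
  by rewrite !addr_ge0// ?sqr_ge0// mulr_ge0// sqr_ge0.
by ring.
Qed.

Lemma weight_enorm x : (weight x)^-1 <= (1 + enorm x) ^+ (2 * d).
Proof.
rewrite /weight prodfV invrK exprM.
have -> : (1 + enorm x) ^+ 2 ^+ d = \prod_(i < d) (1 + enorm x) ^+ 2.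
  by rewrite prodr_const card_ord.
apply: ler_prod => i _; rewrite (ltW (pos _))/=.
have xe : x 0 i ^+ 2 <= enorm x ^+ 2.
  rewrite sqr_sqrtr; last by apply: sumr_ge0 => j _; rewrite -expr2 sqr_ge0.
  rewrite /dotv (bigD1 i)//= -expr2 lerDl; apply: sumr_ge0 => j _.
  by rewrite -expr2 sqr_ge0.
rewrite sqrrD expr1n mul1r -addrA lerD2l (le_trans xe)// lerDr.
by rewrite mulrn_wge0// enorm_ge0.
Qed.

End weight_lemmas.
End weight.

(** * Complex numbers and complex integrals *)

Section complex_facts.
Variable R : realType.
Local Notation C := R[i].
Implicit Types z w : C.

Lemma complex_eq z w : Re z = Re w -> Im z = Im w -> z = w.
Proof. by case: z w => [? ?] [? ?] /= -> ->. Qed.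

Lemma cReD z w : Re (z + w) = Re z + Re w. Proof. by case: z w => [? ?] []. Qed.

Lemma cImD z w : Im (z + w) = Im z + Im w. Proof. by case: z w => [? ?] []. Qed.

Lemma cReN z : Re (- z) = - Re z. Proof. by case: z. Qed.

Lemma cImN z : Im (- z) = - Im z. Proof. by case: z. Qed.

Lemma cReM z w : Re (z * w) = Re z * Re w - Im z * Im w.
Proof. by case: z w => [? ?] []. Qed.

Lemma cImM z w : Im (z * w) = Re z * Im w + Im z * Re w.
Proof. by case: z w => [? ?] []. Qed.

Lemma normc_ge0 z : 0 <= normc z. Proof. by case: z => ? ?; exact: sqrtr_ge0. Qed.

Lemma Re_le_normc z : `|Re z| <= normc z.
Proof.
by case: z => a b /=; rewrite -sqrtr_sqr ler_sqrt ?addr_ge0 ?sqr_ge0// lerDl sqr_ge0.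
Qed.

Lemma Im_le_normc z : `|Im z| <= normc z.
Proof.
by case: z => a b /=; rewrite -sqrtr_sqr ler_sqrt ?addr_ge0 ?sqr_ge0// lerDr sqr_ge0.
Qed.

Lemma normc_le z : normc z <= `|Re z| + `|Im z|.
Proof.
case: z => a b /=; rewrite -[leRHS]ger0_norm ?addr_ge0// -sqrtr_sqr.
rewrite ler_sqrt ?sqr_ge0// sqrrD !real_normK ?num_real//.
by rewrite addrAC lerDl mulrn_wge0// mulr_ge0.
Qed.

Lemma normcN z : normc (- z) = normc z.
Proof. by case: z => a b /=; rewrite !sqrrN. Qed.

Lemma normcR (a : R) : normc a%:C = `|a|.
Proof. by rewrite /= expr0n addr0 sqrtr_sqr. Qed.

Lemma normc_cis t : normc (cis t) = 1 :> R.
Proof. by rewrite /cis /= cos2Dsin2 sqrtr1. Qed.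

Lemma cisD (a b : R) : cis (a + b) = cis a * cis b.
Proof. by apply: complex_eq; rewrite ?cReM ?cImM /= ?cosD ?sinD// addrC mulrC [X in _ + X]mulrC addrC. Qed.

End complex_facts.

Section real_fubini.
Variables (R : realType) (d : nat).
Local Notation E := 'rV[R]_d.
Local Notation leb := (lebesgue_rV R d).

Lemma integrable_le (f a : E -> R) : measurable_fun setT f ->
  (forall x, `|f x| <= a x) -> leb.-integrable setT (EFin \o a) ->
  leb.-integrable setT (EFin \o f).
Proof.
move=> mf fa; apply: le_integrable => //; first exact/measurable_EFinP.
by move=> x _ /=; rewrite lee_fin (le_trans (fa x))// ler_norm.
Qed.

Lemma integrable_mulrl (k : R) (f : E -> R) : leb.-integrable setT (EFin \o f) ->
  leb.-integrable setT (EFin \o (fun x => k * f x)).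
Proof.
move=> fi; rewrite (_ : _ \o _ = fun x => (k%:E * (EFin \o f) x)%E)//.
exact: integrableZl.
Qed.

Lemma integrable_addr (f g : E -> R) : leb.-integrable setT (EFin \o f) ->
  leb.-integrable setT (EFin \o g) ->
  leb.-integrable setT (EFin \o (fun x => f x + g x)).
Proof. by move=> fi gi; exact: (integrableD measurableT fi gi). Qed.

Lemma le_norm_Rintegral (f a : E -> R) : measurable_fun setT f ->
  (forall x, `|f x| <= a x) -> leb.-integrable setT (EFin \o a) ->
  `|\int[leb]_x f x| <= \int[leb]_x a x.
Proof.
move=> mf fa ia; have fi := integrable_le mf fa ia.
apply: (le_trans (le_normr_Rintegral _ fi)) => //.
by apply: le_Rintegral => //; exact: integrable_norm.
Qed.

Section fubini.
Variables (f : E * E -> R) (a b : E -> R).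
Hypothesis mf : measurable_fun setT f.
Hypothesis ia : leb.-integrable setT (EFin \o a).
Hypothesis ib : leb.-integrable setT (EFin \o b).
Hypothesis fab : forall x y, `|f (x, y)| <= a x * b y.

Let ma : measurable_fun setT a.
Proof. by apply/measurable_EFinP; exact: measurable_int ia. Qed.

Let mb : measurable_fun setT b.
Proof. by apply/measurable_EFinP; exact: measurable_int ib. Qed.

Let integrable_f : (leb \x leb)%E.-integrable setT (EFin \o f).
Proof.
apply/integrableP; split; first exact/measurable_EFinP.
apply: (@le_lt_trans _ _ (\int[leb \x leb]_z (`|a z.1|%:E * `|b z.2|%:E)))%E.
  apply: ge0_le_integral => //=.
  - by apply/measurable_EFinP; exact: measurableT_comp.
  - by apply: emeasurable_funM; apply/measurable_EFinP; apply: measurableT_comp => //; exact: measurableT_comp.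
  - move=> [x y] _ /=; rewrite -EFinM lee_fin -normrM.
    by rewrite (le_trans (fab x y))// ler_norm.
rewrite fubini_tonelli1//=; last first.
  by apply: emeasurable_funM; apply/measurable_EFinP; apply: measurableT_comp => //; exact: measurableT_comp.
rewrite /fubini_F /=.
under eq_integral => x _.
  rewrite ge0_integralZl_EFin//=; last by apply/measurable_EFinP; exact: measurableT_comp.
  over.
have /integrableP[_ ia'] := ia; have /integrableP[_ ib'] := ib.
rewrite ge0_integralZr//=; last 2 first.
- by apply/measurable_EFinP; exact: measurableT_comp.
- exact: integral_ge0.
by rewrite lte_mul_pinfty// ?integral_ge0// ge0_fin_numE// integral_ge0.
Qed.

Lemma dominated_integrable_l x : leb.-integrable setT (fun y => (f (x, y))%:E).
Proof.
apply: (@integrable_le (fun y => f (x, y)) (fun y => a x * b y)) => //.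
  exact: (measurableT_comp mf (measurable_pair1 x)).
exact: integrable_mulrl.
Qed.

Let fubini_FE : fubini_F leb (EFin \o f) =
  EFin \o (fun x => \int[leb]_y f (x, y)).
Proof.
apply/funext => x; rewrite /fubini_F /= /Rintegral fineK//.
exact: integrable_fin_num (dominated_integrable_l x).
Qed.

Lemma dominated_fubini_l :
  leb.-integrable setT (fun x => (\int[leb]_y f (x, y))%:E).
Proof. by have := integrable_fubini_F integrable_f; rewrite fubini_FE. Qed.

Lemma dominated_fubini12 :
  \int[leb]_x \int[leb]_y f (x, y) = fine (\int[leb \x leb]_z (f z)%:E).
Proof.
have h1 := integral12_prod_meas1 integrable_f.
rewrite fubini_FE in h1.
by rewrite /Rintegral -/(EFin \o _) h1.
Qed.

Lemma dominated_fubini21 :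
  \int[leb]_y \int[leb]_x f (x, y) = fine (\int[leb \x leb]_z (f z)%:E).
Proof.
have h2 := integral21_prod_meas1 integrable_f.
rewrite -h2 /Rintegral; congr fine; apply: eq_integral => y _.
rewrite /fubini_G /= fineK//.
apply: (@integrable_fin_num _ _ _ leb setT) => //.
apply: (@integrable_le (fun x => f (x, y)) (fun x => b y * a x)).
- exact: (measurableT_comp mf (measurable_pair2 y)).
- by move=> x; rewrite mulrC.
- exact: integrable_mulrl.
Qed.

Lemma dominated_fubini :
  \int[leb]_x \int[leb]_y f (x, y) = \int[leb]_y \int[leb]_x f (x, y).
Proof. by rewrite dominated_fubini12 dominated_fubini21. Qed.

End fubini.

Lemma Rintegral_affine (a : E) (e : R) (f : E -> R) : 0 < e ->
  leb.-integrable setT (EFin \o f) ->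
  leb.-integrable setT (EFin \o (fun u => f (a + e *: u))) /\
  \int[leb]_u f (a + e *: u) = e ^- d * \int[leb]_u f u.
Proof.
move=> e0 fi.
have maff := measurable_affine_rV a e.
have mf : measurable_fun setT (EFin \o f) by exact: measurable_int fi.
have fi' : leb.-integrable setT (EFin \o (fun u => f (a + e *: u))).
  apply/integrableP; split; first exact: (measurableT_comp mf maff).
  have /integrableP[_] := fi.
  rewrite (@ge0_integral_affine _ _ a e (fun u => `|(f u)%:E|%E))//; last exact: measurableT_comp.
  by move=> h; rewrite lte_mul_pinfty// lee_fin invr_ge0 exprn_ge0// ltW.
split=> //.
have ip := integrable_funepos measurableT fi.
have im := integrable_funeneg measurableT fi.
have E1 := @ge0_integral_affine _ _ a e _ e0 (measurable_int _ ip) (funepos_ge0 _).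
have E2 := @ge0_integral_affine _ _ a e _ e0 (measurable_int _ im) (funeneg_ge0 _).
rewrite /Rintegral -[e ^- d]/(fine (e ^- d)%:E) -fineM//; last exact: integrable_fin_num.
congr fine; rewrite integralE [in RHS]integralE muleBr//; last first.
  by rewrite fin_num_adde_defr// integrable_fin_num.
rewrite [X in (_ = X - _)%E](esym E1) [X in (_ = _ - X)%E](esym E2).
by congr (_ - _)%E; apply: eq_integral => x _; rewrite ?funeposE ?funenegE.
Qed.

End real_fubini.

Section complex_integral.
Variables (R : realType) (d : nat).
Local Notation E := 'rV[R]_d.
Local Notation C := R[i].
Local Notation leb := (lebesgue_rV R d).

(** [Cmeasurable] over an arbitrary domain, in particular a product; the two are
    convertible over row vectors. *)
Definition cmeasurable disp (T : measurableType disp) (f : T -> C) : Prop :=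
  measurable_fun setT (fun x => Re (f x)) /\
  measurable_fun setT (fun x => Im (f x)).

Section cmeasurable_lemmas.
Context disp (T : measurableType disp).
Implicit Types f g : T -> C.

Lemma cmeasurable_cst c : cmeasurable (fun _ : T => c).
Proof. by split; exact: measurable_cst. Qed.

Lemma cmeasurableD f g : cmeasurable f -> cmeasurable g ->
  cmeasurable (fun x => f x + g x).
Proof.
move=> [f1 f2] [g1 g2]; split.
  by under eq_fun do rewrite cReD; exact: measurable_funD.
by under eq_fun do rewrite cImD; exact: measurable_funD.
Qed.

Lemma cmeasurableN f : cmeasurable f -> cmeasurable (fun x => - f x).
Proof.
move=> [f1 f2]; split.
  by under eq_fun do rewrite cReN; exact: measurableT_comp.
by under eq_fun do rewrite cImN; exact: measurableT_comp.
Qed.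

Lemma cmeasurableM f g : cmeasurable f -> cmeasurable g ->
  cmeasurable (fun x => f x * g x).
Proof.
move=> [f1 f2] [g1 g2]; split.
  under eq_fun do rewrite cReM.
  by apply: measurable_funB; exact: measurable_funM.
under eq_fun do rewrite cImM.
by apply: measurable_funD; exact: measurable_funM.
Qed.

Lemma cmeasurable_real (u : T -> R) : measurable_fun setT u ->
  cmeasurable (fun x => (u x)%:C).
Proof. by move=> mu; split => //=; exact: measurable_cst. Qed.

Lemma cmeasurable_cis (u : T -> R) : measurable_fun setT u ->
  cmeasurable (fun x => cis (u x)).
Proof.
move=> mu; split; rewrite /cis /=.
  exact: (measurableT_comp (continuous_measurable_fun (@continuous_cos R)) mu).
exact: (measurableT_comp (continuous_measurable_fun (@continuous_sin R)) mu).
Qed.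

Lemma measurable_normc f : cmeasurable f -> measurable_fun setT (fun x => normc (f x)).
Proof.
move=> [f1 f2].
rewrite (_ : (fun x => _) = fun x => Num.sqrt (Re (f x) ^+ 2 + Im (f x) ^+ 2)); last first.
  by apply/funext => x; case: (f x).
apply: (measurableT_comp (continuous_measurable_fun (@sqrt_continuous R))).
by apply: measurable_funD; exact: measurable_funX.
Qed.

Lemma cmeasurable_comp disp' (S : measurableType disp') f (h : S -> T) :
  cmeasurable f -> measurable_fun setT h -> cmeasurable (fun x => f (h x)).
Proof. by move=> [f1 f2] mh; split; [exact: (measurableT_comp f1 mh)|exact: (measurableT_comp f2 mh)]. Qed.

End cmeasurable_lemmas.

Implicit Types f g : E -> C.

Lemma Cintegrable_le f (a : E -> R) : Cmeasurable f ->
  (forall x, normc (f x) <= a x) -> leb.-integrable setT (EFin \o a) ->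
  Cintegrable f.
Proof.
move=> [f1 f2] fa ia; split.
  by apply: integrable_le f1 _ ia => x; exact: le_trans (Re_le_normc _) (fa x).
by apply: integrable_le f2 _ ia => x; exact: le_trans (Im_le_normc _) (fa x).
Qed.

Lemma CintegrableD f g : Cintegrable f -> Cintegrable g ->
  Cintegrable (fun x => f x + g x).
Proof.
move=> [f1 f2] [g1 g2]; split.
  under eq_fun do rewrite cReD; exact: integrable_addr.
under eq_fun do rewrite cImD; exact: integrable_addr.
Qed.

Lemma CintegralD f g : Cintegrable f -> Cintegrable g ->
  Cintegral (fun x => f x + g x) = Cintegral f + Cintegral g.
Proof.
move=> [f1 f2] [g1 g2]; apply: complex_eq; rewrite ?cReD ?cImD /=.
  by under eq_Rintegral do rewrite cReD; rewrite RintegralD.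
by under eq_Rintegral do rewrite cImD; rewrite RintegralD.
Qed.

Lemma CintegrableZ c f : Cintegrable f -> Cintegrable (fun x => c * f x).
Proof.
move=> [f1 f2]; split.
  under eq_fun do rewrite cReM -mulNr.
  by apply: integrable_addr; exact: integrable_mulrl.
under eq_fun do rewrite cImM.
by apply: integrable_addr; exact: integrable_mulrl.
Qed.

Lemma CintegralZ c f : Cintegrable f ->
  Cintegral (fun x => c * f x) = c * Cintegral f.
Proof.
move=> [f1 f2]; apply: complex_eq; rewrite ?cReM ?cImM /=.
  under eq_Rintegral do rewrite cReM -mulNr.
  by rewrite RintegralD ?RintegralZl ?mulNr//; exact: integrable_mulrl.
under eq_Rintegral do rewrite cImM.
by rewrite RintegralD ?RintegralZl//; exact: integrable_mulrl.
Qed.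

Lemma eq_Cintegral f g : f =1 g -> Cintegral f = Cintegral g.
Proof. by move=> /funext ->. Qed.

(** The factor 2 comes from the separate bounds on the real and imaginary parts. *)
Lemma normc_Cintegral f (a : E -> R) : Cmeasurable f ->
  (forall x, normc (f x) <= a x) -> leb.-integrable setT (EFin \o a) ->
  normc (Cintegral f) <= 2 * \int[leb]_x a x.
Proof.
move=> [f1 f2] fa ia; apply: le_trans (normc_le _) _; rewrite mulr2n mulrDl mul1r /=.
apply: lerD.
  by apply: le_norm_Rintegral => // x; exact: le_trans (Re_le_normc _) (fa x).
by apply: le_norm_Rintegral => // x; exact: le_trans (Im_le_normc _) (fa x).
Qed.

Lemma Cintegral_affine (a : E) (e : R) f : 0 < e -> Cintegrable f ->
  Cintegrable (fun u => f (a + e *: u)) /\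
  Cintegral (fun u => f (a + e *: u)) = (e ^- d)%:C * Cintegral f.
Proof.
move=> e0 [f1 f2].
have [h1 h2] := Rintegral_affine a e0 f1; have [h3 h4] := Rintegral_affine a e0 f2.
split=> //; apply: complex_eq; rewrite ?cReM ?cImM /= ?mul0r ?subr0 ?addr0//.
Qed.

Section cfubini.
Variables (f : E * E -> C) (a b : E -> R).
Hypothesis mf : cmeasurable f.
Hypothesis ia : leb.-integrable setT (EFin \o a).
Hypothesis ib : leb.-integrable setT (EFin \o b).
Hypothesis fab : forall x y, normc (f (x, y)) <= a x * b y.

Let fRe x y : `|Re (f (x, y))| <= a x * b y.
Proof. exact: le_trans (Re_le_normc _) (fab _ _). Qed.

Let fIm x y : `|Im (f (x, y))| <= a x * b y.
Proof. exact: le_trans (Im_le_normc _) (fab _ _). Qed.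

Lemma Cfubini_inner x : Cintegrable (fun y => f (x, y)).
Proof.
split.
  exact: (@dominated_integrable_l _ _ (fun z => Re (f z)) _ _ mf.1 ib fRe).
exact: (@dominated_integrable_l _ _ (fun z => Im (f z)) _ _ mf.2 ib fIm).
Qed.

Lemma Cfubini_outer : Cintegrable (fun x => Cintegral (fun y => f (x, y))).
Proof.
split.
  exact: (@dominated_fubini_l _ _ (fun z => Re (f z)) _ _ mf.1 ia ib fRe).
exact: (@dominated_fubini_l _ _ (fun z => Im (f z)) _ _ mf.2 ia ib fIm).
Qed.

Lemma Cfubini : Cintegral (fun x => Cintegral (fun y => f (x, y))) =
  Cintegral (fun y => Cintegral (fun x => f (x, y))).
Proof.
apply: complex_eq => /=.
  exact: (@dominated_fubini _ _ (fun z => Re (f z)) _ _ mf.1 ia ib fRe).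
exact: (@dominated_fubini _ _ (fun z => Im (f z)) _ _ mf.2 ia ib fIm).
Qed.

End cfubini.

Lemma Rdominated_cvg (f_ : nat -> E -> R) (f a : E -> R) :
  (forall n, measurable_fun setT (f_ n)) ->
  (forall n x, `|f_ n x| <= a x) -> leb.-integrable setT (EFin \o a) ->
  (forall x, f_ n x @[n --> \oo] --> f x) ->
  \int[leb]_x f_ n x @[n --> \oo] --> \int[leb]_x f x.
Proof.
move=> mf fa ia fc.
have fcE x : (f_ n x)%:E @[n --> \oo] --> (f x)%:E.
  apply: cvg_EFin; [exact: nearW|exact: fc].
have h : (\int[leb]_x (f_ n x)%:E)%E @[n --> \oo] --> (\int[leb]_x (f x)%:E)%E.
  apply: (@dominated_cvg _ _ _ leb setT measurableT (fun n x => (f_ n x)%:E)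
    (fun x => (f x)%:E) (EFin \o a)) => //.
  - by move=> n; exact/measurable_EFinP.
  - by move=> n x _ /=; rewrite lee_fin.
rewrite /Rintegral; apply: fine_cvg; rewrite fineK//.
apply: integrable_fin_num => //; apply: (@integrable_le _ _ f a) => // [|x].
  by apply: (measurable_fun_cvg mf) => x _; exact: fc.
apply: (@closed_cvg _ _ \oo _ (fun n => `|f_ n x|) [set y : R | y <= a x]).
- exact: closed_le.
- by apply: nearW => n; exact: fa.
- by apply: cvg_norm; exact: fc.
Qed.

Definition ccvg (u : nat -> C) (l : C) : Prop :=
  Re (u n) @[n --> \oo] --> Re l /\ Im (u n) @[n --> \oo] --> Im l.

Lemma ccvg_unique u l l' : ccvg u l -> ccvg u l' -> l = l'.
Proof.
move=> [h1 h2] [h3 h4]; apply: complex_eq.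
  exact: (cvg_unique _ h1 h3).
exact: (cvg_unique _ h2 h4).
Qed.

Lemma ccvgM u v l l' : ccvg u l -> ccvg v l' -> ccvg (fun n => u n * v n) (l * l').
Proof.
move=> [h1 h2] [h3 h4]; split.
  under eq_fun do rewrite cReM; rewrite cReM.
  exact: (cvgB (cvgM h1 h3) (cvgM h2 h4)).
under eq_fun do rewrite cImM; rewrite cImM.
exact: (cvgD (cvgM h1 h4) (cvgM h2 h3)).
Qed.

Lemma ccvg_cst l : ccvg (fun=> l) l.
Proof. by split; exact: cvg_cst. Qed.

Lemma ccvg_real (u : nat -> R) (l : R) : u n @[n --> \oo] --> l ->
  ccvg (fun n => (u n)%:C) l%:C.
Proof. by move=> h; split => //=; exact: cvg_cst. Qed.

Lemma Cdominated_cvg (f_ : nat -> E -> C) f (a : E -> R) :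
  (forall n, Cmeasurable (f_ n)) -> (forall n x, normc (f_ n x) <= a x) ->
  leb.-integrable setT (EFin \o a) -> (forall x, ccvg (f_ ^~ x) (f x)) ->
  ccvg (fun n => Cintegral (f_ n)) (Cintegral f).
Proof.
move=> mf fa ia fc; split.
  apply: (@Rdominated_cvg (fun n x => Re (f_ n x)) (fun x => Re (f x)) a) => //.
  - by move=> n; exact: (mf n).1.
  - by move=> n x; exact: le_trans (Re_le_normc _) (fa n x).
  - by move=> x; exact: (fc x).1.
apply: (@Rdominated_cvg (fun n x => Im (f_ n x)) (fun x => Im (f x)) a) => //.
- by move=> n; exact: (mf n).2.
- by move=> n x; exact: le_trans (Im_le_normc _) (fa n x).
- by move=> x; exact: (fc x).2.
Qed.

End complex_integral.

(** * Partial derivatives of complex functions *)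

Section partial_derivatives.
Variables (R : realType) (d : nat).
Local Notation E := 'rV[R]_d.
Local Notation C := R[i].
Local Notation ei i := (delta_mx 0 i : E).
Implicit Types (f g : E -> C) (u : E -> R).

Lemma derive_slice u (x v : E) (t : R) :
  (fun h : R => h^-1 *: ((u \o shift (x + t *: v)) (h *: v) - u (x + t *: v))) =
  (fun h : R => h^-1 *: (((fun s : R => u (x + s *: v)) \o shift t) (h *: 1)
     - u (x + t *: v))).
Proof.
apply/funext => h /=; congr (_ *: (u _ - _)).
by rewrite /shift /= -[h *: 1]/(h * 1) mulr1 scalerDl addrCA.
Qed.

(** A directional derivative is a derivative in one real variable, to which the
    chain rule and differentiation under the integral sign apply. *)
Lemma is_derive_slice u (x v : E) (t l : R) :
  is_derive (x + t *: v) v u l <-> is_derive t 1 (fun s : R => u (x + s *: v)) l.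
Proof.
split=> [] [h1 h2]; split.
- by move: h1; rewrite /derivable (derive_slice u x v t).
- by rewrite -h2 /derive (derive_slice u x v t).
- by rewrite /derivable (derive_slice u x v t).
- by rewrite -h2 /derive (derive_slice u x v t).
Qed.

Lemma is_derive_at u (x v : E) (l : R) :
  is_derive x v u l <-> is_derive (0 : R) 1 (fun s : R => u (x + s *: v)) l.
Proof.
have := is_derive_slice u x v 0 l; rewrite scale0r addr0; exact.
Qed.

Definition has_partial f i x (l : C) : Prop :=
  is_derive x (ei i) (fun y => Re (f y)) (Re l) /\
  is_derive x (ei i) (fun y => Im (f y)) (Im l).

Lemma has_partialD f g i x l m : has_partial f i x l -> has_partial g i x m ->
  has_partial (fun y => f y + g y) i x (l + m).
Proof.
move=> [f1 f2] [g1 g2]; split.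
  by rewrite cReD; under eq_fun do rewrite cReD; exact: is_deriveD.
by rewrite cImD; under eq_fun do rewrite cImD; exact: is_deriveD.
Qed.

Lemma has_partialM f g i x l m : has_partial f i x l -> has_partial g i x m ->
  has_partial (fun y => f y * g y) i x (l * g x + f x * m).
Proof.
move=> [f1 f2] [g1 g2]; split.
  under eq_fun do rewrite cReM.
  apply: (is_derive_eq (is_deriveB (is_deriveM f1 g1) (is_deriveM f2 g2))).
  by rewrite cReD !cReM /GRing.scale /=; ring.
under eq_fun do rewrite cImM.
apply: (is_derive_eq (is_deriveD (is_deriveM f1 g2) (is_deriveM f2 g1))).
by rewrite cImD !cImM /GRing.scale /=; ring.
Qed.

Lemma has_partial_cst c i x : has_partial (fun=> c) i x 0.
Proof. by split; exact: is_derive_cst. Qed.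

Lemma is_derive_coord i j (x : E) :
  is_derive x (ei i) (fun y : E => y 0 j) (i == j)%:R.
Proof.
apply/is_derive_at.
rewrite (_ : (fun s : R => _) = (fun s => x 0 j + s * (i == j)%:R)); last first.
  by apply/funext => s; rewrite !mxE eqxx/= eq_sym.
have := is_deriveD (is_derive_cst (x 0 j) (0 : R) (1 : R))
   (is_deriveM (is_derive_id (0 : R) (1 : R)) (is_derive_cst ((i == j)%:R : R) (0:R) (1 : R))).
move=> h; apply: (is_derive_eq h).
by rewrite add0r scaler0 add0r /GRing.scale /= mulr1.
Qed.

Lemma has_partial_coord i j x :
  has_partial (fun y : E => (y 0 j)%:C) i x (i == j)%:R%:C.
Proof. by split => /=; [exact: is_derive_coord|exact: is_derive_cst]. Qed.

Lemma is_derive_dilate u i x (c l : R) : is_derive (c *: x) (ei i) u l ->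
  is_derive x (ei i) (fun y => u (c *: y)) (c * l).
Proof.
move=> /is_derive_at h; apply/is_derive_at.
rewrite (_ : (fun s : R => _) =
  (fun s : R => u (c *: x + s *: ei i)) \o (fun s => c * s)); last first.
  by apply/funext => s /=; rewrite scalerDr scalerA.
rewrite mulrC; apply: is_derive1_comp; first by rewrite mulr0.
by have := is_deriveZ c (is_derive_id (0 : R) (1 : R)); rewrite /GRing.scale /= mulr1.
Qed.

Lemma has_partial_dilate f i x (c : R) l : has_partial f i (c *: x) l ->
  has_partial (fun y => f (c *: y)) i x (c%:C * l).
Proof.
move=> [f1 f2]; split.
  by rewrite cReM /= mul0r subr0; exact: is_derive_dilate.
by rewrite cImM /= mul0r addr0; exact: is_derive_dilate.
Qed.

Lemma has_partial_val f i x l : has_partial f i x l -> partial [:: i] f x = l.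
Proof. by move=> [[_ h1] [_ h2]]; apply: complex_eq; rewrite /partial /= -?h1 -?h2. Qed.

End partial_derivatives.

(** * The Schwartz space *)

Section schwartz_calculus.
Variables (R : realType) (d : nat).
Local Notation E := 'rV[R]_d.
Local Notation C := R[i].
Implicit Types (f g : E -> C) (u : E -> R).

Definition rapid f : Prop :=
  forall N : nat, exists B : R, forall x, (1 + enorm x) ^+ N * normc (f x) <= B.

Definition ccontinuous f : Prop :=
  continuous (fun x => Re (f x)) /\ continuous (fun x => Im (f x)).

Lemma rpartial_rcons s i u : rpartial (rcons s i) u = rpartial s (rpartial [:: i] u).
Proof. by rewrite /rpartial foldr_rcons. Qed.

(** When a class of functions is closed under partial derivatives, bounds on the
    functions alone are bounds on all their derivatives. It is applied to functions
    built from Schwartz functions, to Fourier transforms and to functions supported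
    in a fixed compact set. *)
Lemma schwartz_criterion (P : (E -> C) -> Prop) :
  (forall f, P f -> rapid f) -> (forall f, P f -> ccontinuous f) ->
  (forall f i, P f -> exists2 g, P g & forall x, has_partial f i x (g x)) ->
  forall f, P f -> is_schwartz f.
Proof.
move=> Pr Pc Pd.
have Ps f s : P f -> exists2 g, P g &
    rpartial s (fun x => Re (f x)) = (fun x => Re (g x)) /\
    rpartial s (fun x => Im (f x)) = (fun x => Im (g x)).
  move=> Pf; elim: s => [|i s [g Pg [h1 h2]]]; first by exists f.
  have [g' Pg' hg'] := Pd g i Pg; exists g' => //=.
  rewrite h1 h2; split; apply/funext => x; have [[_ h3] [_ h4]] := hg' x; by [].
have bnd N M : forall f, P f -> exists B : R, forall s x, (size s <= M)%N ->
    (1 + enorm x) ^+ N * normc (partial s f x) <= B.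
  (* The innermost derivative is removed first: it stays in the class [P]. *)
  elim: M => [|M ih] f Pf.
    have [B hB] := Pr f Pf N; exists B => s x; rewrite leqn0 size_eq0 => /eqP ->.
    by rewrite /partial /=; move: (hB x); case: (f x).
  have [B hB] := Pr f Pf N.
  have /choice[D hD] : forall i, exists D : R, forall s x, (size s <= M)%N ->
      (1 + enorm x) ^+ N * normc (partial (rcons s i) f x) <= D.
    move=> i; have [g Pg hg] := Pd f i Pf; have [D hD] := ih g Pg.
    exists D => s x sM; rewrite (_ : partial _ f x = partial s g x); first exact: hD.
    have E1 : rpartial [:: i] (fun x => Re (f x)) = fun x => Re (g x).
      by apply/funext => y; have [[_ h3] [_ h4]] := hg y.
    have E2 : rpartial [:: i] (fun x => Im (f x)) = fun x => Im (g x).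
      by apply/funext => y; have [[_ h3] [_ h4]] := hg y.
    by rewrite /partial !rpartial_rcons E1 E2.
  exists (`|B| + \sum_i `|D i|) => s x; case/lastP: s => [_|s i].
    apply: (@le_trans _ _ B).
      by rewrite /partial /=; move: (hB x); case: (f x).
    by rewrite (le_trans (ler_norm B))// lerDl sumr_ge0.
  rewrite size_rcons ltnS => sM; apply: (le_trans (hD i s x sM)).
  rewrite (le_trans (ler_norm _))// (bigD1 i)//= addrCA lerDl addr_ge0// sumr_ge0//.
move=> f Pf; split.
  split=> s; have [g Pg [h1 h2]] := Ps f s Pf; rewrite ?h1 ?h2.
    split; first exact: (Pc g Pg).1.
    by move=> i x; have [g' _ hg'] := Pd g i Pg; have [[]] := hg' x.
  split; first exact: (Pc g Pg).2.
  by move=> i x; have [g' _ hg'] := Pd g i Pg; have [_ []] := hg' x.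
move=> N; have [B hB] := bnd N N f Pf.
apply: (@le_lt_trans _ _ B%:E); last exact: ltry.
by apply: ge_ereal_sup => _ [s [x [sN ->]]]; rewrite lee_fin hB.
Qed.

Lemma schwartz_rapid f : is_schwartz f -> rapid f.
Proof.
move=> [_ h] N; have := h N; rewrite -ge0_fin_numE ?seminorm_ge0// => hfin.
exists (fine (seminorm N f)) => x; rewrite -lee_fin fineK//.
apply: ereal_sup_ubound; exists [::], x; split => //.
by rewrite /partial /=; case: (f x).
Qed.

Lemma schwartz_continuous f : is_schwartz f -> ccontinuous f.
Proof. by move=> [[h1 h2] _]; split; [have [] := h1 [::]|have [] := h2 [::]]. Qed.

Lemma schwartz_has_partial f i x : is_schwartz f ->
  has_partial f i x (partial [:: i] f x).
Proof.
move=> [[h1 h2] _]; split; split=> //.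
  by have [_] := h1 [::]; exact.
by have [_] := h2 [::]; exact.
Qed.

Lemma schwartz_partial f i : is_schwartz f -> is_schwartz (partial [:: i] f).
Proof.
move=> [[h1 h2] h3].
have e s : rpartial s (fun x => Re (partial [:: i] f x)) =
    rpartial (rcons s i) (fun x => Re (f x)).
  by rewrite /rpartial foldr_rcons.
have e' s : rpartial s (fun x => Im (partial [:: i] f x)) =
    rpartial (rcons s i) (fun x => Im (f x)).
  by rewrite /rpartial foldr_rcons.
split; first by split=> s; rewrite ?e ?e'.
move=> N; apply: le_lt_trans (h3 N.+1); apply: ge_ereal_sup => _ [s [x [sN ->]]].
apply: (@le_trans _ _ ((1 + enorm x) ^+ N.+1 * normc (partial (rcons s i) f x))%:E); last first.
  by apply: ereal_sup_ubound; exists (rcons s i), x; rewrite size_rcons.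
rewrite lee_fin [partial s _ x](_ : _ = partial (rcons s i) f x); last first.
  by rewrite /partial e e'.
rewrite ler_wpM2r ?normc_ge0// ler_weXn2l//.
by rewrite lerDl enorm_ge0.
Qed.

Lemma coord_le_enorm (x : E) i : `|x 0 i| <= enorm x.
Proof.
rewrite -sqrtr_sqr /enorm ler_wsqrtr// /dotv (bigD1 i)//= -expr2 lerDl.
by apply: sumr_ge0 => j _; rewrite -expr2 sqr_ge0.
Qed.

Lemma enormZ (c : R) (x : E) : enorm (c *: x) = `|c| * enorm x.
Proof.
rewrite -sqrtr_sqr -sqrtrM ?sqr_ge0//; congr Num.sqrt.
by rewrite /dotv mulr_sumr; apply: eq_bigr => i _; rewrite !mxE; ring.
Qed.

Lemma enorm_le_sum (x : E) : enorm x <= \sum_i `|x 0 i|.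
Proof.
have S0 : 0 <= \sum_i `|x 0 i| by exact: sumr_ge0.
rewrite -[leRHS]ger0_norm// -sqrtr_sqr ler_wsqrtr// expr2 mulr_sumr.
apply: ler_sum => i _; rewrite -expr2 -real_normK ?num_real// expr2 ler_wpM2r//.
by rewrite (bigD1 i)//= lerDl sumr_ge0.
Qed.

(** No single operation gives a class closed under derivatives: those of a
    product or of a multiple by a coordinate are sums of such functions. Hence one
    class for all the operations. *)
Inductive schwartz_generated : (E -> C) -> Prop :=
| SG_base f : is_schwartz f -> schwartz_generated f
| SG_add f g : schwartz_generated f -> schwartz_generated g ->
    schwartz_generated (fun x => f x + g x)
| SG_mul f g : schwartz_generated f -> schwartz_generated g ->
    schwartz_generated (fun x => f x * g x)
| SG_scale c f : schwartz_generated f -> schwartz_generated (fun x => c * f x)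
| SG_coord i f : schwartz_generated f ->
    schwartz_generated (fun x => (x 0 i)%:C * f x)
| SG_dilate (c : R) f : 0 < c -> schwartz_generated f ->
    schwartz_generated (fun x => f (c *: x)).

Lemma schwartz_generatedP f : schwartz_generated f -> is_schwartz f.
Proof.
have e1 (x : E) : 1 <= 1 + enorm x by rewrite lerDl enorm_ge0.
have e0 (x : E) : 0 <= 1 + enorm x by exact: le_trans (e1 x).
move: f; apply: schwartz_criterion => [f|f|f i].
- elim=> {f} [f|f g _ h1 _ h2|f g _ h1 _ h2|c f _ h|i f _ h|c f c0 _ h] => [|N|N|N|N|N].
  + exact: schwartz_rapid.
  + have [B hB] := h1 N; have [D hD] := h2 N; exists (B + D) => x.
    apply: le_trans (lerD (hB x) (hD x)); rewrite -mulrDr ler_wpM2l ?exprn_ge0//.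
    exact: le_normcD.
  + have [B hB] := h1 N; have [D hD] := h2 0%N; exists (B * D) => x.
    rewrite Normc.normcM mulrA; apply: ler_pM (hB x) _; rewrite ?mulr_ge0 ?exprn_ge0 ?normc_ge0//.
    by have := hD x; rewrite expr0 mul1r.
  + have [B hB] := h N; exists (normc c * B) => x.
    by rewrite Normc.normcM mulrCA ler_wpM2l ?normc_ge0.
  + have [B hB] := h N.+1; exists B => x; apply: le_trans (hB x).
    rewrite Normc.normcM normcR mulrA exprSr ler_wpM2r ?normc_ge0//.
    rewrite ler_wpM2l ?exprn_ge0//.
    by rewrite (le_trans (coord_le_enorm x i))// lerDr.
  + have [B hB] := h N; exists ((1 + c^-1) ^+ N * B) => x.
    apply: (@le_trans _ _ ((1 + c^-1) ^+ N * ((1 + enorm (c *: x)) ^+ N * normc (f (c *: x))))).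
      rewrite mulrA -exprMn ler_wpM2r ?normc_ge0// lerXn2r ?nnegrE ?mulr_ge0 ?addr_ge0 ?enorm_ge0 ?invr_ge0 ?(ltW c0)//.
      rewrite enormZ gtr0_norm// mulrDl mul1r mulrDr mulr1 mulrA mulVf ?gt_eqF// mul1r.
      have h1 : 0 <= c * enorm x by rewrite mulr_ge0 ?enorm_ge0 ?(ltW c0).
      have h2 : 0 <= c^-1 by rewrite invr_ge0 ltW.
      by lra.
    by rewrite ler_wpM2l// exprn_ge0// addr_ge0// invr_ge0 ltW.
- elim=> {f} [f|f g _ [f1 f2] _ [g1 g2]|f g _ [f1 f2] _ [g1 g2]|c f _ [f1 f2]|i f _ [f1 f2]|c f c0 _ [f1 f2]].
  + exact: schwartz_continuous.
  + split=> x.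
      by under eq_fun do rewrite cReD; exact: (cvgD (f1 x) (g1 x)).
    by under eq_fun do rewrite cImD; exact: (cvgD (f2 x) (g2 x)).
  + split=> x.
      under eq_fun do rewrite cReM.
      exact: (cvgB (cvgM (f1 x) (g1 x)) (cvgM (f2 x) (g2 x))).
    under eq_fun do rewrite cImM.
    exact: (cvgD (cvgM (f1 x) (g2 x)) (cvgM (f2 x) (g1 x))).
  + split=> x.
      under eq_fun do rewrite cReM.
      exact: (cvgB (cvgM (cvg_cst _) (f1 x)) (cvgM (cvg_cst _) (f2 x))).
    under eq_fun do rewrite cImM.
    exact: (cvgD (cvgM (cvg_cst _) (f2 x)) (cvgM (cvg_cst _) (f1 x))).
  + split=> x.
      under eq_fun do rewrite cReM /= mul0r subr0.
      exact: (cvgM (@coord_continuous _ _ _ 0 i x) (f1 x)).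
    under eq_fun do rewrite cImM /= mul0r addr0.
    exact: (cvgM (@coord_continuous _ _ _ 0 i x) (f2 x)).
  + split=> x.
      exact: (continuous_comp (@scaler_continuous _ _ c x) (f1 (c *: x))).
    exact: (continuous_comp (@scaler_continuous _ _ c x) (f2 (c *: x))).
- elim=> {f} [f sf|f g Sf [f' h1 h1'] Sg [g' h2 h2']
     |f g Sf [f' h1 h1'] Sg [g' h2 h2']
     |c f _ [f' h1 h1']|j f Sf [f' h1 h1']|c f c0 _ [f' h1 h1']].
  + exists (partial [:: i] f); first by apply: SG_base; exact: schwartz_partial.
    by move=> x; exact: schwartz_has_partial.
  + exists (fun x => f' x + g' x); first exact: SG_add.
    by move=> x; exact: has_partialD.
  + exists (fun x => f' x * g x + f x * g' x).
      by apply: SG_add; exact: SG_mul.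
    by move=> x; exact: has_partialM.
  + exists (fun x => c * f' x); first exact: SG_scale.
    move=> x; have := has_partialM (has_partial_cst c i x) (h1' x).
    by rewrite mul0r add0r.
  + exists (fun x => (i == j)%:R%:C * f x + (x 0 j)%:C * f' x).
      by apply: SG_add; [exact: SG_scale|exact: SG_coord].
    by move=> x; apply: has_partialM => //; exact: has_partial_coord.
  + exists (fun x => c%:C * f' (c *: x)).
      exact: (SG_scale c%:C (SG_dilate c0 h1)).
    by move=> x; exact: has_partial_dilate.
Qed.

Lemma schwartzD f g : is_schwartz f -> is_schwartz g ->
  is_schwartz (fun x => f x + g x).
Proof. by move=> sf sg; apply/schwartz_generatedP/SG_add; exact: SG_base. Qed.

Lemma schwartzM f g : is_schwartz f -> is_schwartz g ->
  is_schwartz (fun x => f x * g x).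
Proof. by move=> sf sg; apply/schwartz_generatedP/SG_mul; exact: SG_base. Qed.

Lemma schwartzZ c f : is_schwartz f -> is_schwartz (fun x => c * f x).
Proof. by move=> sf; apply/schwartz_generatedP/SG_scale; exact: SG_base. Qed.

Lemma schwartz_coord i f : is_schwartz f ->
  is_schwartz (fun x => (x 0 i)%:C * f x).
Proof. by move=> sf; apply/schwartz_generatedP/SG_coord; exact: SG_base. Qed.

Lemma schwartz_dilate (c : R) f : 0 < c -> is_schwartz f ->
  is_schwartz (fun x => f (c *: x)).
Proof. by move=> c0 sf; apply/schwartz_generatedP/SG_dilate => //; exact: SG_base. Qed.

Lemma ccontinuous_measurable f : ccontinuous f -> Cmeasurable f.
Proof. by move=> [h1 h2]; split; exact: continuous_measurable_rV. Qed.

Lemma schwartz_measurable f : is_schwartz f -> Cmeasurable f.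
Proof. by move=> /schwartz_continuous/ccontinuous_measurable. Qed.

(** One factor [weight x] can absorb a translation, by [weight_shift], and the other
    one remains for integrability. *)
Lemma schwartz_weight2 f : is_schwartz f ->
  exists2 B : R, 0 <= B & forall x, normc (f x) <= B * weight x ^+ 2.
Proof.
move=> /schwartz_rapid/(_ (2 * d * 2)%N)[B hB].
have h x : normc (f x) <= B * weight x ^+ 2.
  have w0 := weight_gt0 x.
  rewrite -ler_pdivrMr ?exprn_gt0// mulrC -exprVn.
  apply: le_trans (hB x); rewrite ler_wpM2r ?normc_ge0// exprM.
  by rewrite lerXn2r ?nnegrE ?invr_ge0 ?exprn_ge0 ?addr_ge0 ?enorm_ge0 ?(ltW w0)// weight_enorm.
exists B => //; have := le_trans (normc_ge0 _) (h 0).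
by rewrite pmulr_lge0// exprn_gt0// weight_gt0.
Qed.

Lemma schwartz_weight f : is_schwartz f ->
  exists2 B : R, 0 <= B & forall x, normc (f x) <= B * weight x.
Proof.
move=> /schwartz_weight2[B B0 hB]; exists B => // x; apply: le_trans (hB x) _.
by rewrite ler_wpM2l// expr2 ler_piMr ?weight_ge0 ?weight_le1.
Qed.

Lemma schwartz_integrable f : is_schwartz f -> Cintegrable f.
Proof.
move=> sf; have [B B0 hB] := schwartz_weight sf.
apply: (Cintegrable_le (schwartz_measurable sf) hB).
by apply: integrable_mulrl; exact: integrable_weight.
Qed.

End schwartz_calculus.

(** * The Fourier transform *)

Section fourier_transform.
Variables (R : realType) (d : nat).
Local Notation E := 'rV[R]_d.
Local Notation C := R[i].
Local Notation ei i := (delta_mx 0 i : E).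
Local Notation leb := (lebesgue_rV R d).
Implicit Types (f g psi m : E -> C) (u : E -> R) (sg : R).

Lemma dotvC (x y : E) : dotv x y = dotv y x.
Proof. by apply: eq_bigr => i _; rewrite mulrC. Qed.

Lemma dotvDr (x y z : E) : dotv x (y + z) = dotv x y + dotv x z.
Proof. by rewrite /dotv -big_split; apply: eq_bigr => i _; rewrite mxE mulrDr. Qed.

Lemma dotvZr (x y : E) c : dotv x (c *: y) = c * dotv x y.
Proof. by rewrite /dotv mulr_sumr; apply: eq_bigr => i _; rewrite mxE mulrCA. Qed.

Lemma dotv_delta (x : E) i : dotv x (ei i) = x 0 i.
Proof.
rewrite /dotv (bigD1 i)//= !mxE !eqxx mulr1 big1 ?addr0// => j ji.
by rewrite mxE (negbTE ji) andbF mulr0.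
Qed.

Lemma measurable_dotv_pair :
  measurable_fun setT (fun z : E * E => dotv z.1 z.2).
Proof.
apply: measurable_sum => i; apply: measurable_funM.
  exact: (measurableT_comp (measurable_coord 0 i) measurable_fst).
exact: (measurableT_comp (measurable_coord 0 i) measurable_snd).
Qed.

Lemma measurable_dotv (y : E) : measurable_fun setT (fun x : E => dotv x y).
Proof. exact: (measurableT_comp measurable_dotv_pair (measurable_pair2 y)). Qed.

Definition fourier_cst : C := ((2 * pi) `^ (- (d%:R / 2)))%:C.

Fact ft_key : unit. Proof. exact: tt. Qed.

(** The two signs [sg = -1] and [sg = 1] give the transform and its inverse. *)
Definition ft := locked_with ft_key (fun sg f (xi : E) =>
  fourier_cst * Cintegral (fun x => cis (sg * dotv x xi) * f x)).

Lemma ftE sg f xi :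
  ft sg f xi = fourier_cst * Cintegral (fun x => cis (sg * dotv x xi) * f x).
Proof. by rewrite [ft]unlock. Qed.

Lemma fourierE f : fourier f = ft (-1) f.
Proof.
by apply/funext => xi; rewrite ftE /fourier; under [in RHS]eq_Cintegral do rewrite mulN1r.
Qed.

Lemma inv_fourierE f : inv_fourier f = ft 1 f.
Proof.
apply/funext => xi; rewrite ftE /inv_fourier.
by under [in RHS]eq_Cintegral do rewrite mul1r dotvC.
Qed.

Lemma cis_measurable sg (xi : E) : Cmeasurable (fun x => cis (sg * dotv x xi) : C).
Proof. by apply: cmeasurable_cis; apply: measurable_funM => //; exact: measurable_dotv. Qed.

Lemma ft_integrable sg f xi : Cmeasurable f -> Cintegrable f ->
  Cintegrable (fun x => cis (sg * dotv x xi) * f x).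
Proof.
move=> mf [f1 f2]; apply: (@Cintegrable_le _ _ _ (fun x => `|Re (f x)| + `|Im (f x)|)).
- exact: (cmeasurableM (cis_measurable sg xi) mf).
- by move=> x; rewrite Normc.normcM normc_cis mul1r normc_le.
- by apply: integrable_addr; exact: integrable_norm.
Qed.

Lemma schwartz_ft_integrable sg f xi : is_schwartz f ->
  Cintegrable (fun x => cis (sg * dotv x xi) * f x).
Proof. by move=> sf; apply: ft_integrable; [exact: schwartz_measurable|exact: schwartz_integrable]. Qed.

Lemma ft_lc sg c f g : is_schwartz f -> is_schwartz g ->
  forall xi, ft sg (fun x => c * f x + g x) xi = c * ft sg f xi + ft sg g xi.
Proof.
move=> sf sg' xi; rewrite !ftE.
rewrite (@eq_Cintegral _ _ _ (fun x => c * (cis (sg * dotv x xi) * f x) + cis (sg * dotv x xi) * g x)); last first.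
  by move=> x; rewrite mulrDr mulrCA.
have h := schwartz_ft_integrable sg xi sf.
rewrite CintegralD ?CintegralZ//; last 2 first.
- exact: CintegrableZ.
- exact: schwartz_ft_integrable.
by rewrite mulrDr mulrCA.
Qed.

Lemma ftZ sg c f : is_schwartz f -> forall xi, ft sg (fun x => c * f x) xi = c * ft sg f xi.
Proof.
move=> sf xi; rewrite !ftE.
rewrite (@eq_Cintegral _ _ _ (fun x => c * (cis (sg * dotv x xi) * f x))); last first.
  by move=> x; rewrite mulrCA.
rewrite CintegralZ; last exact: schwartz_ft_integrable.
exact: mulrCA.
Qed.

Lemma ft_bounded sg f : is_schwartz f -> exists B : R, forall xi, normc (ft sg f xi) <= B.
Proof.
move=> sf; have [B B0 hB] := schwartz_weight sf.
exists (normc fourier_cst * (2 * \int[leb]_x (B * weight x))) => xi.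
rewrite ftE Normc.normcM ler_wpM2l ?normc_ge0//; apply: normc_Cintegral.
- exact: (cmeasurableM (cis_measurable sg xi) (schwartz_measurable sf)).
- by move=> x; rewrite Normc.normcM normc_cis mul1r.
- by apply: integrable_mulrl; exact: integrable_weight.
Qed.

Lemma integral_partial0 (u u' : E -> R) i (B : R) :
  (forall x, is_derive x (ei i) u (u' x)) ->
  measurable_fun setT u -> measurable_fun setT u' ->
  (forall x, `|u x| <= B * weight x) -> (forall x, `|u' x| <= B * weight x) ->
  \int[leb]_x u' x = 0.
Proof.
move=> du mu mu' bu bu'.
have iw c : leb.-integrable setT (EFin \o (fun x => c * weight x)).
  by apply: integrable_mulrl; exact: integrable_weight.
have iu : leb.-integrable setT (EFin \o u) by exact: integrable_le bu _.
have B0 : 0 <= B.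
  by have := le_trans (normr_ge0 _) (bu 0); rewrite pmulr_lge0// weight_gt0.
pose f (t : R) (x : E) := u (x + t *: ei i).
have fE t x : f t x = u (t *: ei i + 1 *: x) by rewrite /f scale1r addrC.
have aff t : leb.-integrable setT (EFin \o f t) /\ \int[leb]_x f t x = \int[leb]_x u x.
  have [h1 h2] := Rintegral_affine (t *: ei i) ltr01 iu.
  split; first by rewrite (funext (fE t)).
  by rewrite (funext (fE t)) h2 expr1n invr1 mul1r.
have wt (t : R) (x : E) : `|t| < 1 -> weight (x + t *: ei i) <= 2 ^+ d * 2 * weight x.
  move=> t1; have := weight_shift x (- (t *: ei i)); rewrite opprK weightN => h.
  have w2 : 2^-1 <= weight (t *: ei i).
    rewrite /weight (bigD1 i)//= big1 => [|j ji]; last first.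
      by rewrite !mxE (negbTE ji) andbF mulr0 expr0n addr0 invr1.
    rewrite !mxE !eqxx mulr1 mulr1 lef_pV2 ?posrE ?ltr_wpDr ?sqr_ge0//.
    have -> : 2 = 1 + 1 :> R by [].
    by rewrite lerD2l -real_normK ?num_real// expr_le1// ltW.
  have h' : weight (x + t *: ei i) * 2^-1 <= 2 ^+ d * weight x.
    by apply: le_trans h; rewrite ler_wpM2l// weight_ge0.
  by move: h'; rewrite ler_pdivrMr// mulrAC.
have dpar (t : R) (x : E) : is_derive t (1 : R) (f^~ x) (u' (x + t *: ei i)).
  by apply/is_derive_slice; exact: du.
have I0 : `](-1), 1[%classic (0 : R) by rewrite /= in_itv/= ltrN10 ltr01.
pose G (x : E) := B * (2 ^+ d * 2) * weight x.
have h := @differentiation_under_integral R _ _ leb f setT measurableT 0 (-1) 1 I0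
  (fun t _ => (aff t).1) (fun t x _ _ => (let: DeriveDef h _ := dpar t x in h)) G.
have := h _ _ _; rewrite (_ : partial1of2 f 0 = u'); last first.
  apply/funext => x; rewrite partial1of2E; have [_ ->] := dpar 0 x.
  by rewrite scale0r addr0.
move=> <-.
- rewrite (_ : (fun x' : R => _) = cst (\int[leb]_x u x)) ?derive1_cst//.
  by apply/funext => t; exact: (aff t).2.
- by move=> x; rewrite /G !mulr_ge0 ?weight_ge0 ?exprn_ge0.
- exact: iw.
- move=> t x; rewrite /= in_itv/= => t1 _; rewrite partial1of2E.
  have [_ ->] := dpar t x; apply: le_trans (bu' _) _.
  by rewrite /G -mulrA ler_wpM2l// wt// ltr_norml.
Qed.

End fourier_transform.

(** * The Fourier transform preserves the Schwartz space *)

Section fourier_schwartz.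
Variables (R : realType) (d : nat).
Local Notation E := 'rV[R]_d.
Local Notation C := R[i].
Local Notation ei i := (delta_mx 0 i : E).
Local Notation leb := (lebesgue_rV R d).
Implicit Types (f g psi m : E -> C) (u : E -> R) (sg : R).

Lemma is_derive_cis_affine (a b t : R) (z : C) :
  is_derive t (1 : R) (fun s => Re (cis (a + s * b) * z))
    (Re ((0 +i* b) * (cis (a + t * b) * z))).
Proof.
have hl : is_derive t (1 : R) (fun s : R => a + s * b) b.
  have := is_deriveD (is_derive_cst a t (1 : R))
    (is_deriveM (is_derive_id t (1 : R)) (is_derive_cst b t (1 : R))).
  move=> h; apply: (is_derive_eq h).
  by rewrite add0r scaler0 add0r /GRing.scale /= mulr1.
have hc := @is_derive1_comp _ cos (fun s => a + s * b) _ _ _ (is_derive_cos (a + t * b)) hl.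
have hs := @is_derive1_comp _ sin (fun s => a + s * b) _ _ _ (is_derive_sin (a + t * b)) hl.
under eq_fun do rewrite cReM /=.
have := is_deriveB (is_deriveM hc (is_derive_cst (Re z) t (1 : R)))
  (is_deriveM hs (is_derive_cst (Im z) t (1 : R))).
move=> h; apply: (is_derive_eq h).
by rewrite !scaler0 !add0r cReM cImM cReM /= /GRing.scale /=; ring.
Qed.

Lemma has_partial_cis sg (xi : E) i x :
  has_partial (fun y : E => cis (sg * dotv y xi) : C) i x
    ((0 +i* (sg * xi 0 i)) * cis (sg * dotv x xi)).
Proof.
have E1 z : is_derive x (ei i) (fun y => Re (cis (sg * dotv y xi) * z))
    (Re ((0 +i* (sg * xi 0 i)) * (cis (sg * dotv x xi) * z))).
  apply/is_derive_at.
  have := is_derive_cis_affine (sg * dotv x xi) (sg * xi 0 i) 0 z.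
  rewrite mul0r addr0; congr is_derive; apply/funext => s; congr (Re (cis _ * _)).
  rewrite [dotv (x + _) xi]dotvC dotvDr dotvZr dotv_delta [dotv xi x]dotvC.
  by ring.
split.
  by have := E1 1; under eq_fun do rewrite mulr1; rewrite mulr1.
have := E1 (0 +i* -1); under eq_fun do rewrite cReM /= mulr0 mulrN1 sub0r opprK.
congr is_derive.
by rewrite !(cReM, cImM) /=; ring.
Qed.

Section ft_derivative.
Variables (sg : R) (f : E -> C).
Hypothesis sf : is_schwartz f.

Let h (i : 'I_d) (xi : E) (t : R) (x : E) : R :=
  Re (cis (sg * dotv x xi + t * (sg * x 0 i)) * f x).

Let integrable_coord_norm (i : 'I_d) :
  leb.-integrable setT (EFin \o (fun x : E => `|sg| * (`|x 0 i| * normc (f x)))).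
Proof.
apply: integrable_mulrl.
have [B B0 hB] := schwartz_weight (schwartz_coord i sf).
apply: (@integrable_le _ _ _ (fun x => B * weight x)).
- apply: measurable_funM; first by apply: measurableT_comp => //; exact: measurable_coord.
  exact: measurable_normc (schwartz_measurable sf).
- move=> x; have := hB x; rewrite Normc.normcM normcR.
  by rewrite normrM normr_id (ger0_norm (normc_ge0 _)).
- by apply: integrable_mulrl; exact: integrable_weight.
Qed.

(** Differentiation under the integral sign: the derivative of the integrand is
    dominated by the modulus of [x_i * f x], again a Schwartz function. *)
Lemma is_derive_Rintegral_cis i xi :
  is_derive xi (ei i) (fun eta => \int[leb]_x Re (cis (sg * dotv x eta) * f x))
    (\int[leb]_x Re ((0 +i* (sg * x 0 i)) * (cis (sg * dotv x xi) * f x))).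
Proof.
apply/is_derive_at.
rewrite (_ : (fun s : R => _) = fun s => \int[leb]_x h i xi s x); last first.
  apply/funext => s; apply: eq_Rintegral => x _; congr (Re (cis _ * _)).
  by rewrite dotvDr dotvZr dotv_delta; ring.
have dpar (t : R) (x : E) : is_derive t (1 : R) (h i xi ^~ x)
   (Re ((0 +i* (sg * x 0 i)) * (cis (sg * dotv x xi + t * (sg * x 0 i)) * f x))).
  exact: is_derive_cis_affine.
have ih t : leb.-integrable setT (EFin \o h i xi t).
  have [] := schwartz_ft_integrable sg (xi + t *: ei i) sf.
  move=> + _; congr (integrable _ _ _); apply/funext => x; congr (Re (cis _ * _))%:E.
  by rewrite dotvDr dotvZr dotv_delta; ring.
have I0 : `](-1), 1[%classic (0 : R) by rewrite /= in_itv/= ltrN10 ltr01.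
pose G (x : E) := `|sg| * (`|x 0 i| * normc (f x)).
have G0 x : 0 <= G x by rewrite !mulr_ge0 ?normc_ge0.
have hG (t : R) (x : E) : `](-1), 1[%classic t -> setT x -> `|partial1of2 (h i xi) t x| <= G x.
  move=> _ _; rewrite partial1of2E; have [_ ->] := dpar t x.
  apply: le_trans (Re_le_normc _) _; rewrite !Normc.normcM normc_cis mul1r /G mulrA.
  by rewrite ler_wpM2r ?normc_ge0// /= expr0n add0r sqrtr_sqr normrM.
have dh := fun (t : R) (x : E) (_ : `](-1), 1[%classic t) (_ : setT x) =>
   (let: DeriveDef p _ := dpar t x in p).
have D1 := @derivable_under_integral R _ _ leb (h i xi) setT measurableT 0 (-1) 1 I0
  (fun t _ => ih t) dh G G0 (integrable_coord_norm i) hG.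
have D2 := @differentiation_under_integral R _ _ leb (h i xi) setT measurableT 0 (-1) 1 I0
  (fun t _ => ih t) dh G G0 (integrable_coord_norm i) hG.
split; first exact: D1.
rewrite -derive1E D2; apply: eq_Rintegral => x _ /=.
rewrite partial1of2E; have [_ ->] := dpar 0 x.
by rewrite mul0r addr0.
Qed.

End ft_derivative.

(** Brings continuity within the reach of dominated convergence. *)
Lemma sequentially_continuous u :
  (forall x (v : nat -> E), v n @[n --> \oo] --> x -> u (v n) @[n --> \oo] --> u x) ->
  continuous u.
Proof.
move=> hu x; apply/(@cvgrPdist_le _ _ _ (nbhs x)) => e e0; apply: contrapT => nb.
have /choice[v hv] : forall n : nat, exists y, ball x n.+1%:R^-1 y /\ e < `|u x - u y|.
  move=> n; apply: contrapT => /forallNP hn; apply: nb; apply/nbhs_ballP.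
  exists n.+1%:R^-1 => [/=|y xy]; first by rewrite invr_gt0.
  by rewrite leNgt; apply/negP => hy; exact: (hn y (conj xy hy)).
have vx : v n @[n --> \oo] --> x.
  apply/cvg_ballP => r r0; have [N _ hN] := near_infty_natSinv_lt (PosNum r0).
  by exists N => // n Nn; apply: le_ball (hv n).1; exact: ltW (hN n Nn).
have /cvgrPdist_lt/(_ e e0)[N _ hN] := hu x v vx.
by have := hN N (leqnn N); rewrite /= ltNge (ltW (hv N).2).
Qed.

(** Reduces imaginary parts of transforms to real parts. *)
Lemma Im_Re_mulNi (z : C) : Im z = Re ((0 +i* -1) * z).
Proof. by rewrite cReM /= mul0r mulN1r sub0r opprK. Qed.

Lemma ft_has_partial sg f i xi : is_schwartz f ->
  has_partial (ft sg f) i xi (ft sg (fun x => (0 +i* sg) * ((x 0 i)%:C * f x)) xi).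
Proof.
move=> sf.
have reg g eta : Re (ft sg g eta) =
    ((2 * pi) `^ (- (d%:R / 2))) * \int[leb]_x Re (cis (sg * dotv x eta) * g x).
  by rewrite ftE cReM /= mul0r subr0.
have img g eta : Im (ft sg g eta) =
    ((2 * pi) `^ (- (d%:R / 2))) * \int[leb]_x Re (cis (sg * dotv x eta) * ((0 +i* -1) * g x)).
  rewrite ftE cImM /= mul0r addr0; congr (_ * _); apply: eq_Rintegral => x _.
  by rewrite Im_Re_mulNi mulrCA.
have e1 (x : E) : (0 +i* (sg * x 0 i)) = (0 +i* sg) * (x 0 i)%:C :> C.
  by apply: complex_eq; rewrite ?cReM ?cImM /=; ring.
split.
  rewrite (_ : (fun y => _) = fun eta => ((2 * pi) `^ (- (d%:R / 2))) *:
      \int[leb]_x Re (cis (sg * dotv x eta) * f x)); last exact/funext/reg.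
  rewrite reg -[X in is_derive _ _ _ X]/(_ *: _).
  apply: (is_derive_eq (is_deriveZ _ (is_derive_Rintegral_cis sg sf i xi))).
  congr (_ *: _); apply: eq_Rintegral => x _; congr Re.
  by rewrite e1; ring.
rewrite (_ : (fun y => _) = fun eta => ((2 * pi) `^ (- (d%:R / 2))) *:
    \int[leb]_x Re (cis (sg * dotv x eta) * ((0 +i* -1) * f x))); last exact/funext/img.
rewrite img -[X in is_derive _ _ _ X]/(_ *: _).
apply: (is_derive_eq (is_deriveZ _ (is_derive_Rintegral_cis sg (schwartzZ (0 +i* -1) sf) i xi))).
congr (_ *: _); apply: eq_Rintegral => x _; congr Re.
by rewrite e1; ring.
Qed.

Lemma ft_continuous sg f : is_schwartz f -> ccontinuous (ft sg f).
Proof.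
move=> sf; have [B B0 hB] := schwartz_weight sf.
suff h x (v : nat -> E) : v n @[n --> \oo] --> x -> ccvg (fun n => ft sg f (v n)) (ft sg f x).
  by split; apply: sequentially_continuous => x v /h[].
move=> vx; rewrite ftE; under eq_fun do rewrite ftE.
apply: ccvgM; first exact: ccvg_cst.
apply: (Cdominated_cvg (a := fun y => B * weight y)).
- by move=> n; apply: cmeasurableM; [exact: cis_measurable|exact: schwartz_measurable].
- by move=> n y; rewrite Normc.normcM normc_cis mul1r.
- by apply: integrable_mulrl; exact: integrable_weight.
move=> y; apply: ccvgM; last exact: ccvg_cst.
have vc i : v n 0 i @[n --> \oo] --> x 0 i := cvg_comp _ _ vx (@coord_continuous R 1 d 0 i x).
have dc : sg * dotv y (v n) @[n --> \oo] --> sg * dotv y x.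
  apply: cvgM; first exact: cvg_cst.
  rewrite /dotv; elim: (index_enum _) => [|i l ih].
    by rewrite big_nil; under eq_fun do rewrite big_nil; exact: cvg_cst.
  rewrite big_cons; under eq_fun do rewrite big_cons; apply: cvgD ih.
  by apply: cvgM; [exact: cvg_cst|exact: vc].
split=> /=; first exact: (cvg_comp _ _ dc (@continuous_cos R _)).
exact: (cvg_comp _ _ dc (@continuous_sin R _)).
Qed.

(** Integration by parts: the derivative of the product of [f] and the exponential
    has integral 0. *)
Lemma ft_partial sg f i xi : is_schwartz f ->
  ft sg (partial [:: i] f) xi = - ((0 +i* (sg * xi 0 i)) * ft sg f xi).
Proof.
move=> sf; apply/eqP; rewrite -subr_eq0 opprK; apply/eqP.
pose w g x := cis (sg * dotv x xi) * g x : C.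
have dw x : has_partial (w f) i x
    ((0 +i* (sg * xi 0 i)) * w f x + w (partial [:: i] f) x).
  have := has_partialM (has_partial_cis sg xi i x) (schwartz_has_partial i x sf).
  by rewrite mulrA.
have sp := schwartz_partial i sf.
have mw g : is_schwartz g -> Cmeasurable (w g).
  by move=> h; exact: (cmeasurableM (cis_measurable sg xi) (schwartz_measurable h)).
have mw' : Cmeasurable (fun x => (0 +i* (sg * xi 0 i)) * w f x + w (partial [:: i] f) x).
  apply: cmeasurableD (mw _ sp); apply: cmeasurableM (mw _ sf); exact: cmeasurable_cst.
have [B B0 hB] := schwartz_weight sf; have [D D0 hD] := schwartz_weight sp.
pose K := B + normc (0 +i* (sg * xi 0 i)) * B + D.
have K1 x : normc (w f x) <= K * weight x.
  rewrite Normc.normcM normc_cis mul1r (le_trans (hB x))// ler_wpM2r ?weight_ge0//.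
  by rewrite /K -addrA lerDl addr_ge0// mulr_ge0// normc_ge0.
have K2 x : normc ((0 +i* (sg * xi 0 i)) * w f x + w (partial [:: i] f) x) <= K * weight x.
  rewrite (le_trans (le_normcD _ _))// !Normc.normcM !normc_cis !mul1r.
  apply: (@le_trans _ _ (normc (0 +i* (sg * xi 0 i)) * (B * weight x) + D * weight x)).
    by apply: lerD => //; rewrite ler_wpM2l// normc_ge0.
  rewrite -subr_ge0 [leRHS](_ : _ = B * weight x); first by rewrite mulr_ge0 ?weight_ge0.
  by rewrite /K; ring.
have Z : Cintegral (fun x => (0 +i* (sg * xi 0 i)) * w f x + w (partial [:: i] f) x) = 0.
  apply: complex_eq => /=.
    apply: (integral_partial0 (u := fun x => Re (w f x)) (i := i) (B := K)).
    - by move=> x; exact: (dw x).1.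
    - exact: (mw f sf).1.
    - exact: mw'.1.
    - by move=> x; exact: le_trans (Re_le_normc _) (K1 x).
    - by move=> x; exact: le_trans (Re_le_normc _) (K2 x).
  apply: (integral_partial0 (u := fun x => Im (w f x)) (i := i) (B := K)).
  - by move=> x; exact: (dw x).2.
  - exact: (mw f sf).2.
  - exact: mw'.2.
  - by move=> x; exact: le_trans (Im_le_normc _) (K1 x).
  - by move=> x; exact: le_trans (Im_le_normc _) (K2 x).
have iw g : is_schwartz g -> Cintegrable (w g) by move=> h; exact: schwartz_ft_integrable.
rewrite CintegralD in Z; [|by apply: CintegrableZ; exact: iw|exact: iw].
rewrite CintegralZ in Z; last exact: iw.
rewrite !ftE -/(w f) -/(w (partial [:: i] f)) mulrCA -mulrDr addrC.
by rewrite Z mulr0.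
Qed.

(** Transforms of Schwartz functions form a class closed under derivatives, because
    the derivative of a transform is the transform of a multiple by a coordinate.
    They decrease rapidly because their multiples by coordinates are, up to a
    factor of modulus 1, transforms of derivatives. *)
Lemma schwartz_ft sg f : sg ^+ 2 = 1 -> is_schwartz f -> is_schwartz (ft sg f).
Proof.
move=> sg1 sf.
apply: (@schwartz_criterion _ _ (fun g => exists2 f, is_schwartz f & g = ft sg f)); last by exists f.
- move=> _ [{}f {}sf ->] N.
  suff [B hB] : exists B, forall x : E, (1 + \sum_i `|x 0 i|) ^+ N * normc (ft sg f x) <= B.
    exists B => x; apply: le_trans (hB x); rewrite ler_wpM2r ?normc_ge0//.
    by rewrite lerXn2r ?nnegrE ?addr_ge0 ?enorm_ge0 ?sumr_ge0// lerD2l enorm_le_sum.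
  elim: N f sf => [|N ih] f sf.
    by have [B hB] := ft_bounded sg sf; exists B => x; rewrite expr0 mul1r.
  have [B hB] := ih f sf.
  have /choice[D hD] : forall i : 'I_d, exists D, forall x : E,
      (1 + \sum_i `|x 0 i|) ^+ N * normc (ft sg (partial [:: i] f) x) <= D.
    by move=> i; apply: ih; exact: schwartz_partial.
  exists (B + \sum_i D i) => x; rewrite exprSr mulrAC mulrDr mulr1 mulr_sumr.
  apply: lerD => //; apply: ler_sum => i _; apply: le_trans (hD i x).
  have hs : normc (0 +i* (sg * x 0 i)) = `|x 0 i|.
    rewrite /= expr0n add0r sqrtr_sqr normrM.
    have : `|sg| ^+ 2 = 1 by rewrite -normrX sg1 normr1.
    move/eqP; rewrite sqrf_eq1 => /orP[/eqP ->|/eqP h]; first by rewrite mul1r.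
    by have := normr_ge0 sg; rewrite h lerNr oppr0 ler10.
  have -> : normc (ft sg (partial [:: i] f) x) = `|x 0 i| * normc (ft sg f x).
    by rewrite ft_partial// normcN [LHS]Normc.normcM hs.
  by rewrite [in leRHS]mulrA [leRHS]mulrAC.
- by move=> _ [{}f {}sf ->]; exact: ft_continuous.
- move=> _ i [{}f {}sf ->].
  exists (ft sg (fun x => (0 +i* sg) * ((x 0 i)%:C * f x))).
    by eexists; [|reflexivity]; apply: schwartzZ; exact: schwartz_coord.
  by move=> x; exact: ft_has_partial.
Qed.

Lemma schwartz_ft1 f : is_schwartz f -> is_schwartz (ft 1 f).
Proof. by apply: schwartz_ft; rewrite expr1n. Qed.

Lemma schwartz_ftN1 f : is_schwartz f -> is_schwartz (ft (-1) f).
Proof. by apply: schwartz_ft; rewrite sqrrN expr1n. Qed.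

End fourier_schwartz.

(** * The Fourier transform of an exponential weight *)

Section exponential_weight1.
Variable R : realType.
Local Notation mu := (@lebesgue_measure R).

Lemma ge0_integral_opp1 (f : R -> \bar R) : measurable_fun setT f ->
  (forall t, 0 <= f t)%E -> (\int[mu]_t f (- t)%R = \int[mu]_t f t)%E.
Proof.
move=> mf f0.
pose h := fun t : R => - t.
have mh : measurable_fun [set: measurableTypeR R] (h : measurableTypeR R -> measurableTypeR R).
  exact: oppr_measurable.
pose nu : {measure set (measurableTypeR R) -> \bar R} :=
  measure_function_pushforward__canonical__measure_function_Measure mu mh.
have munu A : measurable A -> mu A = nu A.
  move=> mA; apply: (@lebesgue_measure_unique R nu) => // _ [[u v] /= uv <-].
  rewrite /nu /= /pushforward.
  rewrite (_ : h @^-1` _ = [set` `[- v, - u[]); last first.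
    apply/seteqP; split => t /=; rewrite !in_itv/= /h.
      by rewrite [u < - t]ltrNr [- t <= v]lerNl andbC.
    by rewrite [t < - u]ltrNr [- v <= t]lerNl andbC.
  rewrite lebesgue_measure_itv lebesgue_measure_itv/= !lte_fin ltrN2.
  by case: ifPn => // _; rewrite -!EFinB opprK addrC.
have -> : (\int[mu]_t f t = \int[nu]_t f t)%E.
  by apply: eq_measure_integral => A mA _; exact: munu.
by rewrite /nu ge0_integral_pushforward.
Qed.

Section half_line.
Variables (e z : R).
Hypothesis e0 : 0 < e.

(* A primitive of [(1 + cos (z * t)) * expR (- (e * t))] that vanishes at infinity. *)
Let F (t : R) : R := expR (- (e * t)) *
  (((z * sin (z * t) - e * cos (z * t)) / (e ^+ 2 + z ^+ 2)) - e^-1).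

Let ez : 0 < e ^+ 2 + z ^+ 2. Proof. by rewrite ltr_pwDl ?exprn_gt0 ?sqr_ge0. Qed.

Let F_derive (t : R) : is_derive t (1 : R) F ((1 + cos (z * t)) * expR (- (e * t))).
Proof.
have l (c : R) : is_derive t (1 : R) (fun s : R => c * s) c.
  by have := is_deriveZ c (is_derive_id t (1 : R)); rewrite /GRing.scale /= mulr1.
have h1 := @is_derive1_comp _ expR (fun s => - e * s) t _ _ (is_derive_expR _) (l (- e)).
have h2 := @is_derive1_comp _ sin (fun s => z * s) t _ _ (is_derive_sin _) (l z).
have h3 := @is_derive1_comp _ cos (fun s => z * s) t _ _ (is_derive_cos _) (l z).
have h4 := is_deriveB (is_deriveM (is_derive_cst z t (1 : R)) h2) (is_deriveM (is_derive_cst e t (1 : R)) h3).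
have h5 := is_deriveB (is_deriveM h4 (is_derive_cst ((e ^+ 2 + z ^+ 2)^-1) t (1 : R))) (is_derive_cst (e^-1) t (1 : R)).
have := is_deriveM h1 h5.
rewrite (_ : _ * _ = F); last first.
  by apply/funext => s; rewrite !fctE /= /F mulNr.
move=> h; apply: (is_derive_eq h); rewrite /GRing.scale /=.
have n1 : e ^+ 2 + z ^+ 2 != 0 by rewrite gt_eqF.
have n2 : e != 0 by rewrite gt_eqF.
rewrite !fctE /= mulNr; field.
by rewrite n2 n1.
Qed.

Let F_cvg : F x @[x --> +oo] --> (0 : R).
Proof.
pose K := (`|z| + e) / (e ^+ 2 + z ^+ 2) + e^-1.
have exp0 : expR (- (e * x)) @[x --> +oo] --> (0 : R).
  have h : (e * x) @[x --> +oo] --> +oo by exact: gt0_cvgMry.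
  exact: (cvg_comp _ _ h (@cvgr_expR R)).
apply/norm_cvg0P; apply: (@squeeze_cvgr _ _ _ _ (fun=> 0) (fun x => expR (- (e * x)) * K)).
- apply: nearW => x; rewrite normr_ge0/= /F normrM ger0_norm ?expR_ge0// ler_wpM2l ?expR_ge0//.
  rewrite (le_trans (ler_normB _ _))// [`|e^-1|]ger0_norm ?invr_ge0 ?(ltW e0)// lerD2r.
  rewrite normrM [X in _ * X]ger0_norm ?invr_ge0 ?(ltW ez)// ler_wpM2r ?invr_ge0 ?(ltW ez)//.
  rewrite (le_trans (ler_normB _ _))// !normrM (gtr0_norm e0); apply: lerD.
    by rewrite ler_piMr// ler_norml sin_geN1 sin_le1.
  by rewrite ler_piMr ?(ltW e0)// ler_norml cos_geN1 cos_le1.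
- exact: cvg_cst.
- by rewrite -[X in _ --> X](mul0r K); apply: cvgM => //; exact: cvg_cst.
Qed.

(** The summand 1 makes the integrand nonnegative, so that the fundamental theorem
    of calculus applies on the half-line. *)
Lemma integral_cos_exp :
  (\int[mu]_t ((1 + cos (z * t)) * expR (- (e * `|t|)))%:E =
   (2 / e + 2 * e / (e ^+ 2 + z ^+ 2))%:E)%E.
Proof.
have cf : continuous (fun t : R => (1 + cos (z * t)) * expR (- (e * `|t|))).
  move=> x; apply: cvgM.
    apply: cvgD; first exact: cvg_cst.
    apply: (cvg_comp (fun t : R => z * t)); last exact: continuous_cos.
    by apply: cvgM; [exact: cvg_cst|exact: cvg_id].
  apply: (cvg_comp (fun t : R => - (e * `|t|))); last exact: continuous_expR.
  apply: cvgN; apply: cvgM; first exact: cvg_cst.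
  exact: norm_continuous.
have f0 (x : R) : 0 <= (1 + cos (z * x)) * expR (- (e * `|x|)).
  by rewrite mulr_ge0 ?expR_ge0// -lerBlDl sub0r cos_geN1.
rewrite (ge0_symfun_integralT f0 cf); last first.
  by move=> x /=; rewrite mulrN cosN normrN.
rewrite (_ : [set x | _] = `[0, +oo[%classic); last first.
  by apply/seteqP; split => x /=; rewrite in_itv/= andbT.
rewrite (@ge0_continuous_FTC2y _ _ F 0 0)//.
- rewrite /F !mulr0 oppr0 expR0 mul1r sin0 cos0 mulr0 mulr1 sub0r sub0e -EFinN -EFinM.
  congr _%:E; have n1 : e ^+ 2 + z ^+ 2 != 0 by rewrite gt_eqF.
  have n2 : e != 0 by rewrite gt_eqF.
  by field; rewrite n1.
- by apply: continuous_subspaceT => x; exact: cf.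
- apply: cvg_at_right_filter.
  by apply/differentiable_continuous/derivable1_diffP; have [] := F_derive 0.
- move=> x; rewrite in_itv/= andbT => x0; rewrite derive1E.
  by have [_ ->] := F_derive x; rewrite ger0_norm// ltW.
Qed.

End half_line.

Lemma integral_exp (e : R) : 0 < e ->
  (\int[mu]_t (expR (- (e * `|t|)))%:E = (2 / e)%:E)%E.
Proof.
move=> e0; have := integral_cos_exp 0 e0.
under eq_integral do rewrite mul0r cos0 EFinM.
rewrite ge0_integralZl_EFin//=; last first.
  apply/measurable_EFinP/(measurableT_comp (continuous_measurable_fun (@continuous_expR R))).
  apply: measurableT_comp => //; apply: measurable_funM => //; exact: measurableT_comp.
move=> h.
have -> : (2 / e)%:E = ((2^-1)%:E * (2 / e + 2 * e / (e ^+ 2 + 0 ^+ 2))%:E)%E :> \bar R.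
  rewrite -EFinM; congr _%:E; have n2 : e != 0 by rewrite gt_eqF.
  by field.
by rewrite -h muleA -EFinM mulVf ?mul1e.
Qed.

End exponential_weight1.

Section exponential_weight.
Variables (R : realType) (e : R).
Hypothesis e0 : 0 < e.
Local Notation mu := (@lebesgue_measure R).
Local Notation leb := (lebesgue_rV R).

Definition expweight n (x : 'rV[R]_n) : R := \prod_i expR (- (e * `|x 0 i|)).

Let ew (t : R) := expR (- (e * `|t|)).

Let mew : measurable_fun setT ew.
Proof.
apply: (measurableT_comp (continuous_measurable_fun (@continuous_expR R))).
apply: measurableT_comp => //; apply: measurable_funM => //; exact: measurableT_comp.
Qed.

Let iew : mu.-integrable setT (EFin \o ew).
Proof.
apply/integrableP; split; first exact/measurable_EFinP.
under eq_integral do rewrite /= ger0_norm ?expR_ge0//.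
by rewrite integral_exp// ltry.
Qed.

Lemma expweight_gt0 n (x : 'rV[R]_n) : 0 < expweight x.
Proof. by apply: prodr_gt0 => i _; exact: expR_gt0. Qed.

Lemma expweight_le1 n (x : 'rV[R]_n) : expweight x <= 1.
Proof.
apply: prodr_ile1 => i _; rewrite expR_ge0/= -expR0 ler_expR.
by rewrite oppr_le0 mulr_ge0// ltW.
Qed.

Lemma measurable_expweight n : measurable_fun setT (@expweight n).
Proof.
apply: measurable_prod => i _.
exact: (measurableT_comp (f := ew) mew (measurable_coord 0 i)).
Qed.

Lemma integrable_expweight n : (leb n).-integrable setT (EFin \o @expweight n).
Proof.
apply/integrableP; split.
  by apply/measurable_EFinP; exact: measurable_expweight.
under eq_integral do rewrite /= ger0_norm ?(ltW (expweight_gt0 _))//.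
rewrite (@ge0_integral_prod_rV _ n ew (2 / e)) ?ltry//.
- by move=> t; exact: expR_ge0.
- exact: integral_exp.
Qed.

Let bound1 (f : R -> R) : measurable_fun setT f -> (forall t, `|f t| <= 1) ->
  mu.-integrable setT (EFin \o (fun t => f t * ew t)).
Proof.
move=> mf f1; apply: le_integrable iew => //.
  by apply/measurable_EFinP; exact: measurable_funM.
move=> t _ /=; rewrite lee_fin normrM ler_piMl//.
Qed.

Let msin (z : R) : measurable_fun setT (fun t : R => sin (z * t)).
Proof.
apply: (measurableT_comp (continuous_measurable_fun (@continuous_sin R))).
exact: measurable_funM.
Qed.

Let mcos (z : R) : measurable_fun setT (fun t : R => cos (z * t)).
Proof.
apply: (measurableT_comp (continuous_measurable_fun (@continuous_cos R))).
exact: measurable_funM.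
Qed.

Let sin1 (t : R) : `|sin t| <= 1. Proof. by rewrite ler_norml sin_geN1 sin_le1. Qed.

Let cos1 (t : R) : `|cos t| <= 1. Proof. by rewrite ler_norml cos_geN1 cos_le1. Qed.

Let integral_cos z : (\int[mu]_t (cos (z * t) * ew t)%:E =
  (2 * e / (e ^+ 2 + z ^+ 2))%:E)%E.
Proof.
have ic := bound1 (mcos z) (fun t => cos1 (z * t)).
have := integral_cos_exp z e0.
under eq_integral do rewrite mulrDl mul1r EFinD.
rewrite integralD//= integral_exp//.
have := integrable_fin_num measurableT ic; rewrite /comp /ew.
case: (\int[mu]_t _)%E => // r _; rewrite -EFinD => -[h].
by congr _%:E; apply: (addrI (2 / e)).
Qed.

(* An odd integrand; 1 is added to reduce to nonnegative functions. *)
Let integral_sin z : (\int[mu]_t (sin (z * t) * ew t)%:E = 0)%E.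
Proof.
have is_ := bound1 (msin z) (fun t => sin1 (z * t)).
have m1 : measurable_fun setT (fun t => ((1 + sin (z * t)) * ew t)%:E).
  apply/measurable_EFinP; apply: measurable_funM => //.
  by apply: measurable_funD => //; exact: msin.
have p1 t : (0 <= ((1 + sin (z * t)) * ew t)%:E)%E.
  by rewrite lee_fin mulr_ge0 ?expR_ge0// -lerBlDl sub0r sin_geN1.
have := ge0_integral_opp1 m1 p1.
under eq_integral do rewrite mulrN sinN /ew normrN -/(ew _) mulrDl mul1r EFinD mulNr EFinN.
under [in RHS]eq_integral do rewrite mulrDl mul1r EFinD.
rewrite integralB// integralD//= integral_exp//.
have := integrable_fin_num measurableT is_; rewrite /comp /ew.
case: (\int[mu]_t _)%E => // r _ /= -[h].
by congr _%:E; lra.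
Qed.

Let integrable_trig n (f : R -> R) (z : 'rV[R]_n) c : measurable_fun setT f ->
  (forall t, `|f t| <= 1) ->
  (leb n).-integrable setT (EFin \o (fun x : 'rV[R]_n => f (c + dotv x z) * expweight x)).
Proof.
move=> mf f1; apply: (@integrable_le _ _ _ (@expweight n)); last exact: integrable_expweight.
  apply: measurable_funM; last exact: measurable_expweight.
  apply: (measurableT_comp mf); apply: measurable_funD => //; exact: measurable_dotv.
by move=> x; rewrite normrM [X in _ * X]gtr0_norm ?expweight_gt0// ler_piMl// ltW// expweight_gt0.
Qed.

Let mcos1 : measurable_fun setT (@cos R).
Proof. exact: continuous_measurable_fun (@continuous_cos R). Qed.

Let msin1 : measurable_fun setT (@sin R).
Proof. exact: continuous_measurable_fun (@continuous_sin R). Qed.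

(** A product of Poisson kernels: the transform of [expweight], not normalized. *)
Definition poisson n (z : 'rV[R]_n) : R := \prod_i (2 * e / (e ^+ 2 + z 0 i ^+ 2)).

Let trig_poisson n (z : 'rV[R]_n) :
  \int[leb n]_x (cos (dotv x z) * expweight x) = poisson z /\
  \int[leb n]_x (sin (dotv x z) * expweight x) = 0.
Proof.
elim: n z => [|n ih] z.
  rewrite /Rintegral !integral_dirac//; last 2 first.
  - by apply/measurable_EFinP; have := measurable_int _ (integrable_trig z 0 msin1 sin1);
     under eq_fun do rewrite /= add0r; move/measurable_EFinP.
  - by apply/measurable_EFinP; have := measurable_int _ (integrable_trig z 0 mcos1 cos1);
     under eq_fun do rewrite /= add0r; move/measurable_EFinP.
  rewrite !diracT !mul1e /= /dotv !big_ord0 cos0 sin0 mul0r mul1r.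
  by rewrite /expweight /poisson !big_ord0.
pose z' : 'rV[R]_n := \row_i z 0 (lift ord0 i).
have [hc hs] := ih z'.
have dE x v : dotv (rV_cons (x, v)) z = z 0 0 * x + dotv v z'.
  rewrite /dotv big_ord_recl rV_cons0 /= mulrC; congr (_ + _).
  by apply: eq_bigr => i _; rewrite rV_consS !mxE.
have eE x v : expweight (rV_cons (x, v) : 'rV[R]_n.+1) = ew x * expweight v.
  rewrite /expweight big_ord_recl rV_cons0 /=; congr (_ * _).
  by apply: eq_bigr => i _; rewrite rV_consS.
have i0 (f : R -> R) m (y : 'rV[R]_m) : measurable_fun setT f -> (forall t, `|f t| <= 1) ->
    (leb m).-integrable setT (EFin \o (fun x : 'rV[R]_m => f (dotv x y) * expweight x)).
  by move=> mf f1; have := integrable_trig y 0 mf f1; under eq_fun do rewrite add0r.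
have pE : poisson z = 2 * e / (e ^+ 2 + z 0 0 ^+ 2) * poisson z'.
  by rewrite /poisson big_ord_recl; congr (_ * _); apply: eq_bigr => i _; rewrite mxE.
have inner x : (\int[leb n]_v (cos (z 0 0 * x + dotv v z') * (ew x * expweight v))%:E =
      (cos (z 0 0 * x) * ew x)%:E * (poisson z')%:E)%E /\
    (\int[leb n]_v (sin (z 0 0 * x + dotv v z') * (ew x * expweight v))%:E =
      (sin (z 0 0 * x) * ew x)%:E * (poisson z')%:E)%E.
  have ic := i0 cos n z' mcos1 cos1; have is_ := i0 sin n z' msin1 sin1.
  have eqc : (\int[leb n]_v (cos (dotv v z') * expweight v)%:E = (poisson z')%:E)%E.
    by rewrite -hc /Rintegral fineK//; exact: integrable_fin_num ic.
  have eqs : (\int[leb n]_v (sin (dotv v z') * expweight v)%:E = 0)%E.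
    have := integrable_fin_num measurableT is_ => /fineK <-.
    by rewrite -[fine _]/(\int[leb n]_v (sin (dotv v z') * expweight v)) hs.
  split.
    under eq_integral => v _.
      rewrite cosD (_ : _ * _ = (cos (z 0 0 * x) * ew x) * (cos (dotv v z') * expweight v) +
        (- (sin (z 0 0 * x) * ew x)) * (sin (dotv v z') * expweight v)); last by ring.
      rewrite EFinD !EFinM; over.
    rewrite integralD//; [|exact: integrableZl|exact: integrableZl].
    by rewrite !integralZl// eqc eqs mule0 adde0.
  under eq_integral => v _.
    rewrite sinD (_ : _ * _ = (sin (z 0 0 * x) * ew x) * (cos (dotv v z') * expweight v) +
      (cos (z 0 0 * x) * ew x) * (sin (dotv v z') * expweight v)); last by ring.
    rewrite EFinD !EFinM; over.
  rewrite integralD//; [|exact: integrableZl|exact: integrableZl].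
  by rewrite !integralZl// eqc eqs mule0 adde0.
rewrite /Rintegral (integral_rV_cons (i0 cos _ z mcos1 cos1)) (integral_rV_cons (i0 sin _ z msin1 sin1)).
split.
  under eq_integral => x _.
    under eq_integral => v _ do rewrite /= dE eE.
    rewrite (inner x).1; over.
  rewrite integralZr//=; last exact: (bound1 (mcos (z 0 0)) (fun t => cos1 _)).
  by rewrite integral_cos -EFinM /= pE.
under eq_integral => x _.
  under eq_integral => v _ do rewrite /= dE eE.
  rewrite (inner x).2; over.
rewrite integralZr//=; last exact: (bound1 (msin (z 0 0)) (fun t => sin1 _)).
by rewrite integral_sin mul0e.
Qed.

Lemma Cintegral_expweight n (z : 'rV[R]_n) :
  Cintegral (fun x => cis (dotv x z) * (expweight x)%:C) = (poisson z)%:C.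
Proof.
have [h1 h2] := trig_poisson z.
apply: complex_eq => /=.
  by under eq_Rintegral do rewrite mulr0 subr0.
by under eq_Rintegral do rewrite mulr0 add0r.
Qed.

End exponential_weight.

(** * Fourier inversion *)

Section fourier_inversion.
Variables (R : realType) (d : nat).
Local Notation E := 'rV[R]_d.
Local Notation C := R[i].
Local Notation leb := (lebesgue_rV R d).
Local Notation cst := (fourier_cst R d).
Implicit Types (f g psi m : E -> C) (sg : R).

(** Both sides are the same double integral, in the two orders. *)
Lemma ft_multiplier sg m (a : E -> R) psi x : Cmeasurable m ->
  (forall xi, normc (m xi) <= a xi) -> leb.-integrable setT (EFin \o a) ->
  is_schwartz psi ->
  ft sg (fun xi => m xi * ft (- sg) psi xi) x =
  cst * Cintegral (fun y => psi y * ft sg m (x - y)).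
Proof.
move=> mm ma ia sp.
have [B B0 hB] := schwartz_weight sp.
have im : Cintegrable m by exact: Cintegrable_le ma ia.
pose F (z : E * E) : C := cst * ((cis (sg * dotv z.1 x) * m z.1) *
  (cis (- sg * dotv z.2 z.1) * psi z.2)).
have mF : cmeasurable F.
  apply: cmeasurableM; first exact: cmeasurable_cst.
  apply: cmeasurableM; first apply: cmeasurableM.
  - exact: (cmeasurable_comp (cis_measurable sg x) measurable_fst).
  - exact: (cmeasurable_comp mm measurable_fst).
  - apply: cmeasurableM; last exact: (cmeasurable_comp (schwartz_measurable sp) measurable_snd).
    apply: cmeasurable_cis; apply: measurable_funM => //.
    by under eq_fun do rewrite dotvC; exact: measurable_dotv_pair.
have Fab xi y : normc (F (xi, y)) <= (normc cst * a xi) * (B * weight y).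
  rewrite /F !Normc.normcM !normc_cis !mul1r mulrA; apply: ler_pM => //; rewrite ?normc_ge0//.
    by rewrite mulr_ge0 ?normc_ge0.
  by rewrite ler_wpM2l ?normc_ge0.
have i1 : leb.-integrable setT (EFin \o (fun xi => normc cst * a xi)) by exact: integrable_mulrl.
have i2 : leb.-integrable setT (EFin \o (fun xi => B * weight xi)).
  by apply: integrable_mulrl; exact: integrable_weight.
rewrite [LHS]ftE; congr (_ * _).
transitivity (Cintegral (fun xi => Cintegral (fun y => F (xi, y)))).
  apply: eq_Cintegral => xi; rewrite ftE mulrA mulrCA -!CintegralZ//.
  - by apply: CintegrableZ; exact: schwartz_ft_integrable.
  - exact: schwartz_ft_integrable.
rewrite (Cfubini mF i1 i2 Fab); apply: eq_Cintegral => y.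
rewrite ftE mulrCA -!CintegralZ; last 2 first.
- by apply: CintegrableZ; exact: ft_integrable.
- exact: ft_integrable.
apply: eq_Cintegral => xi; rewrite /F /=; congr (_ * _).
have -> : sg * dotv xi (x - y) = sg * dotv xi x + - sg * dotv y xi.
  by rewrite dotvDr -scaleN1r dotvZr [dotv y xi]dotvC; ring.
by rewrite cisD; ring.
Qed.

Lemma expweightE (e : R) (x : E) : expweight e x = expR (- (e * \sum_i `|x 0 i|)).
Proof. by rewrite /expweight -expR_sum; congr expR; rewrite mulr_sumr -sumrN. Qed.

Lemma ft_expweight (e : R) (z : E) : 0 < e ->
  ft 1 (fun x => (expweight e x)%:C) z = cst * (poisson e z)%:C.
Proof.
move=> e0; rewrite ftE; congr (_ * _); rewrite -Cintegral_expweight//.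
by apply: eq_Cintegral => x; rewrite mul1r.
Qed.

Lemma measurable_poisson (e : R) (x : E) : 0 < e ->
  measurable_fun setT (fun y : E => poisson e (x - y)).
Proof.
move=> e0; apply: measurable_prod => i _; under eq_fun do rewrite !mxE.
apply: (measurableT_comp (f := fun t : R => 2 * e / (e ^+ 2 + (x 0 i - t) ^+ 2))); last exact: measurable_coord.
apply: continuous_measurable_fun => t; apply: cvgM; first exact: cvg_cst.
apply: cvgV; first by rewrite gt_eqF// ltr_pwDl ?exprn_gt0 ?sqr_ge0.
apply: cvgD; first exact: cvg_cst.
have h : (x 0 i - s) @[s --> t] --> (x 0 i - t) by apply: cvgB; [exact: cvg_cst|exact: cvg_id].
by under eq_fun do rewrite expr2; rewrite expr2; exact: cvgM.
Qed.

Lemma fourier_cst2 : cst * cst = ((2 * pi) ^- d)%:C.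
Proof.
rewrite /fourier_cst -rmorphM; congr _%:C.
have p0 : 0 < 2 * pi :> R by rewrite mulr_gt0// pi_gt0.
rewrite -powRD ?(gt_eqF p0) ?implybT// -opprD -splitr powRN.
by rewrite powR_mulrn// ltW.
Qed.

Lemma ft_regularized_cvg g x : is_schwartz g ->
  ccvg (fun n => ft 1 (fun xi => (expweight n.+1%:R^-1 xi)%:C * g xi) x) (ft 1 g x).
Proof.
move=> sg; have [B B0 hB] := schwartz_weight sg.
rewrite ftE; under eq_fun do rewrite ftE.
apply: ccvgM; first exact: ccvg_cst.
apply: (Cdominated_cvg (a := fun xi => B * weight xi)).
- move=> n; apply: cmeasurableM; first exact: cis_measurable.
  apply: cmeasurableM; last exact: schwartz_measurable.
  by apply: cmeasurable_real; exact: measurable_expweight.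
- move=> n xi; rewrite !Normc.normcM normc_cis mul1r normcR gtr0_norm ?expweight_gt0//.
  rewrite (le_trans _ (hB xi))// ler_piMl ?normc_ge0// expweight_le1//.
- by apply: integrable_mulrl; exact: integrable_weight.
- move=> xi; apply: ccvgM; first exact: ccvg_cst.
  rewrite -[X in ccvg _ X]mul1r; apply: ccvgM; last exact: ccvg_cst.
  apply: (ccvg_real (l := 1)); under eq_fun do rewrite expweightE.
  have h : (- (n.+1%:R^-1 * \sum_i `|xi 0 i|)) @[n --> \oo] --> (0 : R).
    rewrite -[X in _ --> X]oppr0; apply: cvgN.
    rewrite -[X in _ --> X](mul0r (\sum_i `|xi 0 i|)); apply: cvgM; last exact: cvg_cst.
    exact: cvg_harmonic.
  by have := cvg_comp _ _ h (@continuous_expR R 0); rewrite expR0; exact.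
Qed.

(** The transform of [psi] is damped by [expweight e]. By [ft_multiplier] the inverse
    transform of the damped function is the convolution of [psi] with a Poisson
    kernel of width [e]. As [e] tends to 0, dominated convergence gives the limits
    of both expressions. *)
Lemma fourier_inversion psi : is_schwartz psi -> ft 1 (ft (-1) psi) = psi.
Proof.
move=> sp; apply/funext => x.
have sf := schwartz_ftN1 sp.
pose e (n : nat) : R := n.+1%:R^-1.
have e0 n : 0 < e n by rewrite invr_gt0.
have ecvg : e n @[n --> \oo] --> (0 : R) by exact: cvg_harmonic.
pose I n := ft 1 (fun xi => (expweight (e n) xi)%:C * ft (-1) psi xi) x.
have cI : ccvg I (ft 1 (ft (-1) psi) x) := ft_regularized_cvg x sf.
pose J n := cst * cst * ((2 ^+ d)%:C *
  Cintegral (fun u => psi (x + e n *: u) * (weight u)%:C)).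
have IJ n : I n = J n.
  have en := e0 n.
  rewrite /I -[in ft (-1) psi]/(- (1 : R)).
  rewrite (@ft_multiplier 1 _ (@expweight R (e n) d)) //; last 3 first.
  - by apply: cmeasurable_real; exact: measurable_expweight.
  - by move=> xi; rewrite normcR gtr0_norm ?expweight_gt0.
  - exact: integrable_expweight.
  have [B B0 hB] := schwartz_weight sp.
  pose G y := psi y * (poisson (e n) (x - y))%:C.
  have mG : Cmeasurable G.
    apply: cmeasurableM; first exact: schwartz_measurable.
    by apply: cmeasurable_real; exact: measurable_poisson.
  have iG : Cintegrable G.
    apply: (Cintegrable_le (a := fun y => (2 / e n) ^+ d * (B * weight y))) => //.
      move=> y; rewrite Normc.normcM normcR mulrC; apply: ler_pM; rewrite ?normc_ge0//.
      rewrite ger0_norm; last first.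
        apply: prodr_ge0 => i _; rewrite divr_ge0 ?mulr_ge0 ?(ltW en)//.
        by rewrite addr_ge0 ?sqr_ge0.
      have -> : (2 / e n) ^+ d = \prod_(i < d) (2 / e n) by rewrite prodr_const card_ord.
      apply: ler_prod => i _; rewrite divr_ge0 ?mulr_ge0 ?(ltW en) ?addr_ge0 ?sqr_ge0//=.
      have e2 : 0 < e n ^+ 2 by rewrite exprn_gt0.
      have e3 : 0 < e n ^+ 2 + (x - y) 0 i ^+ 2 by rewrite ltr_pwDl ?sqr_ge0.
      rewrite ler_pdivrMr// mulrAC ler_pdivlMr// -mulrA -expr2 ler_wpM2l//.
      by rewrite lerDl sqr_ge0.
    by do 2 apply: integrable_mulrl; exact: integrable_weight.
  have [iG' EG] := Cintegral_affine x en iG.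
  rewrite (@eq_Cintegral _ _ _ (fun y => cst * G y)); last first.
    by move=> y; rewrite ft_expweight// mulrCA.
  rewrite CintegralZ// mulrA /J; congr (_ * _).
  have ed : e n ^+ d != 0 by rewrite expf_neq0 ?gt_eqF.
  have -> : Cintegral G = (e n ^+ d)%:C * Cintegral (fun u => G (x + e n *: u)).
    by rewrite EG mulrA -rmorphM mulfV// mul1r.
  (* The substitution [y = x + e *: u] turns the Poisson kernel into [weight]. *)
  have GE u : G (x + e n *: u) = ((2 / e n) ^+ d)%:C * (psi (x + e n *: u) * (weight u)%:C).
    rewrite /G mulrCA; congr (_ * _); rewrite -rmorphM; congr _%:C.
    have -> : (2 / e n) ^+ d = \prod_(i < d) (2 / e n) by rewrite prodr_const card_ord.
    rewrite /poisson /weight -big_split/=; apply: eq_bigr => i _.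
    rewrite !mxE opprD addNKr sqrrN exprMn -[X in X + _]mulr1 -mulrDr.
    have u0 : 1 + u 0 i ^+ 2 != 0 by rewrite gt_eqF// ltr_wpDr ?sqr_ge0.
    have en' : e n != 0 by rewrite gt_eqF.
    by field; rewrite en' u0.
  have iW : Cintegrable (fun u => psi (x + e n *: u) * (weight u)%:C).
    have := CintegrableZ ((((2 / e n) ^+ d)^-1)%:C) iG'.
    rewrite (_ : (fun u => _) = (fun u => psi (x + e n *: u) * (weight u)%:C))//.
    apply/funext => u; rewrite GE mulrA -rmorphM mulVf ?mul1r//.
    by rewrite expf_neq0// mulf_neq0// invr_neq0// gt_eqF.
  rewrite (eq_Cintegral GE) CintegralZ// mulrA -rmorphM; congr (_%:C * _).
  by rewrite -exprMn mulrCA mulfV ?gt_eqF// mulr1.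
have cJ : ccvg J (psi x).
  have -> : psi x = cst * cst * ((2 ^+ d)%:C * Cintegral (fun u : E => psi x * (weight u)%:C)).
    have iwC : Cintegrable (fun u : E => (weight u)%:C).
      split => /=; first exact: integrable_weight.
      exact: integrable0.
    rewrite CintegralZ//.
    have -> : Cintegral (fun u : E => (weight u)%:C) = (pi ^+ d)%:C.
      apply: complex_eq => /=; first by rewrite /Rintegral integral_weight.
      by rewrite /Rintegral integral0.
    rewrite fourier_cst2 [psi x * _]mulrC !mulrA -!rmorphM exprMn.
    by rewrite -mulrA mulVf ?mul1r// mulf_neq0 ?expf_neq0// gt_eqF// pi_gt0.
  have [B B0 hB] := schwartz_weight sp.
  apply: ccvgM; first exact: ccvg_cst.
  apply: ccvgM; first exact: ccvg_cst.
  apply: (Cdominated_cvg (a := fun u => B * weight u)).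
  - move=> n; apply: cmeasurableM; last exact: (cmeasurable_real (@measurable_weight R d)).
    exact: (cmeasurable_comp (schwartz_measurable sp) (measurable_affine_rV x (e n))).
  - move=> n u; rewrite Normc.normcM normcR ger0_norm ?weight_ge0// ler_wpM2r ?weight_ge0//.
    by rewrite (le_trans (hB _))// ler_piMr// weight_le1.
  - by apply: integrable_mulrl; exact: integrable_weight.
  - move=> u; apply: ccvgM; last exact: ccvg_cst.
    have h : (x + e n *: u) @[n --> \oo] --> x.
      have h0 : (e n *: u) @[n --> \oo] --> 0 *: u by exact: cvgZr_tmp.
      by have := cvgD (cvg_cst x) h0; rewrite scale0r addr0; exact.
    have [c1 c2] := schwartz_continuous sp.
    by split; [exact: (cvg_comp _ _ h (c1 x))|exact: (cvg_comp _ _ h (c2 x))].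
by apply: (ccvg_unique cI); rewrite (funext IJ).
Qed.

Lemma ft_dilate sg m (e : R) z : 0 < e -> is_schwartz m ->
  ft sg (fun xi => m (e *: xi)) z = (e ^- d)%:C * ft sg m (e^-1 *: z).
Proof.
move=> e0 sm; pose G x := cis (sg * dotv x (e^-1 *: z)) * m x.
have iG : Cintegrable G by exact: schwartz_ft_integrable.
have [_ EG] := Cintegral_affine 0 e0 iG.
rewrite !ftE -/G mulrCA -EG; congr (_ * _); apply: eq_Cintegral => x.
rewrite /G !add0r; congr (cis (_ * _) * _).
rewrite dotvZr [dotv (e *: x) z]dotvC dotvZr dotvC mulrA mulVf ?mul1r//.
by rewrite gt_eqF.
Qed.

End fourier_inversion.

(** * The dyadic resolution of unity *)

Section dyadic_resolution.
Variables (R : realType) (d : nat) (phi0 : 'rV[R]_d -> R[i]).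
Hypothesis hphi0 : resolution_generator phi0.
Local Notation E := 'rV[R]_d.
Local Notation C := R[i].

(** A smooth function of compact support. *)
Lemma generator_schwartz : is_schwartz phi0.
Proof.
pose P (f : E -> C) := smooth f /\ forall (x : E) i, 2 < `|x 0 i| -> f x = 0.
apply: (@schwartz_criterion _ _ P).
- move=> f [sf f0] N.
  pose K : set E := [set v | forall i : 'I_d, `[- 2, 2]%classic (v ord0 i)].
  have cK : compact K.
    by apply: (@rV_compact R d (fun=> `[- 2, 2]%classic)) => i; exact: segment_compact.
  have bK (u : E -> R) : continuous u -> exists M : R, forall x : E, K x -> `|u x| <= M.
    move=> cu.
    have cuK : compact (u @` K).
      by apply: continuous_compact => //; exact: continuous_subspaceT.
    have [M [_ hM]] := compact_bounded cuK.
    exists (M + 1) => x Kx; apply: (hM (M + 1)); first by rewrite ltrDl.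
    by exists x.
  have [A hA] := bK _ (proj1 (sf.1 [::])); have [B hB] := bK _ (proj1 (sf.2 [::])).
  have K0 : K 0 by move=> i; rewrite /= mxE in_itv/= oppr_le0 !ler0n.
  have A0 : 0 <= A := le_trans (normr_ge0 _) (hA 0 K0).
  have B0 : 0 <= B := le_trans (normr_ge0 _) (hB 0 K0).
  exists ((1 + 2 * d%:R) ^+ N * (A + B)) => x.
  have [Kx|nKx] := pselect (K x).
    apply: ler_pM; rewrite ?exprn_ge0 ?addr_ge0 ?enorm_ge0 ?normc_ge0//.
      rewrite lerXn2r ?nnegrE ?addr_ge0 ?enorm_ge0 ?mulr_ge0// lerD2l.
      rewrite (le_trans (enorm_le_sum x))//.
      have -> : 2 * d%:R = \sum_(i < d) (2 : R) by rewrite sumr_const card_ord mulr_natr.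
      by apply: ler_sum => i _; have := Kx i; rewrite /= in_itv/= ler_norml.
    by apply: le_trans (normc_le _) _; apply: lerD; [exact: hA|exact: hB].
  have /existsNP[i hi] := nKx.
  rewrite (f0 x i) ?Normc.normc0 ?mulr0 ?mulr_ge0 ?exprn_ge0 ?addr_ge0 ?mulr_ge0//.
  by rewrite ltNge ler_norml; apply/negP => h; apply: hi; rewrite /= in_itv.
- by move=> f [[h1 h2] _]; split; [have [] := h1 [::]|have [] := h2 [::]].
- move=> f i [[h1 h2] f0]; exists (partial [:: i] f); last first.
    move=> x; split; split=> //.
      by have [_] := h1 [::]; exact.
    by have [_] := h2 [::]; exact.
  split.
    split=> s.
      by rewrite (_ : rpartial s _ = rpartial (rcons s i) (fun x => Re (f x))) // rpartial_rcons.
    by rewrite (_ : rpartial s _ = rpartial (rcons s i) (fun x => Im (f x))) // rpartial_rcons.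
  move=> x j xj; apply: has_partial_val.
  have n0 : \near x, 0 = f x.
    have := @coord_continuous R 1 d 0 j x.
    move/cvg_norm => /(cvgr_gt _) /(_ _ xj); apply: filterS => y hy.
    by rewrite (f0 y j).
  split.
    apply: (near_eq_is_derive (f := cst (0 : R))).
    by apply: filterS n0 => y <-.
  apply: (near_eq_is_derive (f := cst (0 : R))).
  by apply: filterS n0 => y <-.
- have [sp _ supp] := hphi0; split=> // x i xi.
  apply/eqP/negPn/negP => nz.
  have /supp : closure [set xi | phi0 xi != 0] x by exact: subset_closure.
  rewrite /= leNgt => /negP; apply; exact: lt_le_trans xi (coord_le_enorm x i).
Qed.

(** The sum of the dyadic functions of index at most [N]. *)
Definition lowpass (N : nat) : E -> C := fun xi => phi0 ((2 ^- N) *: xi).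

Lemma lowpass_schwartz N : is_schwartz (lowpass N).
Proof. by apply: schwartz_dilate generator_schwartz; rewrite invr_gt0 exprn_gt0. Qed.

Lemma lowpass0 : lowpass 0 = dyadic phi0 0.
Proof. by apply/funext => xi; rewrite /lowpass expr0 invr1 scale1r. Qed.

Lemma lowpassS N xi : lowpass N.+1 xi = lowpass N xi + dyadic phi0 N.+1 xi.
Proof. by rewrite /lowpass /= addrC subrK. Qed.

Lemma dyadic_schwartz nu : is_schwartz (dyadic phi0 nu).
Proof.
case: nu => [|nu]; first exact: generator_schwartz.
rewrite (_ : dyadic phi0 nu.+1 = fun xi => lowpass nu.+1 xi + -1 * lowpass nu xi); last first.
  by apply/funext => xi; rewrite mulN1r.
by apply: schwartzD; [|apply: schwartzZ]; exact: lowpass_schwartz.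
Qed.

Lemma lowpass_eq1 N xi : enorm xi <= 2 ^+ N -> lowpass N xi = 1.
Proof.
have [_ h1 _] := hphi0; move=> h; apply: h1.
by rewrite enormZ gtr0_norm ?invr_gt0 ?exprn_gt0// mulrC ler_pdivrMr ?mul1r// exprn_gt0.
Qed.

Lemma lowpass_eq0 N xi : 2 ^+ N.+1 < enorm xi -> lowpass N xi = 0.
Proof.
have [_ _ supp] := hphi0; move=> h; apply/eqP/negPn/negP => nz.
have : closure [set xi | phi0 xi != 0] (2 ^- N *: xi) by exact: subset_closure.
move/supp; rewrite /= enormZ gtr0_norm ?invr_gt0 ?exprn_gt0// mulrC.
by rewrite ler_pdivrMr ?exprn_gt0// -exprS leNgt h.
Qed.

Lemma dyadic_eq0_gt nu xi : 2 ^+ nu.+1 < enorm xi -> dyadic phi0 nu xi = 0.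
Proof.
case: nu => [|nu] h; first by rewrite -lowpass0; exact: lowpass_eq0.
rewrite /= -/(lowpass nu.+1 xi) -/(lowpass nu xi) !lowpass_eq0 ?subrr//.
by apply: lt_trans h; rewrite ltr_eXn2l// ltr1n.
Qed.

Lemma dyadic_eq0_le nu xi : enorm xi <= 2 ^+ nu -> dyadic phi0 nu.+1 xi = 0.
Proof.
move=> h; rewrite /= -/(lowpass nu.+1 xi) -/(lowpass nu xi) !lowpass_eq1 ?subrr//.
by apply: le_trans h _; rewrite ler_weXn2l// ler1n.
Qed.

Lemma lowpass_dyadic_low N nu xi : (nu < N)%N ->
  lowpass N xi * dyadic phi0 nu xi = dyadic phi0 nu xi.
Proof.
move=> nN; have [h|h] := leP (enorm xi) (2 ^+ nu.+1).
  rewrite lowpass_eq1 ?mul1r//; apply: (le_trans h).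
  by rewrite ler_weXn2l// ler1n.
by rewrite dyadic_eq0_gt// mulr0.
Qed.

Lemma lowpass_dyadic_high N nu xi : (N.+1 < nu)%N ->
  lowpass N xi * dyadic phi0 nu xi = 0.
Proof.
case: nu => // nu; rewrite ltnS => Nn; have [h|h] := leP (enorm xi) (2 ^+ N.+1).
  rewrite dyadic_eq0_le ?mulr0//; apply: (le_trans h).
  by rewrite ler_weXn2l// ler1n.
by rewrite lowpass_eq0 ?mul0r.
Qed.

End dyadic_resolution.

(** * Frequency filters on distributions *)

Section frequency_filter.
Variables (R : realType) (d : nat).
Local Notation E := 'rV[R]_d.
Local Notation C := R[i].
Local Notation S := (schwartz R d).
Local Notation leb := (lebesgue_rV R d).
Local Notation cst := (fourier_cst R d).
Implicit Types (m f g : E -> C) (psi : S) (T : S -> C).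

(** The multiplier [m], transposed to test functions: the two transforms occur in
    the opposite order. *)
Definition filter_fun m f : E -> C := ft (-1) (fun xi => m xi * ft 1 f xi).

(** The piece of index [nu] is the case [m = dyadic phi0 nu]. *)
Definition freq_filter m T : S -> C := inv_dfourier (dmul m (dfourier T)).

Lemma schwartz_is_schwartz psi : is_schwartz psi.
Proof. by case: psi => f /= /asboolP. Qed.

Lemma schwartz_sub f : is_schwartz f -> exists psi : S, psi = f :> (E -> C) /\
  forall T, extend0 T f = T psi.
Proof.
move=> sf; have pf : f \in @schwartz_pred R d by apply/asboolP.
exists (Schwartz pf); split=> // T; rewrite /extend0.
case: insubP => [psi _ pE|/negP//]; congr T; exact: val_inj.
Qed.

Lemma schwartz_filter_fun m f : is_schwartz m -> is_schwartz f ->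
  is_schwartz (filter_fun m f).
Proof.
by move=> sm sf; apply/schwartz_ftN1/schwartzM => //; exact: schwartz_ft1.
Qed.

Lemma freq_filterE m T psi : is_schwartz m ->
  freq_filter m T psi = extend0 T (filter_fun m psi).
Proof.
move=> sm; have sp := schwartz_is_schwartz psi.
have s1 : is_schwartz (inv_fourier psi).
  by rewrite inv_fourierE; exact: schwartz_ft1.
rewrite /freq_filter /inv_dfourier.
have [p1 [e1 ->]] := schwartz_sub s1; rewrite /dmul e1.
have [p2 [e2 ->]] := schwartz_sub (schwartzM sm s1); rewrite /dfourier e2.
by rewrite fourierE inv_fourierE.
Qed.

Lemma filter_fun_comp m1 m2 f : is_schwartz m1 -> is_schwartz m2 ->
  is_schwartz f ->
  filter_fun m1 (filter_fun m2 f) = filter_fun (fun xi => m1 xi * m2 xi) f.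
Proof.
move=> s1 s2 sf; rewrite /filter_fun.
rewrite fourier_inversion; first by congr ft; apply/funext => xi; rewrite mulrA.
by apply: schwartzM => //; exact: schwartz_ft1.
Qed.

Lemma freq_filter_comp m1 m2 T : is_schwartz m1 -> is_schwartz m2 ->
  freq_filter m1 (freq_filter m2 T) =
  freq_filter (fun xi => m2 xi * m1 xi) T.
Proof.
move=> s1 s2; apply/funext => psi; have sp := schwartz_is_schwartz psi.
rewrite freq_filterE//; have [p [e ->]] := schwartz_sub (schwartz_filter_fun s1 sp).
rewrite (freq_filterE T p s2) (freq_filterE T psi (schwartzM s2 s1)) e.
by rewrite filter_fun_comp.
Qed.

Lemma filter_fun_lc m c f g : is_schwartz m -> is_schwartz f -> is_schwartz g ->
  filter_fun m (fun x => c * f x + g x) =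
  fun x => c * filter_fun m f x + filter_fun m g x.
Proof.
move=> sm sf sg.
apply/funext => x; rewrite /filter_fun -ft_lc; last 2 first.
- by apply: schwartzM => //; exact: schwartz_ft1.
- by apply: schwartzM => //; exact: schwartz_ft1.
by congr ft; apply/funext => xi; rewrite ft_lc// mulrDr mulrCA.
Qed.

Lemma filter_fun_mulD m1 m2 f : is_schwartz m1 -> is_schwartz m2 ->
  is_schwartz f -> filter_fun (fun xi => m1 xi + m2 xi) f =
  fun x => filter_fun m1 f x + filter_fun m2 f x.
Proof.
move=> s1 s2 sf; have h := schwartz_ft1 sf.
apply/funext => x; have := @ft_lc R d (-1) 1 _ _ (schwartzM s1 h) (schwartzM s2 h) x.
rewrite mul1r => <-; congr ft; apply/funext => xi; by rewrite mul1r mulrDl.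
Qed.

Lemma freq_filter0 T : linear T -> freq_filter (fun=> 0) T = 0.
Proof.
move=> lT; apply/funext => psi.
have s0 : is_schwartz (fun _ : E => 0 : C).
  by have := schwartz_is_schwartz (0 : S).
rewrite freq_filterE//.
have [p [e ->]] := schwartz_sub (schwartz_filter_fun s0 (schwartz_is_schwartz psi)).
have -> : p = 0.
  apply: val_inj => /=; rewrite e; apply/funext => x; rewrite /filter_fun.
  under [X in ft _ X]eq_fun do rewrite mul0r.
  have := @ftZ R d (-1) 0 _ s0 x; rewrite mul0r => h.
  by rewrite [LHS]h mul0r.
by have := lT (-1) 0 0; rewrite scaler0 add0r => ->; rewrite scaleN1r addNr.
Qed.

Lemma linear_freq_filter m T : is_schwartz m -> linear T -> linear (freq_filter m T).
Proof.
move=> sm lT a f g; suff key (h : S) : schwartz_fun h = (fun x => a * f x + g x) ->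
    freq_filter m T h = a *: freq_filter m T f + freq_filter m T g by exact: key.
move=> hE; rewrite (freq_filterE T h sm) (freq_filterE T f sm) (freq_filterE T g sm).
have sf := schwartz_is_schwartz f; have sg := schwartz_is_schwartz g.
have [p [e Ep]] := schwartz_sub (schwartz_filter_fun sm (schwartz_is_schwartz h)).
have [pf [ef Ef]] := schwartz_sub (schwartz_filter_fun sm sf).
have [pg [eg Eg]] := schwartz_sub (schwartz_filter_fun sm sg).
rewrite (Ep T) (Ef T) (Eg T) -lT; congr T; apply: val_inj => /=; rewrite e hE.
by rewrite (filter_fun_lc a sm sf sg) -ef -eg.
Qed.

Lemma freq_filterD m T U psi :
  freq_filter m (fun psi => T psi + U psi) psi = freq_filter m T psi + freq_filter m U psi.
Proof.
rewrite /freq_filter /inv_dfourier /extend0; case: insub => [p1|]; rewrite ?addr0//.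
rewrite /dmul /extend0; case: insub => [p2|]; rewrite ?addr0//.
by rewrite /dfourier /extend0; case: insub => [p3|]; rewrite ?addr0.
Qed.

Lemma freq_filterN m T psi :
  freq_filter m (fun psi => - T psi) psi = - freq_filter m T psi.
Proof.
rewrite /freq_filter /inv_dfourier /extend0; case: insub => [p1|]; rewrite ?oppr0//.
rewrite /dmul /extend0; case: insub => [p2|]; rewrite ?oppr0//.
by rewrite /dfourier /extend0; case: insub => [p3|]; rewrite ?oppr0.
Qed.

Lemma freq_filter_mulD m1 m2 T psi : is_schwartz m1 -> is_schwartz m2 -> linear T ->
  freq_filter (fun xi => m1 xi + m2 xi) T psi =
  freq_filter m1 T psi + freq_filter m2 T psi.
Proof.
move=> s1 s2 lT; have sp := schwartz_is_schwartz psi.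
rewrite !freq_filterE//; last exact: schwartzD.
have [p [e ->]] := schwartz_sub (schwartz_filter_fun (schwartzD s1 s2) sp).
have [p1 [e1 ->]] := schwartz_sub (schwartz_filter_fun s1 sp).
have [p2 [e2 ->]] := schwartz_sub (schwartz_filter_fun s2 sp).
have := lT 1 p1 p2; rewrite scale1r => h.
rewrite -[T p1]scale1r -lT; congr T; apply: val_inj => /=; rewrite e filter_fun_mulD//.
apply/funext => x; rewrite -e1 -e2.
by rewrite -[RHS]/(1 * p1 x + p2 x) mul1r.
Qed.

Lemma schwartz_convolution_integrable f g x : is_schwartz f -> is_schwartz g ->
  Cintegrable (fun y => f y * g (x - y)).
Proof.
move=> sf sg; have [B B0 hB] := schwartz_weight sf; have [D D0 hD] := schwartz_weight sg.
apply: (Cintegrable_le (a := fun y => (B * D) * weight y)).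
- apply: cmeasurableM; first exact: schwartz_measurable.
  exact: (cmeasurable_comp (schwartz_measurable sg) (measurableT_comp (@measurable_sub_rV R d) (measurable_pair1 x))).
- move=> y; rewrite Normc.normcM mulrAC; apply: ler_pM; rewrite ?normc_ge0//.
  by rewrite (le_trans (hD _))// ler_piMr// weight_le1.
- by apply: integrable_mulrl; exact: integrable_weight.
Qed.

Section kernel.
Variable m : E -> C.
Hypothesis sm : is_schwartz m.

Fact filter_kernel_key : unit. Proof. exact: tt. Qed.

Definition filter_kernel := locked_with filter_kernel_key
  (fun z : E => cst * ft (-1) m z).

Lemma filter_kernelE z : filter_kernel z = cst * ft (-1) m z.
Proof. by rewrite [filter_kernel]unlock. Qed.

Lemma schwartz_filter_kernel : is_schwartz filter_kernel.
Proof.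
rewrite (funext filter_kernelE).
by apply/schwartzZ/schwartz_ftN1.
Qed.

Lemma filter_funE f x : is_schwartz f ->
  filter_fun m f x = Cintegral (fun y => f y * filter_kernel (x - y)).
Proof.
move=> sf; have [B B0 hB] := schwartz_weight sm.
have iw c : leb.-integrable setT (EFin \o (fun y : E => c * weight y)).
  by apply: integrable_mulrl; exact: integrable_weight.
have iF := schwartz_convolution_integrable x sf (schwartz_ftN1 sm).
rewrite /filter_fun -[X in fun xi => _ * ft X _ _](opprK 1).
rewrite (ft_multiplier _ x (schwartz_measurable sm) hB (iw B) sf) -CintegralZ//.
by apply: eq_Cintegral => y; rewrite filter_kernelE mulrCA.
Qed.

End kernel.

Section convolution.
Variables (m g : E -> C) (T : S -> C).
Hypothesis sm : is_schwartz m.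
Hypothesis gT : represents g T.
Hypothesis ig : leb.-integrable setT (EFin \o (fun x => normc (g x) * weight x)).

(** The convolution of [g] with the reflection of [filter_kernel m], which appears
    when the convolution is moved from the test function to [g]. *)
Definition filtered : E -> C := fun y => Cintegral (fun x => g x * filter_kernel m (x - y)).

Let F (psi : E -> C) (z : E * E) : C := g z.1 * (psi z.2 * filter_kernel m (z.1 - z.2)).

Let mF (psi : E -> C) : Cmeasurable psi -> cmeasurable (F psi).
Proof.
move=> mpsi; apply: cmeasurableM; first exact: (cmeasurable_comp gT.1 measurable_fst).
apply: cmeasurableM; first exact: (cmeasurable_comp mpsi measurable_snd).
exact: (cmeasurable_comp (schwartz_measurable (schwartz_filter_kernel sm)) (@measurable_sub_rV R d)).
Qed.

Let mFs (psi : E -> C) : Cmeasurable psi -> cmeasurable (fun z => F psi (z.2, z.1)).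
Proof.
move=> mpsi; apply: (cmeasurable_comp (mF mpsi)).
by apply/measurable_fun_pairP; split; [exact: measurable_snd|exact: measurable_fst].
Qed.

Let iw c : leb.-integrable setT (EFin \o (fun y : E => c * weight y)).
Proof. by apply: integrable_mulrl; exact: integrable_weight. Qed.

Let F_le (psi : E -> C) B : 0 <= B -> (forall x, normc (psi x) <= B * weight x ^+ 2) ->
  exists A, forall x y, normc (F psi (x, y)) <= (normc (g x) * weight x) * (A * weight y).
Proof.
move=> B0 hB; have [A A0 hA] := schwartz_weight (schwartz_filter_kernel sm).
exists (A * B * 2 ^+ d) => x y.
rewrite /F !Normc.normcM -[in leRHS]mulrA ler_wpM2l ?normc_ge0//=.
apply: (@le_trans _ _ (B * weight y ^+ 2 * (A * weight (x - y)))).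
  by apply: ler_pM; rewrite ?normc_ge0.
rewrite [leLHS](_ : _ = (A * B * weight y) * (weight (x - y) * weight y)); last by ring.
rewrite [leRHS](_ : _ = (A * B * weight y) * (2 ^+ d * weight x)); last by ring.
by rewrite ler_wpM2l ?weight_shift// !mulr_ge0 ?weight_ge0.
Qed.

(* A positive function with the decay of a test function: dividing by it, the
   integrability and the measurability of the convolution follow from Fubini's
   theorem for this function. *)
Let weight2 (y : E) : C := (weight y ^+ 2)%:C.

Let mweight2 : Cmeasurable weight2.
Proof. by apply: cmeasurable_real; apply: measurable_funX; exact: measurable_weight. Qed.

Let weight2_le : forall x, normc (weight2 x) <= 1 * weight x ^+ 2.
Proof. by move=> x; rewrite normcR mul1r ger0_norm// exprn_ge0// weight_ge0. Qed.

Let weight2K (y : E) z : ((weight y ^+ 2)^-1)%:C * (weight2 y * z) = z.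
Proof.
by rewrite mulrA -rmorphM mulVf ?mul1r// expf_neq0// gt_eqF// weight_gt0.
Qed.

Lemma filtered_integrable y : Cintegrable (fun x => g x * filter_kernel m (x - y)).
Proof.
have [A hA] := F_le ler01 weight2_le.
have hA' y' x : normc (F weight2 (x, y')) <= (A * weight y') * (normc (g x) * weight x).
  by rewrite mulrC.
have := CintegrableZ ((weight y ^+ 2)^-1)%:C (Cfubini_inner (mFs mweight2) ig hA' y).
by under eq_fun do rewrite /F /= mulrCA weight2K.
Qed.

Let filteredM (psi : E -> C) y : filtered y * psi y = Cintegral (fun x => F psi (x, y)).
Proof.
rewrite mulrC -CintegralZ; last exact: filtered_integrable.
by apply: eq_Cintegral => x; rewrite mulrCA.
Qed.

Lemma filtered_measurable : Cmeasurable filtered.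
Proof.
have [A hA] := F_le ler01 weight2_le.
have hA' y x : normc (F weight2 (x, y)) <= (A * weight y) * (normc (g x) * weight x).
  by rewrite mulrC.
have [i1 i2] := Cfubini_outer (mFs mweight2) (iw A) ig hA'.
have mh : Cmeasurable (fun y => Cintegral (fun x => F weight2 (x, y))).
  by split; apply/measurable_EFinP; [exact: measurable_int i1|exact: measurable_int i2].
rewrite (_ : filtered = fun y => ((weight y ^+ 2)^-1)%:C * Cintegral (fun x => F weight2 (x, y))).
  apply: cmeasurableM mh; apply: cmeasurable_real.
  under eq_fun do rewrite -powR_inv1 ?exprn_ge0 ?weight_ge0//.
  apply: (measurableT_comp (f := fun t : R => t `^ (- 1))); first exact: measurable_powR.
  by apply: measurable_funX; exact: measurable_weight.
by apply/funext => y; rewrite -filteredM [filtered y * _]mulrC weight2K.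
Qed.

(** The pairing of [T] with the filtered test function is a double integral, and
    integrating first in the variable of [g] gives the pairing with [filtered]. *)
Lemma represents_filtered : represents filtered (freq_filter m T).
Proof.
split; first exact: filtered_measurable.
move=> psi; have sp := schwartz_is_schwartz psi; have [B B0 hB] := schwartz_weight2 sp.
have mp := schwartz_measurable sp.
have [A hA] := F_le B0 hB.
have hA' y x : normc (F psi (x, y)) <= (A * weight y) * (normc (g x) * weight x).
  by rewrite mulrC.
split.
  have := Cfubini_outer (mFs mp) (iw A) ig hA'.
  rewrite (_ : (fun y => filtered y * psi y) = fun y => Cintegral (fun x => F psi (x, y)))//.
  exact/funext/filteredM.
rewrite freq_filterE//; have [p [e ->]] := schwartz_sub (schwartz_filter_fun sm sp).
have [_ ->] := gT.2 p.
rewrite (eq_Cintegral (filteredM psi)) -(Cfubini (mF mp) ig (iw A) hA).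
apply: eq_Cintegral => x; rewrite e filter_funE// -CintegralZ//.
exact: schwartz_convolution_integrable sp (schwartz_filter_kernel sm).
Qed.

End convolution.
End frequency_filter.

(** * The [l_q] quasi-norm over a block *)

Section block_lq.
Variables (R : realType).
Implicit Types (q : \bar R) (j : nat) (a b : nat -> R).

Lemma powRD_le (a b q : R) : 0 <= a -> 0 <= b -> 0 < q ->
  (a + b) `^ q <= 2 `^ q * (a `^ q + b `^ q).
Proof.
move=> a0 b0 q0; wlog ab : a b a0 b0 / a <= b.
  move=> wl; have [/wl|/ltW/wl] := leP a b; first exact.
  by rewrite addrC [X in _ * X]addrC; exact.
apply: (@le_trans _ _ (2 `^ q * b `^ q)).
  rewrite -powRM//; apply: ge0_ler_powR; rewrite ?nnegrE ?mulr_ge0 ?addr_ge0 ?(ltW q0)//.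
  by rewrite mulr2n mulrDl mul1r lerD2r.
by rewrite ler_wpM2l ?powR_ge0// lerDr powR_ge0.
Qed.

Definition in_block j nu := ((2 ^ j).-1 <= nu < (2 ^ j.+1).-1)%N.

Lemma block_lq_ge0 q j a : (0 < q)%E -> 0 <= block_lq q j a.
Proof.
case: q => [q||]//= _; first exact: powR_ge0.
exact: bigmax_ge_id.
Qed.

Lemma le_block_lq q j a b : (0 < q)%E ->
  (forall nu, in_block j nu -> 0 <= a nu <= b nu) ->
  block_lq q j a <= block_lq q j b.
Proof.
case: q => [q||] q0 ab; last by exfalso.
  rewrite /block_lq; have q1 : 0 < q by rewrite -lte_fin.
  apply: ge0_ler_powR; rewrite ?invr_ge0 ?(ltW q1) ?nnegrE//.
  - by apply: sumr_ge0 => i _; exact: powR_ge0.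
  - by apply: sumr_ge0 => i _; exact: powR_ge0.
  apply: ler_sum_nat => nu /ab/andP[a0 h].
  by apply: ge0_ler_powR; rewrite ?nnegrE ?(ltW q1)// (le_trans a0).
rewrite /block_lq big_nat; apply: bigmax_le => [|nu hnu]; first exact: bigmax_ge_id.
have /andP[_ h] := ab nu hnu; apply: (le_trans h).
by apply: le_bigmax_seq; rewrite ?mem_index_iota.
Qed.

Definition lq_cst q : R := if q is q'%:E then 2 * 2 `^ q'^-1 else 1.

Lemma lq_cst_ge1 q : (0 < q)%E -> 1 <= lq_cst q.
Proof.
case: q => [q||]//= q0; have q1 : 0 < q by rewrite -lte_fin.
rewrite -[leLHS]mulr1; apply: ler_pM => //; first by rewrite ler1n.
by rewrite -[leLHS](powRr0 2); apply: ler_powR; rewrite ?ler1n// invr_ge0 ltW.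
Qed.

Lemma block_lqD q j a b : (0 < q)%E ->
  (forall nu, 0 <= a nu) -> (forall nu, 0 <= b nu) ->
  block_lq q j (fun nu => a nu + b nu) <=
  lq_cst q * (block_lq q j a + block_lq q j b).
Proof.
move=> + a0 b0; case: q => [q||] q0; last by exfalso.
  rewrite /block_lq /lq_cst; have q1 : 0 < q by rewrite -lte_fin.
  have S0 (c : nat -> R) : 0 <= \sum_((2 ^ j).-1 <= nu < (2 ^ j.+1).-1) c nu `^ q.
    by apply: sumr_ge0 => i _; exact: powR_ge0.
  have := S0 a; have := S0 b; have := S0 (fun nu => a nu + b nu).
  have : \sum_((2 ^ j).-1 <= nu < (2 ^ j.+1).-1) (a nu + b nu) `^ q <=
    2 `^ q * (\sum_((2 ^ j).-1 <= nu < (2 ^ j.+1).-1) a nu `^ q +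
              \sum_((2 ^ j).-1 <= nu < (2 ^ j.+1).-1) b nu `^ q).
    rewrite -big_split/= mulr_sumr; apply: ler_sum => nu _; exact: powRD_le.
  set C := \sum_(_ <= _ < _) _ `^ _; set A := \sum_(_ <= _ < _) a _ `^ _.
  set B := \sum_(_ <= _ < _) b _ `^ _; move=> h C0 B0 A0.
  apply: (@le_trans _ _ ((2 `^ q * (A + B)) `^ q^-1)).
    apply: ge0_ler_powR; rewrite ?invr_ge0 ?(ltW q1) ?nnegrE//.
    by rewrite mulr_ge0 ?powR_ge0 ?addr_ge0.
  rewrite powRM ?powR_ge0 ?addr_ge0// -powRrM mulfV ?gt_eqF// (@powRr1 _ 2)// -mulrA.
  by rewrite ler_wpM2l// powRD_le// invr_gt0.
rewrite /block_lq mul1r big_nat; apply: bigmax_le => [|nu hnu].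
  by rewrite addr_ge0 // bigmax_ge_id.
by apply: lerD; apply: le_bigmax_seq; rewrite ?mem_index_iota.
Qed.

Lemma le_block_lq_term q j a nu : (0 < q)%E -> (forall nu, 0 <= a nu) ->
  in_block j nu -> a nu <= block_lq q j a.
Proof.
move=> + a0 hnu; have nuI : nu \in index_iota (2 ^ j).-1 (2 ^ j.+1).-1 by rewrite mem_index_iota.
case: q => [q||] q0; last 2 first.
- exact: le_bigmax_seq.
- by exfalso.
rewrite /block_lq; have q1 : 0 < q by rewrite -lte_fin.
rewrite -[leLHS]powRr1// -(mulfV (lt0r_neq0 q1)) powRrM.
apply: ge0_ler_powR; rewrite ?invr_ge0 ?(ltW q1) ?nnegrE ?powR_ge0//.
  by apply: sumr_ge0 => i _; exact: powR_ge0.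
rewrite (big_rem nu)//= lerDl; apply: sumr_ge0 => i _; exact: powR_ge0.
Qed.

Lemma block_lq_single q j a nu : (0 < q)%E -> 0 <= a nu ->
  (forall mu, in_block j mu -> mu != nu -> a mu = 0) ->
  block_lq q j a <= a nu.
Proof.
move=> + a0 ha; case: q => [q||] q0; last 2 first.
- rewrite /block_lq big_nat; apply: bigmax_le => // mu /ha.
  by case: eqVneq => [->//|_ ->].
- by exfalso.
rewrite /block_lq; have q1 : 0 < q by rewrite -lte_fin.
rewrite -[leRHS]powRr1// -(mulfV (lt0r_neq0 q1)) powRrM.
apply: ge0_ler_powR; rewrite ?invr_ge0 ?(ltW q1) ?nnegrE ?powR_ge0//.
  by apply: sumr_ge0 => i _; exact: powR_ge0.
rewrite big_nat (eq_bigr (fun mu => if mu == nu then a nu `^ q else 0)); last first.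
  by move=> mu /ha; case: eqVneq => [->//|_ ->//]; rewrite powR0 ?gt_eqF.
rewrite -big_nat -big_mkcond/= big_nat1_eq; case: ifP => // _; exact: powR_ge0.
Qed.

Lemma measurable_block_lq d (T : measurableType d) q j (f : nat -> T -> R) :
  (0 < q)%E -> (forall nu, in_block j nu -> measurable_fun setT (f nu)) ->
  measurable_fun setT (fun x => block_lq q j (fun nu => f nu x)).
Proof.
move=> + mf; case: q => [q||] q0; last by exfalso.
  rewrite /block_lq; apply: (measurableT_comp (measurable_powR q^-1)).
  under eq_fun do rewrite big_nat big_mkcond/=.
  apply: measurable_sum => nu; case h : ((2 ^ j).-1 <= nu < (2 ^ j.+1).-1)%N; last exact: measurable_cst.
  exact: (measurableT_comp (measurable_powR q) (mf _ h)).
rewrite /block_lq; under eq_fun do rewrite big_nat.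
elim: (index_iota _ _) => [|nu l ih]; first by under eq_fun do rewrite big_nil; exact: measurable_cst.
under eq_fun do rewrite big_cons.
case h : ((2 ^ j).-1 <= nu < (2 ^ j.+1).-1)%N => //.
by apply: measurable_maxr => //; exact: mf.
Qed.

End block_lq.

Lemma lee_poweR (R : realType) (r : R) (x y : \bar R) : 0 < r ->
  (0 <= x -> x <= y -> x `^ r <= y `^ r)%E.
Proof.
move=> r0 x0 xy; apply: (gt0_ler_poweR (ltW r0)) => //; rewrite in_itv/= leey andbT//.
exact: le_trans xy.
Qed.

(** * Young's inequality *)

Section Lnorm_extra.
Context d (T : measurableType d) (R : realType) (mu : {measure set T -> \bar R}).
Implicit Types (f g : T -> R) (p : R).
Local Open Scope ereal_scope.

Lemma le_Lnorm (p : R) (f g : T -> \bar R) : (0 < p)%R ->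
  measurable_fun setT f -> measurable_fun setT g ->
  (forall x, `|f x| <= `|g x|) -> Lnorm mu p%:E f <= Lnorm mu p%:E g.
Proof.
move=> p0 mf mg fg; rewrite unlock.
apply: lee_poweR; first by rewrite invr_gt0.
  by apply: integral_ge0 => x _; exact: poweR_ge0.
apply: ge0_le_integral => //.
- by move=> x _; exact: poweR_ge0.
- by apply: (measurableT_comp (measurable_poweR p)); exact: measurableT_comp.
- by apply: (measurableT_comp (measurable_poweR p)); exact: measurableT_comp.
- by move=> x _; exact: lee_poweR.
Qed.

Lemma Lnorm_scale (p c : R) (f : T -> R) : (0 < p)%R -> (0 <= c)%R -> measurable_fun setT f ->
  Lnorm mu p%:E (fun x => (c * f x)%:E) = c%:E * Lnorm mu p%:E (fun x => (f x)%:E).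
Proof.
move=> p0 c0 mf; rewrite unlock.
have mF : measurable_fun setT (fun x => `|(f x)%:E| `^ p).
  apply: (measurableT_comp (measurable_poweR p)); apply: measurableT_comp => //.
  exact/measurable_EFinP.
under eq_integral => x _ do rewrite EFinM abseM poweRM ?abse_ge0// gee0_abs ?lee_fin//.
rewrite poweR_EFin ge0_integralZl//; last 2 first.
- by move=> x _; exact: poweR_ge0.
- by rewrite lee_fin powR_ge0.
rewrite poweRM ?lee_fin ?powR_ge0// ?integral_ge0//; last by move=> x _; exact: poweR_ge0.
by rewrite poweR_EFin -powRrM mulfV ?lt0r_neq0// powRr1.
Qed.

End Lnorm_extra.

Section young.
Variables (R : realType) (d : nat).
Local Notation E := 'rV[R]_d.
Local Notation leb := (lebesgue_rV R d).
Variables (p c : R) (G k : E -> R).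
Hypothesis p1 : 1 < p.
Hypothesis G0 : forall x, 0 <= G x.
Hypothesis k0 : forall x, 0 <= k x.
Hypothesis mG : measurable_fun setT G.
Hypothesis mk : measurable_fun setT k.
Hypothesis c0 : 0 <= c.
Hypothesis kl : forall y, (\int[leb]_x (k (x - y))%:E = c%:E)%E.
Hypothesis kr : forall x, (\int[leb]_y (k (x - y))%:E = c%:E)%E.

Let p0 : 0 < p. Proof. exact: lt_trans p1. Qed.

Let mkz : measurable_fun setT (fun z : E * E => k (z.1 - z.2)).
Proof. exact: (measurableT_comp mk (@measurable_sub_rV R d)). Qed.

Let mky y : measurable_fun setT (fun x : E => k (x - y)).
Proof. exact: (measurableT_comp mkz (measurable_pair2 y)). Qed.

(** Hoelder's inequality for [G * k `^ p^-1] and [k `^ p'^-1], with [p'] the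
    conjugate exponent. *)
Let young_pointwise (y : E) :
  ((\int[leb]_x (G x * k (x - y))%:E) `^ p <=
  (c `^ (p - 1))%:E * \int[leb]_x (G x `^ p * k (x - y))%:E)%E.
Proof.
pose p' := p / (p - 1).
have pm : 0 < p - 1 by rewrite subr_gt0.
have p'0 : 0 < p' by rewrite divr_gt0.
have pp' : p^-1 + p'^-1 = 1.
  by rewrite /p' invf_div -[X in X + _]mul1r -mulrDl addrC subrK mulfV ?lt0r_neq0.
pose f (x : E) := G x * k (x - y) `^ p^-1; pose g (x : E) := k (x - y) `^ p'^-1.
have mg' r : measurable_fun setT (fun x : E => k (x - y) `^ r).
  exact: (measurableT_comp (measurable_powR r) (mky y)).
have mf : measurable_fun setT f by exact: measurable_funM.
have mg : measurable_fun setT g := mg' p'^-1.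
have := @hoelder _ _ R leb f g p p' mf mg p0 p'0 pp'.
rewrite Lnorm1 => h.
have fg0 : (\int[leb]_x (G x * k (x - y))%:E = \int[leb]_x `|(f x * g x)%:E|)%E.
  apply: eq_integral => x _; rewrite gee0_abs; last first.
    by rewrite lee_fin !mulr_ge0// powR_ge0.
  by rewrite /f /g -mulrA -powRD ?pp' ?oner_eq0// powRr1.
rewrite fg0; apply: (@le_trans _ _ ((Lnorm leb p%:E (EFin \o f) * Lnorm leb p'%:E (EFin \o g)) `^ p)%E).
  apply: lee_poweR => //.
  by apply: integral_ge0 => x _; rewrite lee_fin.
rewrite poweRM ?Lnorm_ge0// poweR_Lnorm ?lt0r_neq0// muleC.
apply: lee_pmul; rewrite ?poweR_ge0//.
- by apply: integral_ge0 => x _; exact: poweR_ge0.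
- rewrite unlock -poweRrM.
  rewrite (@eq_integral _ _ _ leb setT (fun x => (k (x - y))%:E)); last first.
    move=> x _; rewrite /= ger0_norm ?powR_ge0// -powRrM mulVf ?lt0r_neq0// powRr1//.
  rewrite kl poweR_EFin /p' invf_div -mulrA mulVf ?mulr1 ?lt0r_neq0//.
- rewrite le_eqVlt; apply/orP; left; apply/eqP; apply: eq_integral => x _ /=.
  rewrite ger0_norm; last by rewrite mulr_ge0// powR_ge0.
  by rewrite powRM ?powR_ge0// -powRrM mulVf ?lt0r_neq0// powRr1.
Qed.

Lemma measurable_convolution :
  measurable_fun setT (fun y : E => \int[leb]_x (G x * k (x - y))%:E)%E.
Proof.
have mF : measurable_fun setT (fun z : E * E => (G z.1 * k (z.1 - z.2))%:E).
  by apply/measurable_EFinP; apply: measurable_funM => //; exact: (measurableT_comp mG measurable_fst).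
have F0 (z : E * E) : (0 <= (G z.1 * k (z.1 - z.2))%:E)%E by rewrite lee_fin mulr_ge0.
exact: (measurable_fun_fubini_tonelli_G (m1 := leb) _ mF F0).
Qed.

(** Integrate [young_pointwise] and exchange the integrals. *)
Lemma young : (Lnorm leb p%:E (fun y => \int[leb]_x (G x * k (x - y))%:E) <=
  c%:E * Lnorm leb p%:E (fun x => (G x)%:E))%E.
Proof.
have mGp : measurable_fun setT (fun x => G x `^ p).
  exact: (measurableT_comp (measurable_powR p) mG).
have mFp : measurable_fun setT (fun z : E * E => (G z.1 `^ p * k (z.1 - z.2))%:E).
  by apply/measurable_EFinP; apply: measurable_funM => //; exact: (measurableT_comp mGp measurable_fst).
have Fp0 (z : E * E) : (0 <= (G z.1 `^ p * k (z.1 - z.2))%:E)%E.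
  by rewrite lee_fin mulr_ge0// powR_ge0.
have mI := measurable_convolution.
have mIp : measurable_fun setT (fun y : E => \int[leb]_x (G x `^ p * k (x - y))%:E)%E.
  exact: (measurable_fun_fubini_tonelli_G (m1 := leb) _ mFp Fp0).
have I0 (y : E) : (0 <= \int[leb]_x (G x * k (x - y))%:E)%E.
  by apply: integral_ge0 => x _; rewrite lee_fin mulr_ge0.
have Ip0 (y : E) : (0 <= \int[leb]_x (G x `^ p * k (x - y))%:E)%E.
  by apply: integral_ge0 => x _; rewrite lee_fin mulr_ge0// powR_ge0.
have GpE : (\int[leb]_x `|(G x)%:E| `^ p = \int[leb]_x (G x `^ p)%:E)%E.
  by apply: eq_integral => x _ /=; rewrite ger0_norm.
have Gp0 : (0 <= \int[leb]_x (G x `^ p)%:E)%E.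
  by apply: integral_ge0 => x _; rewrite lee_fin powR_ge0.
have tot : (\int[leb]_y \int[leb]_x (G x `^ p * k (x - y))%:E = c%:E * \int[leb]_x (G x `^ p)%:E)%E.
  rewrite -(fubini_tonelli (m1 := leb) (m2 := leb) _ mFp Fp0)/= -ge0_integralZl//; last 2 first.
  - exact/measurable_EFinP.
  - by move=> x _; rewrite lee_fin powR_ge0.
  apply: eq_integral => x _; under eq_integral do rewrite EFinM.
  rewrite ge0_integralZl ?lee_fin ?powR_ge0//; last 2 first.
  - apply/measurable_EFinP; exact: (measurableT_comp mkz (measurable_pair1 x)).
  - by move=> y _; rewrite lee_fin.
  by rewrite kr muleC.
rewrite unlock GpE; move: Gp0 tot {GpE}.
move: (\int[leb]_x (G x `^ p)%:E)%E => A A0 tot.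
apply: (@le_trans _ _ (((c `^ p)%:E * A) `^ p^-1)%E).
  apply: lee_poweR; first by rewrite invr_gt0.
    by apply: integral_ge0 => x _; exact: poweR_ge0.
  rewrite -(mulr_powRB1 c0 p0) mulrC EFinM -muleA -tot -ge0_integralZl//; last by rewrite lee_fin powR_ge0.
  apply: ge0_le_integral => //.
  - by move=> y _; exact: poweR_ge0.
  - by apply: (measurableT_comp (measurable_poweR p)); exact: measurableT_comp.
  - exact: measurable_funeM.
  - by move=> y _; rewrite gee0_abs//; exact: young_pointwise.
rewrite poweRM ?lee_fin ?powR_ge0// poweR_EFin -powRrM mulfV ?lt0r_neq0// powRr1//.
Qed.

End young.

(** * Low-pass filters are uniformly bounded on [L_p] *)

Section lowpass_bound.
Variables (R : realType) (d : nat) (phi0 : 'rV[R]_d -> R[i]).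
Hypothesis hphi0 : resolution_generator phi0.
Local Notation E := 'rV[R]_d.
Local Notation C := R[i].
Local Notation S := (schwartz R d).
Local Notation leb := (lebesgue_rV R d).
Local Notation cst := (fourier_cst R d).
Implicit Types (g : E -> C) (T : S -> C).

(** The width is [e] and the integral does not depend on it. *)
Definition lowpass_bound (A e : R) (z : E) : R := A * (e ^- d * weight (e^-1 *: z)).

(** The kernels are the dilations of a fixed Schwartz function. *)
Lemma lowpass_kernel_le : exists2 A, 0 <= A & forall N z,
  normc (filter_kernel (lowpass phi0 N) z) <= lowpass_bound A (2 ^- N) z.
Proof.
have sp := generator_schwartz hphi0.
have s1 := schwartz_ftN1 sp.
have [B B0 hB] := schwartz_weight s1.
exists (normc cst * B) => [|N z]; first by rewrite mulr_ge0 ?normc_ge0.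
have e0 : 0 < 2 ^- N :> R by rewrite invr_gt0 exprn_gt0.
rewrite filter_kernelE /lowpass (@ft_dilate _ _ (-1) phi0 _ z e0 sp).
rewrite /lowpass_bound; move: (2 ^- N) e0 => e e0.
move: (hB (e^-1 *: z)); move: (ft _ _ _) => F hF.
have ed : `|e ^- d| = e ^- d by rewrite ger0_norm// invr_ge0 exprn_ge0// ltW.
rewrite !Normc.normcM (normcR (e ^- d)) ed.
rewrite -mulrA ler_wpM2l ?normc_ge0// mulrCA ler_wpM2l ?invr_ge0 ?exprn_ge0 ?(ltW e0)//.
Qed.

Lemma measurable_lowpass_bound A e : measurable_fun setT (lowpass_bound A e).
Proof.
apply: measurable_funM => //; apply: measurable_funM => //.
apply: (measurableT_comp (@measurable_weight R d)).
by have := @measurable_affine_rV R d 0 e^-1; under eq_fun do rewrite add0r.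
Qed.

Lemma lowpass_bound_ge0 A e z : 0 <= A -> 0 < e -> 0 <= lowpass_bound A e z.
Proof. by move=> A0 e0; rewrite /lowpass_bound !mulr_ge0 ?weight_ge0 ?invr_ge0 ?exprn_ge0 ?(ltW e0). Qed.

Lemma integral_lowpass_boundl A e (y : E) : 0 <= A -> 0 < e ->
  (\int[leb]_x (lowpass_bound A e (x - y))%:E = (A * pi ^+ d)%:E)%E.
Proof.
move=> A0 e0; have ei0 : 0 < e^-1 by rewrite invr_gt0.
have w0 (u : E) : (0 <= (weight u)%:E)%E by rewrite lee_fin weight_ge0.
have mw : measurable_fun setT (fun u : E => (weight u)%:E).
  by apply/measurable_EFinP; exact: measurable_weight.
have wE (x : E) : (lowpass_bound A e (x - y))%:E =
    ((A * e ^- d)%:E * (weight (- (e^-1 *: y) + e^-1 *: x))%:E)%E.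
  by rewrite /lowpass_bound mulrA EFinM scalerBr addrC.
have mw' : measurable_fun setT (fun x : E => (weight (- (e^-1 *: y) + e^-1 *: x))%:E).
  exact: (measurableT_comp mw (measurable_affine_rV _ _)).
rewrite (eq_integral _ _ (fun x _ => wE x)) ge0_integralZl//; last first.
  by rewrite lee_fin mulr_ge0// invr_ge0 exprn_ge0// ltW.
rewrite (ge0_integral_affine _ ei0 mw w0) integral_weight -!EFinM; congr _%:E.
rewrite exprVn invrK; move: (pi ^+ d) => P; rewrite mulrA mulfVK//.
by rewrite expf_neq0// gt_eqF.
Qed.

Lemma integral_lowpass_boundr A e (x : E) : 0 <= A -> 0 < e ->
  (\int[leb]_y (lowpass_bound A e (x - y))%:E = (A * pi ^+ d)%:E)%E.
Proof.
move=> A0 e0; rewrite -(integral_lowpass_boundl x A0 e0); apply: eq_integral => y _.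
by rewrite /lowpass_bound -(weightN (e^-1 *: (y - x))) -scalerN opprB.
Qed.

Lemma normc_Cintegral_lee f (a : E -> R) : Cintegrable f ->
  (forall x, normc (f x) <= a x) -> measurable_fun setT a ->
  ((normc (Cintegral f))%:E <= \int[leb]_x (2 * a x)%:E)%E.
Proof.
move=> [f1 f2] fa ma.
have mf : Cmeasurable f.
  by split; apply/measurable_EFinP; [exact: measurable_int f1|exact: measurable_int f2].
have mn := measurable_normc mf.
have i_n : leb.-integrable setT (EFin \o (fun x => normc (f x))).
  apply: (@integrable_le _ _ _ (fun x => `|complex.Re (f x)| + `|complex.Im (f x)|)) => //.
    by move=> x; rewrite ger0_norm ?normc_ge0// normc_le.
  by apply: integrable_addr; exact: integrable_norm.
have := normc_Cintegral mf (fun x => lexx _) i_n; rewrite -lee_fin => /le_trans; apply.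
rewrite EFinM fineK; last exact: (integrable_fin_num measurableT i_n).
rewrite -ge0_integralZl//; last 2 first.
- exact/measurable_EFinP.
- by move=> x _; rewrite lee_fin normc_ge0.
apply: ge0_le_integral => //.
- by move=> x _; rewrite lee_fin mulr_ge0 ?normc_ge0.
- by apply/measurable_EFinP; exact: measurable_funM.
- by apply/measurable_EFinP; exact: measurable_funM.
- by move=> x _; rewrite lee_fin ler_wpM2l.
Qed.

(** The majorants of the kernels have the same integral for all [N]. *)
Lemma Lnorm_filtered : exists2 A, 0 <= A & forall N p g T, 1 < p ->
  represents g T -> leb.-integrable setT (EFin \o (fun x => normc (g x) * weight x)) ->
  (Lnorm leb p%:E (fun y => (normc (filtered (lowpass phi0 N) g y))%:E) <=
  A%:E * Lnorm leb p%:E (fun x => (normc (g x))%:E))%E.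
Proof.
have [A A0 hA] := lowpass_kernel_le.
have A20 : 0 <= 2 * A by rewrite mulr_ge0.
exists (2 * A * pi ^+ d) => [|N p g T p1 gT ig]; first by rewrite mulr_ge0// exprn_ge0// pi_ge0.
have sl := lowpass_schwartz hphi0 N.
have e0 : 0 < 2 ^- N :> R by rewrite invr_gt0 exprn_gt0.
have mg : measurable_fun setT (fun x => normc (g x)) := measurable_normc gT.1.
have mk := measurable_lowpass_bound (2 * A) (2 ^- N).
have k0 (x : E) : 0 <= lowpass_bound (2 * A) (2 ^- N) x by exact: lowpass_bound_ge0.
have cc0 : 0 <= 2 * A * pi ^+ d :> R by rewrite mulr_ge0// exprn_ge0// pi_ge0.
have yg := young p1 (fun x => normc_ge0 (g x)) k0 mg mk cc0
  (fun y => integral_lowpass_boundl y A20 e0) (fun x => integral_lowpass_boundr x A20 e0).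
apply: le_trans yg; apply: le_Lnorm.
- exact: lt_trans p1.
- by apply/measurable_EFinP; apply: measurable_normc; exact: (filtered_measurable sl gT ig).
- exact: (measurable_convolution (fun x => normc_ge0 (g x)) k0 mg mk).
move=> y; rewrite gee0_abs ?lee_fin ?normc_ge0// gee0_abs; last first.
  by apply: integral_ge0 => x _; rewrite lee_fin mulr_ge0 ?normc_ge0.
have := @normc_Cintegral_lee _ (fun x => normc (g x) * lowpass_bound A (2 ^- N) (x - y))
   (filtered_integrable sl gT ig y).
have mk' : measurable_fun setT (fun x : E => lowpass_bound A (2 ^- N) (x - y)).
  apply: (measurableT_comp (measurable_lowpass_bound _ _)).
  exact: (measurableT_comp (@measurable_sub_rV R d) (measurable_pair2 y)).
move=> /(_ _ (measurable_funM mg mk')) h; apply: le_trans (h _) _.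
  by move=> x; rewrite Normc.normcM ler_wpM2l ?normc_ge0.
rewrite le_eqVlt; apply/orP; left; apply/eqP; apply: eq_integral => x _.
by rewrite /lowpass_bound; congr _%:E; ring.
Qed.

Lemma le_add1_powR (t p : R) : 0 <= t -> 1 <= p -> t <= 1 + t `^ p.
Proof.
move=> t0 p1; have [t1|t1] := leP t 1.
  by rewrite (le_trans t1)// lerDl powR_ge0.
by rewrite (le_trans (le1r_powR (ltW t1) p1))// lerDr.
Qed.

(** [t <= 1 + t `^ p], and [weight] is bounded and integrable. *)
Lemma Lnorm_integrable_weight p g : 1 < p -> Cmeasurable g ->
  (Lnorm leb p%:E (fun x => (normc (g x))%:E) < +oo)%E ->
  leb.-integrable setT (EFin \o (fun x => normc (g x) * weight x)).
Proof.
move=> p1 mg fin; have mn := measurable_normc mg.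
have p0 : 0 < p by exact: lt_trans p1.
apply: (@integrable_le _ _ _ (fun x => weight x + normc (g x) `^ p)).
- by apply: measurable_funM => //; exact: measurable_weight.
- move=> x; rewrite ger0_norm ?mulr_ge0 ?normc_ge0 ?weight_ge0//.
  apply: (@le_trans _ _ ((1 + normc (g x) `^ p) * weight x)).
    by rewrite ler_wpM2r ?weight_ge0// le_add1_powR ?normc_ge0// ltW.
  by rewrite mulrDl mul1r lerD2l ler_piMr ?powR_ge0 ?weight_le1.
- apply: integrable_addr; first exact: integrable_weight.
  apply/integrableP; split.
    by apply/measurable_EFinP; exact: (measurableT_comp (measurable_powR p) mn).
  have := poweR_lty p fin; rewrite poweR_Lnorm ?lt0r_neq0//.
  congr (_ < _)%E; apply: eq_integral => x _ /=.
  by rewrite !ger0_norm ?powR_ge0 ?normc_ge0.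
Qed.

End lowpass_bound.

(** * Block norms of distributions *)

Section representing_functions.
Variables (R : realType) (d : nat).
Local Notation E := 'rV[R]_d.
Local Notation C := R[i].
Local Notation S := (schwartz R d).
Implicit Types (g h : E -> C) (T U : S -> C).

Lemma represents0 : represents (fun _ : E => 0 : C) (0 : S -> C).
Proof.
have h : Cintegrable (fun _ : E => 0 : C) by split; exact: integrable0.
split; first exact: cmeasurable_cst.
move=> psi; under eq_fun do rewrite mul0r; split=> //.
by apply: complex_eq => /=; rewrite /Rintegral integral0.
Qed.

Lemma representsD g h T U : represents g T -> represents h U ->
  represents (fun x => g x + h x) (fun psi => T psi + U psi).
Proof.
move=> [mg hg] [mh hh]; split; first exact: cmeasurableD.
move=> psi; have [ig ->] := hg psi; have [ih ->] := hh psi.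
have -> : (fun x => (g x + h x) * psi x) = fun x => g x * psi x + h x * psi x.
  by apply/funext => x; rewrite mulrDl.
by rewrite CintegralD//; split=> //; exact: CintegrableD.
Qed.

Lemma representsN g T : represents g T -> represents (fun x => - g x) (fun psi => - T psi).
Proof.
move=> [mg hg]; split; first exact: cmeasurableN.
move=> psi; have [ig ->] := hg psi.
have -> : (fun x => - g x * psi x) = fun x => -1 * (g x * psi x).
  by apply/funext => x; rewrite mulN1r mulNr.
by rewrite CintegralZ// mulN1r; split=> //; exact: CintegrableZ.
Qed.

End representing_functions.

Lemma le_ereal_infD (R : realType) (A B : set \bar R) (z : \bar R) :
  (forall x, A x -> 0 <= x)%E -> (forall y, B y -> 0 <= y)%E ->
  (forall x y, A x -> B y -> z <= x + y)%E -> (z <= ereal_inf A + ereal_inf B)%E.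
Proof.
move=> A0 B0 h; rewrite leNgt; apply/negP => hz.
have iA0 : (0 <= ereal_inf A)%E by exact: le_ereal_inf_tmp.
have iB0 : (0 <= ereal_inf B)%E by exact: le_ereal_inf_tmp.
have fB : ereal_inf B \is a fin_num.
  by rewrite ge0_fin_numE// (le_lt_trans _ (lt_le_trans hz (leey _)))// leeDr.
move: hz; rewrite -lteBrDr// => /ereal_inf_lt[x Ax]; rewrite lteBrDr// => hx.
have fx : x \is a fin_num.
  by rewrite ge0_fin_numE ?A0// (le_lt_trans _ (lt_le_trans hx (leey _)))// leeDl.
move: hx; rewrite addeC -lteBrDr// => /ereal_inf_lt[y By]; rewrite lteBrDr// addeC.
by apply/negP; rewrite -leNgt; exact: h.
Qed.

Section block_norm.
Variables (R : realType) (d : nat) (phi0 : 'rV[R]_d -> R[i]).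
Local Notation E := 'rV[R]_d.
Local Notation C := R[i].
Local Notation S := (schwartz R d).
Local Notation leb := (lebesgue_rV R d).
Variables (s p : R) (q : \bar R).
Hypothesis p1 : 1 < p.
Hypothesis q0 : (0 < q)%E.
Implicit Types (f : S -> C) (g : nat -> E -> C).

Local Notation bn := (block_norm phi0 s p q).

Let p0 : 0 < p. Proof. exact: lt_trans p1. Qed.

Definition weighted g (nu : nat) (x : E) : R := 2 `^ (nu%:R * s) * normc (g nu x).

Definition block_fun j g (x : E) : R := block_lq q j (weighted g ^~ x).

Definition block_rep f j g := forall nu, in_block j nu -> represents (g nu) (piece phi0 nu f).

Lemma weighted_ge0 g nu x : 0 <= weighted g nu x.
Proof. by rewrite mulr_ge0 ?powR_ge0 ?normc_ge0. Qed.

Lemma measurable_weighted g nu : Cmeasurable (g nu) -> measurable_fun setT (weighted g nu).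
Proof. by move=> mg; apply: measurable_funM => //; exact: measurable_normc. Qed.

Lemma measurable_block_fun f j g : block_rep f j g -> measurable_fun setT (block_fun j g).
Proof.
by move=> fg; apply: measurable_block_lq => // nu /fg[mg _]; exact: measurable_weighted.
Qed.

Lemma block_norm_le f j g : block_rep f j g ->
  (bn f j <= Lnorm leb p%:E (fun x => (block_fun j g x)%:E))%E.
Proof. by move=> fg; apply: ereal_inf_lbound; exists g. Qed.

Lemma block_norm_ge f j (X : \bar R) :
  (forall g, block_rep f j g -> X <= Lnorm leb p%:E (fun x => (block_fun j g x)%:E))%E ->
  (X <= bn f j)%E.
Proof. by move=> h; apply: le_ereal_inf_tmp => _ [g [fg ->]]; exact: h. Qed.

Lemma block_norm_ge0 f j : (0 <= bn f j)%E.
Proof. by apply: block_norm_ge => g _; exact: Lnorm_ge0. Qed.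

Lemma block_norm_lty f j : (bn f j < +oo)%E -> exists2 g, block_rep f j g &
  (Lnorm leb p%:E (fun x => (block_fun j g x)%:E) < +oo)%E.
Proof. by move=> /ereal_inf_lt[_ [g [fg ->]] h]; exists g. Qed.

Lemma le_Lnorm_block (u v : E -> R) : measurable_fun setT u -> measurable_fun setT v ->
  (forall x, 0 <= u x <= v x) ->
  (Lnorm leb p%:E (fun x => (u x)%:E) <= Lnorm leb p%:E (fun x => (v x)%:E))%E.
Proof.
move=> mu mv uv; apply: le_Lnorm => //; [exact/measurable_EFinP|exact/measurable_EFinP|].
move=> x; have /andP[u0 h] := uv x.
by rewrite /= lee_fin !ger0_norm// (le_trans u0).
Qed.

Lemma Lnorm_block_eq0 (u : E -> R) : (forall x, u x = 0) ->
  (Lnorm leb p%:E (fun x => (u x)%:E) = 0)%E.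
Proof.
move=> u0; rewrite (_ : (fun x => _) = cst 0%E); last by apply/funext => x; rewrite u0.
by apply: Lnorm0; rewrite eqe lt0r_neq0.
Qed.

Lemma block_lq_eq0 j (a : nat -> R) : (forall nu, in_block j nu -> a nu = 0) -> block_lq q j a = 0.
Proof.
move=> a0; apply/eqP; rewrite eq_le block_lq_ge0// andbT.
apply: (@le_trans _ _ (block_lq q j (fun=> 0))); last exact: (@block_lq_single _ _ _ _ 0%N).
by apply: le_block_lq => // nu /a0 ->; rewrite lexx.
Qed.

Lemma block_norm_eq0 f j : (forall nu, in_block j nu -> piece phi0 nu f = 0) ->
  bn f j = 0%E.
Proof.
move=> f0; apply/eqP; rewrite eq_le block_norm_ge0 andbT.
have fg : block_rep f j (fun _ _ => 0) by move=> nu /f0 ->; exact: represents0.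
apply: le_trans (block_norm_le fg) _; rewrite Lnorm_block_eq0// => x.
by apply: block_lq_eq0 => nu _; rewrite /weighted Normc.normc0 mulr0.
Qed.

(** The quasi-triangle inequality in [l_q], then Minkowski's inequality in [L_p]. *)
Lemma Lnorm_block_lqD j (a b c : nat -> E -> R) :
  (forall nu, in_block j nu -> measurable_fun setT (a nu)) ->
  (forall nu, in_block j nu -> measurable_fun setT (b nu)) ->
  (forall nu, in_block j nu -> measurable_fun setT (c nu)) ->
  (forall nu x, 0 <= a nu x) -> (forall nu x, 0 <= b nu x) ->
  (forall nu x, in_block j nu -> 0 <= c nu x <= a nu x + b nu x) ->
  (Lnorm leb p%:E (fun x => (block_lq q j (c ^~ x))%:E) <= (lq_cst q)%:E *
   (Lnorm leb p%:E (fun x => (block_lq q j (a ^~ x))%:E) +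
    Lnorm leb p%:E (fun x => (block_lq q j (b ^~ x))%:E)))%E.
Proof.
move=> ma mb mc a0 b0 cab.
have l0 : 0 <= lq_cst q by rewrite (le_trans ler01)// lq_cst_ge1.
have mA := @measurable_block_lq R _ _ q j a q0 ma.
have mB := @measurable_block_lq R _ _ q j b q0 mb.
have mC := @measurable_block_lq R _ _ q j c q0 mc.
have mAB := measurable_funD mA mB.
apply: (@le_trans _ _ (Lnorm leb p%:E (fun x => (lq_cst q * (block_lq q j (a ^~ x) + block_lq q j (b ^~ x)))%:E))).
  apply: le_Lnorm_block => //; first exact: measurable_funM.
  move=> x; rewrite block_lq_ge0//=; apply: le_trans (@block_lqD _ _ _ _ _ q0 (a0 ^~ x) (b0 ^~ x)).
  by apply: le_block_lq => // nu; exact: cab.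
rewrite Lnorm_scale//; apply: lee_wpmul2l; first by rewrite lee_fin.
exact: minkowski_EFin mA mB (ltW p1).
Qed.

Lemma pieceD nu f0 f1 : piece phi0 nu (f0 + f1) = fun psi => piece phi0 nu f0 psi + piece phi0 nu f1 psi.
Proof. by apply/funext => psi; exact: freq_filterD. Qed.

Lemma pieceN nu f : piece phi0 nu (- f) = fun psi => - piece phi0 nu f psi.
Proof. by apply/funext => psi; exact: freq_filterN. Qed.

Lemma block_normD f0 f1 j : (bn (f0 + f1)%R j <= (lq_cst q)%:E * (bn f0 j + bn f1 j))%E.
Proof.
have l0 : 0 < lq_cst q by rewrite (lt_le_trans ltr01)// lq_cst_ge1.
have key g0 g1 : block_rep f0 j g0 -> block_rep f1 j g1 ->
   (bn (f0 + f1)%R j <= (lq_cst q)%:E * (Lnorm leb p%:E (fun x => (block_fun j g0 x)%:E) +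
     Lnorm leb p%:E (fun x => (block_fun j g1 x)%:E)))%E.
  move=> h0 h1; have h : block_rep (f0 + f1) j (fun nu x => g0 nu x + g1 nu x).
    by move=> nu nuj; rewrite pieceD; exact: representsD (h0 nu nuj) (h1 nu nuj).
  apply: le_trans (block_norm_le h) _; apply: Lnorm_block_lqD.
  - by move=> nu /h0[mg _]; exact: measurable_weighted.
  - by move=> nu /h1[mg _]; exact: measurable_weighted.
  - by move=> nu /h[mg _]; exact: measurable_weighted.
  - exact: weighted_ge0.
  - exact: weighted_ge0.
  - move=> nu x _; rewrite weighted_ge0/= /weighted -mulrDr ler_wpM2l ?powR_ge0//.
    exact: le_normcD.
rewrite -lee_pdivrMl//; apply: le_ereal_infD.
- by move=> _ [g [_ ->]]; exact: Lnorm_ge0.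
- by move=> _ [g [_ ->]]; exact: Lnorm_ge0.
by move=> _ _ [g0 [h0 ->]] [g1 [h1 ->]]; rewrite lee_pdivrMl//; exact: key.
Qed.

Lemma block_normN f j : (bn (- f)%R j <= bn f j)%E.
Proof.
apply: block_norm_ge => g fg.
have h : block_rep (- f) j (fun nu x => - g nu x).
  by move=> nu nuj; rewrite pieceN; exact: representsN (fg nu nuj).
apply: le_trans (block_norm_le h) _; rewrite le_eqVlt; apply/orP; left; apply/eqP.
apply: eq_Lnorm => x; congr (block_lq _ _ _)%:E; apply/funext => nu.
by rewrite /weighted normcN.
Qed.

End block_norm.

(** * Splitting a distribution at a block *)

Section tempered_functions.
Variables (R : realType) (d : nat).
Local Notation E := 'rV[R]_d.
Local Notation C := R[i].
Local Notation S := (schwartz R d).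
Local Notation leb := (lebesgue_rV R d).
Implicit Types (g : E -> C) (T U : S -> C) (psi : S).

Lemma le_seminorm N M (f : E -> C) : (N <= M)%N -> (seminorm N f <= seminorm M f)%E.
Proof.
move=> NM; apply: ge_ereal_sup => _ [s [x [sN ->]]].
apply: (@le_trans _ _ ((1 + enorm x) ^+ M * normc (partial s f x))%:E); last first.
  by apply: ereal_sup_ubound; exists s, x; rewrite (leq_trans sN NM).
by rewrite lee_fin ler_wpM2r ?normc_ge0// ler_weXn2l// lerDl enorm_ge0.
Qed.

Lemma seminorm_fin N psi : seminorm N psi \is a fin_num.
Proof.
by rewrite ge0_fin_numE ?seminorm_ge0//; have [_] := schwartz_is_schwartz psi; exact.
Qed.

Lemma seminorm_weight psi x : normc (psi x) <= fine (seminorm (2 * d) psi) * weight x.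
Proof.
have w0 := weight_gt0 x; rewrite -ler_pdivrMr//.
have pE : partial [::] psi x = psi x by rewrite /partial /=; case: (psi x).
rewrite -lee_fin fineK ?seminorm_fin//.
apply: (@le_trans _ _ ((1 + enorm x) ^+ (2 * d) * normc (partial [::] psi x))%:E); last first.
  by apply: ereal_sup_ubound; exists [::], x.
by rewrite lee_fin pE mulrC ler_wpM2r ?normc_ge0// weight_enorm.
Qed.

(** A seminorm of a test function controls its quotient by [weight]. *)
Lemma represents_tempered g T : linear T -> represents g T ->
  leb.-integrable setT (EFin \o (fun x => normc (g x) * weight x)) -> tempered T.
Proof.
move=> lT [mg gT] ig; split=> //.
exists (2 * d)%N, (2 * \int[leb]_x (normc (g x) * weight x)) => psi.
have [_ ->] := gT psi; rewrite -(fineK (seminorm_fin (2 * d) psi)).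
move: (seminorm_weight psi); move: (fine _) => B hB.
have mgp : Cmeasurable (fun x => g x * psi x).
  by apply: cmeasurableM => //; exact: schwartz_measurable (schwartz_is_schwartz psi).
rewrite -EFinM lee_fin.
have := @normc_Cintegral _ _ _ (fun x => B * (normc (g x) * weight x)) mgp _ (integrable_mulrl B ig).
have -> : 2 * \int[leb]_x (normc (g x) * weight x) * B = 2 * \int[leb]_x (B * (normc (g x) * weight x)).
  by rewrite RintegralZl// -mulrA [X in 2 * X]mulrC.
apply.
by move=> x; rewrite Normc.normcM mulrCA ler_wpM2l ?normc_ge0.
Qed.

Lemma tempered0 : tempered (0 : S -> C).
Proof.
split=> [a x y|]; first by rewrite scaler0 addr0.
by exists 0%N, 0 => psi; rewrite Normc.normc0 mul0e.
Qed.

Lemma temperedD T U : tempered T -> tempered U -> tempered (T + U).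
Proof.
move=> [lT [N [c hc]]] [lU [M [c' hc']]]; split.
  move=> a x y; rewrite -[LHS]/(T (a *: x + y) + U (a *: x + y)) lT lU.
  by rewrite -[RHS]/(a *: (T x + U x) + (T y + U y)) scalerDr addrACA.
have bound (V : C) L (B : R) (x : E -> C) : (L <= maxn N M)%N -> ((normc V)%:E <= B%:E * seminorm L x)%E ->
    ((normc V)%:E <= `|B|%:E * seminorm (maxn N M) x)%E.
  move=> LN /le_trans; apply; apply: (@le_trans _ _ (`|B|%:E * seminorm L x)%E).
    by apply: lee_wpmul2r; rewrite ?seminorm_ge0// lee_fin ler_norm.
  by apply: lee_wpmul2l; rewrite ?lee_fin// le_seminorm.
exists (maxn N M), (`|c| + `|c'|) => psi.
apply: (@le_trans _ _ ((normc (T psi))%:E + (normc (U psi))%:E)%E).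
  by rewrite -EFinD lee_fin; exact: le_normcD.
rewrite EFinD ge0_muleDl ?lee_fin//; apply: leeD.
  by apply: (bound _ _ _ _ _ (hc psi)); exact: leq_maxl.
by apply: (bound _ _ _ _ _ (hc' psi)); exact: leq_maxr.
Qed.

Lemma temperedN T : tempered T -> tempered (- T).
Proof.
move=> [lT [N [c hc]]]; split.
  move=> a x y; rewrite -[LHS]/(- T (a *: x + y)) lT.
  by rewrite -[RHS]/(a *: - T x - T y) scalerN opprD.
by exists N, c => psi; rewrite normcN.
Qed.

End tempered_functions.

Section splitting.
Variables (R : realType) (d : nat) (phi0 : 'rV[R]_d -> R[i]).
Hypothesis hphi0 : resolution_generator phi0.
Local Notation E := 'rV[R]_d.
Local Notation C := R[i].
Local Notation S := (schwartz R d).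
Local Notation leb := (lebesgue_rV R d).
Variables (s p : R) (q : \bar R).
Hypothesis p1 : 1 < p.
Hypothesis q0 : (0 < q)%E.
Implicit Types (f : S -> C) (g : nat -> E -> C).

Local Notation bn := (block_norm phi0 s p q).
Local Notation lowpass := (lowpass phi0).
Local Notation block_rep := (block_rep phi0).
Local Notation weighted := (weighted s).
Local Notation block_fun := (block_fun s q).

Let p0 : 0 < p. Proof. exact: lt_trans p1. Qed.

Lemma Lnorm_weightedE g nu : Cmeasurable (g nu) ->
  Lnorm leb p%:E (fun x => (weighted g nu x)%:E) =
  ((2 `^ (nu%:R * s))%:E * Lnorm leb p%:E (fun x => (normc (g nu x))%:E))%E.
Proof.
by move=> mg; apply: Lnorm_scale; rewrite ?powR_ge0//; exact: measurable_normc.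
Qed.

Lemma le_Lnorm_weighted f j g nu : block_rep f j g -> in_block j nu ->
  (Lnorm leb p%:E (fun x => (weighted g nu x)%:E) <=
   Lnorm leb p%:E (fun x => (block_fun j g x)%:E))%E.
Proof.
move=> fg nuj; apply: le_Lnorm_block => //.
- by apply: measurable_weighted; have [] := fg nu nuj.
- exact: measurable_block_fun fg.
move=> x; rewrite weighted_ge0/=.
by apply: (@le_block_lq_term _ _ _ (weighted g ^~ x)) => // mu; exact: weighted_ge0.
Qed.

(** This is what the convolution with a filter kernel requires. *)
Lemma block_rep_integrable f j g nu : block_rep f j g -> in_block j nu ->
  (Lnorm leb p%:E (fun x => (block_fun j g x)%:E) < +oo)%E ->
  leb.-integrable setT (EFin \o (fun x => normc (g nu x) * weight x)).
Proof.
move=> fg nuj fin; have [mg _] := fg nu nuj.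
apply: (Lnorm_integrable_weight p1 mg).
have := le_lt_trans (le_Lnorm_weighted fg nuj) fin.
rewrite Lnorm_weightedE// => h.
have c0 : 0 < 2 `^ (nu%:R * s) :> R by rewrite powR_gt0.
have [e|//] := eqVneq (Lnorm leb p%:E (fun x => (normc (g nu x))%:E)) +oo%E.
  by move: h; rewrite e gt0_muley ?lte_fin.
by rewrite -ltey => ->.
Qed.

Lemma piece_lowpass_low N nu f : (nu < N)%N ->
  piece phi0 nu (freq_filter (lowpass N) f) = piece phi0 nu f.
Proof.
move=> h; rewrite -[LHS]/(freq_filter _ (freq_filter _ _)).
rewrite freq_filter_comp; [|exact: dyadic_schwartz|exact: lowpass_schwartz].
by congr freq_filter; apply/funext => xi; exact: lowpass_dyadic_low.
Qed.

Lemma piece_lowpass_high N nu f : linear f -> (N.+1 < nu)%N ->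
  piece phi0 nu (freq_filter (lowpass N) f) = 0.
Proof.
move=> lf h; rewrite -[LHS]/(freq_filter _ (freq_filter _ _)).
rewrite freq_filter_comp; [|exact: dyadic_schwartz|exact: lowpass_schwartz].
rewrite -(freq_filter0 lf); congr freq_filter; apply/funext => xi.
exact: lowpass_dyadic_high.
Qed.

Lemma piece_lowpass N nu f :
  piece phi0 nu (freq_filter (lowpass N) f) = freq_filter (lowpass N) (piece phi0 nu f).
Proof.
rewrite -[LHS]/(freq_filter _ (freq_filter _ _)) -[X in _ = freq_filter _ X]/(freq_filter _ _).
rewrite !freq_filter_comp; try exact: dyadic_schwartz; try exact: lowpass_schwartz.
by congr freq_filter; apply/funext => xi; exact: mulrC.
Qed.

(** The pieces of index below [N] are unchanged, those of index above [N.+1] vanish,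
    and each of the two remaining ones is filtered with a loss independent of [N]. *)
Lemma block_norm_lowpass : exists2 A : R, 1 <= A & forall N j f, linear f ->
  (bn (freq_filter (lowpass N) f) j <= A%:E * bn f j)%E.
Proof.
have [A A0 hA] := Lnorm_filtered hphi0.
have l1 := lq_cst_ge1 q0; have l0 : 0 <= lq_cst q by exact: le_trans l1.
exists (lq_cst q * (1 + lq_cst q * (A + A))).
  by rewrite -[leLHS]mulr1; apply: ler_pM => //; rewrite lerDl mulr_ge0// addr_ge0.
move=> N j f lf; have K0 : 0 < lq_cst q * (1 + lq_cst q * (A + A)).
  by rewrite mulr_gt0 ?(lt_le_trans ltr01)// lerDl mulr_ge0// addr_ge0.
rewrite -lee_pdivrMl//; apply: block_norm_ge => g fg; rewrite lee_pdivrMl//.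
set G := Lnorm leb p%:E (fun x => (block_fun j g x)%:E).
have [->|] := eqVneq G +oo%E; first by rewrite gt0_muley ?lte_fin// leey.
rewrite -ltey => Gfin; have ig nu (nuj : in_block j nu) := block_rep_integrable fg nuj Gfin.
pose h nu := filtered (lowpass N) (g nu).
pose g0 nu := if (nu < N)%N then g nu else if (nu == N) || (nu == N.+1) then h nu else fun=> 0.
have sl := lowpass_schwartz hphi0 N.
have hrep nu : in_block j nu -> represents (h nu) (freq_filter (lowpass N) (piece phi0 nu f)).
  by move=> nuj; exact: (represents_filtered sl (fg nu nuj) (ig nu nuj)).
have h0 : block_rep (freq_filter (lowpass N) f) j g0.
  move=> nu nuj; rewrite /g0; case: ltnP => [nN|Nnu].
    by rewrite piece_lowpass_low//; exact: fg.
  case: ifPn => [_|]; first by rewrite piece_lowpass; exact: hrep.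
  rewrite negb_or => /andP[n1 n2]; rewrite piece_lowpass_high//; first exact: represents0.
  by rewrite ltn_neqAle eq_sym n2 ltn_neqAle eq_sym n1.
pose b M nu (x : E) := if nu == M then weighted h nu x else 0.
have b0 M nu x : 0 <= b M nu x by rewrite /b; case: eqP => // _; exact: weighted_ge0.
have mb M nu : in_block j nu -> measurable_fun setT (b M nu).
  move=> nuj; rewrite /b; case: eqP => _; last exact: measurable_cst.
  by apply: measurable_weighted; have [] := hrep nu nuj.
have hb M : (Lnorm leb p%:E (fun x => (block_lq q j (b M ^~ x))%:E) <= A%:E * G)%E.
  have [Mj|Mj] := boolP (in_block j M); last first.
    rewrite Lnorm_block_eq0 ?mule_ge0 ?Lnorm_ge0 ?lee_fin// => x.
    apply: block_lq_eq0 => // nu nuj; rewrite /b; case: eqP => // e.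
    by move: Mj; rewrite -e nuj.
  have mh : Cmeasurable (h M) by have [] := hrep M Mj.
  apply: (@le_trans _ _ (Lnorm leb p%:E (fun x => (weighted h M x)%:E))).
    apply: le_Lnorm_block => //.
    - by apply: measurable_block_lq => // nu; exact: mb.
    - exact: measurable_weighted.
    move=> x; rewrite block_lq_ge0//=.
    have := @block_lq_single _ q j (b M ^~ x) M q0 (b0 M M x).
    rewrite [b M M x]/b eqxx; apply=> mu _ /negbTE; rewrite /b => -> //.
  rewrite Lnorm_weightedE//; apply: (@le_trans _ _ (A%:E * Lnorm leb p%:E (fun x => (weighted g M x)%:E))%E).
    rewrite Lnorm_weightedE; last by have [] := fg M Mj.
    rewrite muleCA; apply: lee_wpmul2l; first by rewrite lee_fin powR_ge0.
    exact: (hA N p (g M) _ p1 (fg M Mj) (ig M Mj)).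
  by apply: lee_wpmul2l; rewrite ?lee_fin//; exact: le_Lnorm_weighted fg Mj.
have mg nu : in_block j nu -> measurable_fun setT (weighted g nu).
  by move=> /fg[mg _]; exact: measurable_weighted.
have mg0 nu : in_block j nu -> measurable_fun setT (weighted g0 nu).
  by move=> /h0[mg0 _]; exact: measurable_weighted.
apply: le_trans (@block_norm_le _ _ phi0 s p q _ j g0 h0) _.
apply: (@le_trans _ _ ((lq_cst q)%:E * (G + (lq_cst q)%:E * (A%:E * G + A%:E * G)))%E); last first.
  rewrite -ge0_muleDl ?lee_fin// -EFinD muleA -EFinM -[X in (X + _)%E]mul1e.
  by rewrite -ge0_muleDl ?lee_fin ?mulr_ge0 ?addr_ge0// -EFinD muleA -EFinM.
pose c nu x := b N nu x + b N.+1 nu x.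
have mc nu : in_block j nu -> measurable_fun setT (c nu).
  by move=> nuj; apply: measurable_funD; exact: mb.
apply: (@le_trans _ _ ((lq_cst q)%:E * (G + Lnorm leb p%:E (fun x => (block_lq q j (c ^~ x))%:E)))%E).
  apply: Lnorm_block_lqD => //.
  - by move=> nu x; exact: weighted_ge0.
  - by move=> nu x; rewrite addr_ge0.
  move=> nu x _; rewrite weighted_ge0/= /c /g0 {1}/weighted.
  case: ltnP => _; first by rewrite lerDl addr_ge0.
  case: ifPn => [|_]; last by rewrite Normc.normc0 mulr0 !addr_ge0 ?weighted_ge0.
  rewrite -/(weighted h nu x) /b; case: eqP => [->|_]/=.
    by move=> _; rewrite addrCA lerDl addr_ge0 ?weighted_ge0//; case: eqP => // _; exact: weighted_ge0.
  by move=> ->; rewrite add0r lerDr weighted_ge0.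
apply: lee_wpmul2l; rewrite ?lee_fin//; apply: leeD => //.
apply: (@le_trans _ _ ((lq_cst q)%:E * (Lnorm leb p%:E (fun x => (block_lq q j (b N ^~ x))%:E)
   + Lnorm leb p%:E (fun x => (block_lq q j (b N.+1 ^~ x))%:E)))%E).
  apply: Lnorm_block_lqD => //; try by move=> nu nuj; exact: mb.
  by move=> nu x _; rewrite addr_ge0//= lexx.
by apply: lee_wpmul2l; rewrite ?lee_fin//; apply: leeD.
Qed.

Lemma piece_rep f nu : (forall j, bn f j < +oo)%E -> exists2 g, represents g (piece phi0 nu f) &
  leb.-integrable setT (EFin \o (fun x => normc (g x) * weight x)).
Proof.
move=> fin; pose j := trunc_log 2 nu.+1.
have nuj : in_block j nu.
  rewrite /in_block; have := @trunc_log_bounds 2 nu.+1 isT isT; rewrite -/j => /andP[h1 h2].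
  by rewrite -ltnS prednK ?expn_gt0// h1 ltn_predRL h2.
have [g fg gfin] := block_norm_lty (fin j).
by exists (g nu); [exact: fg|exact: block_rep_integrable fg nuj gfin].
Qed.

(** It is a finite sum of pieces, hence represented by a function that is
    integrable against [weight]. *)
Lemma tempered_lowpass f N : linear f -> (forall j, bn f j < +oo)%E ->
  tempered (freq_filter (lowpass N) f).
Proof.
move=> lf fin; have sl := lowpass_schwartz hphi0.
have [g gT ig] : exists2 g, represents g (freq_filter (lowpass N) f) &
    leb.-integrable setT (EFin \o (fun x => normc (g x) * weight x)).
  elim: N => [|N [g gT ig]].
    by have [g gT ig] := piece_rep 0 fin; exists g => //; rewrite lowpass0.
  have [g' gT' ig'] := piece_rep N.+1 fin; exists (fun x => g x + g' x).
    rewrite (_ : freq_filter _ f = fun psi => freq_filter (lowpass N) f psi + piece phi0 N.+1 f psi).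
      exact: representsD.
    apply/funext => psi; rewrite (_ : lowpass N.+1 = fun xi => lowpass N xi + dyadic phi0 N.+1 xi); last first.
      by apply/funext => xi; exact: lowpassS.
    by apply: freq_filter_mulD => //; exact: dyadic_schwartz.
  apply: (@integrable_le _ _ _ (fun x => normc (g x) * weight x + normc (g' x) * weight x)).
  - apply: measurable_funM; last exact: measurable_weight.
    by apply: measurable_normc; apply: cmeasurableD; [exact: gT.1|exact: gT'.1].
  - move=> x; rewrite ger0_norm ?mulr_ge0 ?normc_ge0 ?weight_ge0// -mulrDl.
    by rewrite ler_wpM2r ?weight_ge0// le_normcD.
  - exact: integrable_addr.
apply: represents_tempered gT ig; exact: linear_freq_filter.
Qed.

(** The multiplier [lowpass N], for [N] the last index of the block [J], only
    alters the pieces of index [N], in the block [J], and [N.+1], in the next one. *)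
Lemma block_splitting : exists2 A : R, 1 <= A & forall f, tempered f ->
  (forall j, bn f j < +oo)%E -> forall J, exists f0 f1 : S -> C,
  [/\ tempered f0, tempered f1, f = f0 + f1 &
    forall j, [/\ (bn f0 j <= A%:E * bn f j)%E, (bn f1 j <= A%:E * bn f j)%E,
      ((J.+1 < j)%N -> bn f0 j = 0) & ((j < J)%N -> bn f1 j = 0)]].
Proof.
have [A A1 hA] := block_norm_lowpass; have l1 := lq_cst_ge1 q0.
have A0 : 0 <= A by exact: le_trans A1.
exists (lq_cst q * (1 + A)) => [|f tf fin J].
  by rewrite -[leLHS]mulr1; apply: ler_pM => //; rewrite lerDl.
have lf := tf.1; pose N := (2 ^ J.+1).-2.
pose f0 := freq_filter (lowpass N) f; pose f1 := f - f0.
have t0 : tempered f0 by exact: tempered_lowpass.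
have AK : A <= lq_cst q * (1 + A).
  by rewrite -[leLHS]mul1r; apply: ler_pM => //; rewrite lerDr.
exists f0, f1; split=> [//||| j].
- by apply: temperedD => //; exact: temperedN.
- by rewrite /f1 addrC subrK.
have E2 : N.+2 = (2 ^ J.+1)%N by rewrite /N; have := expn_gt0 2 J; rewrite expnS mul2n; case: (2 ^ J)%N.
have b0 : (bn f0 j <= A%:E * bn f j)%E by exact: hA.
split=> [|| Jj | jJ].
- by apply: le_trans b0 _; rewrite lee_wpmul2r ?block_norm_ge0// lee_fin.
- apply: le_trans (@block_normD _ _ phi0 s p q p1 q0 f (- f0) j) _; rewrite EFinM -muleA.
  apply: lee_wpmul2l; first by rewrite lee_fin (le_trans ler01).
  rewrite EFinD ge0_muleDl ?lee_fin// mul1e; apply: leeD => //.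
  by apply: le_trans b0; exact: block_normN.
- apply: block_norm_eq0 => // nu /andP[h _]; apply: piece_lowpass_high => //.
  have : (2 ^ J.+2 <= 2 ^ j)%N by rewrite leq_exp2l.
  rewrite [(2 ^ J.+2)%N]expnS -E2 mul2n => h'; move: h h'; clear; move: (2 ^ j)%N N => n m; lia.
- apply: block_norm_eq0 => // nu /andP[_ h]; rewrite /f1 pieceD.
  apply/funext => psi; rewrite pieceN piece_lowpass_low ?subrr//.
  have : (2 ^ j.+1 <= 2 ^ J)%N by rewrite leq_exp2l.
  have := expn_gt0 2 J; move: E2; rewrite expnS mul2n -addnn => E2 _ h'.
   move: h h' E2; clear; move: (2 ^ j.+1)%N (2 ^ J)%N N => n k m; lia.
Qed.

End splitting.

(** * Sequences, counting measure and geometric averages *)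

Section nonnegative_series.
Variable R : realType.
Implicit Types (u v : nat -> \bar R) (r : \bar R).
Local Open Scope ereal_scope.

Lemma nneseries_le_ub u M : (forall j, 0 <= u j) ->
  (forall n, \sum_(0 <= j < n) u j <= M) -> \sum_(j <oo) u j <= M.
Proof.
move=> u0 h; apply: lime_le; first by apply: is_cvg_nneseries => n _ _; exact: u0.
exact: nearW.
Qed.

Lemma nneseries_ge_term u j : (forall j, 0 <= u j) -> u j <= \sum_(k <oo) u k.
Proof.
move=> u0; apply: le_trans (nneseries_lim_ge j.+1 (fun n _ _ => u0 n)).
by rewrite big_nat_recr//= leeDr// sume_ge0.
Qed.

Lemma counting_set1 (j : nat) : counting [set j] = 1 :> \bar R.
Proof. by rewrite /counting asboolT ?fset_set1 ?finmap.cardfs1//; exact: finite_set1. Qed.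

(** A set of measure 0 for the counting measure is empty. *)
Lemma counting_ae (P : nat -> Prop) :
  (\forall x \ae (@counting nat R), P x) -> forall x, P x.
Proof.
move=> [N [mN N0 PN]] x; apply/not_notP => nP.
have : counting [set x] <= counting N :> \bar R.
  by apply: le_measure; rewrite ?inE// => _ ->; exact: PN.
by rewrite N0 counting_set1 lee_fin ler10.
Qed.

Lemma counting_setT_gt0 : 0 < (@counting nat R) [set: nat].
Proof.
rewrite (lt_le_trans _ (_ : counting [set 0%N] <= _))//.
  by rewrite counting_set1 lte_fin.
by apply: le_measure; rewrite ?inE.
Qed.

Lemma le_Lnorm_counting_term v r j : 0 < r -> (forall j, 0 <= v j) ->
  v j <= Lnorm (@counting nat R) r v.
Proof.
case: r => [r||]// r0 v0.
  have r1 : (0 < r)%R by rewrite -lte_fin.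
  rewrite Lnorm_counting// -[leLHS](poweRe1 (v0 j)) -(mulfV (lt0r_neq0 r1)) poweRrM.
  apply: lee_poweR; rewrite ?invr_gt0 ?poweR_ge0//.
  rewrite -[X in X `^ r](gee0_abs (v0 j)).
  by apply: (@nneseries_ge_term (fun k => `|v k| `^ r)) => k; exact: poweR_ge0.
rewrite unlock counting_setT_gt0.
have /counting_ae/(_ j)/= := @ess_sup_ge _ _ R counting (abse \o v).
by rewrite gee0_abs.
Qed.

Lemma Lnorm_counting_oo_le v M : (forall j, 0 <= v j <= M) ->
  Lnorm (@counting nat R) +oo v <= M.
Proof.
move=> vM; rewrite unlock counting_setT_gt0; apply/ess_supP; apply: nearW => j /=.
by have /andP[v0 h] := vM j; rewrite gee0_abs.
Qed.

End nonnegative_series.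

Section geometric_sums.
Variable R : realType.
Implicit Types (x : R) (j k n : nat).

Definition dist j k := (j - k + (k - j))%N.

Lemma distC j k : dist j k = dist k j.
Proof. by rewrite /dist addnC. Qed.

Lemma sum_expr_le x n : 0 < x < 1 -> \sum_(i < n) x ^+ i <= (1 - x)^-1.
Proof.
move=> /andP[x0 x1]; have x1' : 0 < 1 - x by rewrite subr_gt0.
rewrite -[leRHS]mul1r ler_pdivlMr// mulrC -opprB mulNr -subrX1 opprB.
by rewrite gerBl exprn_ge0// ltW.
Qed.

Lemma sum_expr_dist_le x k n : 0 < x < 1 ->
  \sum_(j < n) x ^+ dist j k <= 2 / (1 - x).
Proof.
move=> x01; have /andP[x0 x1] := x01.
have x1' : 0 < 1 - x by rewrite subr_gt0.
have key : \sum_(j < n) x ^+ dist j k <= \sum_(i < n) x ^+ i + \sum_(i < k) x ^+ i.+1.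
  elim: k n => [|k ih] n.
    by rewrite big_ord0 addr0; apply: ler_sum => j _; rewrite /dist subn0 sub0n addn0.
  case: n => [|n].
    by rewrite !big_ord0 add0r; apply: sumr_ge0 => i _; rewrite exprn_ge0// ltW.
  rewrite big_ord_recl /dist sub0n subn0 add0n.
  rewrite [X in _ <= X + _]big_ord_recr [X in _ <= _ + X]big_ord_recr/=.
  rewrite [leRHS](_ : _ = x ^+ k.+1 + (\sum_(i < n) x ^+ i + \sum_(i < k) x ^+ i.+1 + x ^+ n)); last by ring.
  rewrite lerD2l; apply: le_trans (_ : _ <= \sum_(i < n) x ^+ i + \sum_(i < k) x ^+ i.+1) _.
    by apply: le_trans (ih n); apply: ler_sum => j _; rewrite /bump leq0n add1n !subSS.
  by rewrite lerDl exprn_ge0// ltW.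
apply: (le_trans key); rewrite mulr2n mulrDl mul1r; apply: lerD; first exact: sum_expr_le.
apply: le_trans (sum_expr_le k x01); apply: ler_sum => i _.
by rewrite exprS ler_piMl ?exprn_ge0 ?(ltW x0)// ltW.
Qed.

Lemma nneseries_expr_dist_le x k : 0 < x < 1 ->
  (\sum_(j <oo) (x ^+ dist j k)%:E <= (2 / (1 - x))%:E)%E.
Proof.
move=> x01; have /andP[x0 _] := x01; apply: nneseries_le_ub => [j|n].
  by rewrite lee_fin exprn_ge0// ltW.
by rewrite sumEFin lee_fin big_mkord; exact: sum_expr_dist_le.
Qed.

(** The bound does not depend on the place [k] of the peak, because a two-sided
    geometric series has a sum bounded independently of its centre. *)
Lemma Lnorm_geometric x (r : \bar R) : 0 < x < 1 -> (0 < r)%E ->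
  exists2 A : R, 0 <= A & forall k (M : R) (v : nat -> \bar R), 0 <= M ->
    (forall j, 0 <= v j <= (M * x ^+ dist j k)%:E)%E ->
    (Lnorm (@counting nat R) r v <= (A * M)%:E)%E.
Proof.
move=> x01; have /andP[x0 x1] := x01; case: r => [r||]// r0.
  have r1 : 0 < r by rewrite -lte_fin.
  have y01 : 0 < x `^ r < 1.
    rewrite powR_gt0//= -(powRr0 x); have := gt0_ltr_powR r1 (_ : x \in Num.nneg) (_ : 1 \in Num.nneg) x1.
    by rewrite !nnegrE powRr0 powR1; apply => //; exact: ltW.
  have /andP[y0 y1] := y01; have B0 : 0 < 2 / (1 - x `^ r) by rewrite divr_gt0// subr_gt0.
  exists ((2 / (1 - x `^ r)) `^ r^-1) => [|k M v M0 hv]; first exact: powR_ge0.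
  rewrite Lnorm_counting//.
  apply: (@le_trans _ _ (((M `^ r)%:E * (2 / (1 - x `^ r))%:E) `^ r^-1)%E); last first.
    rewrite -EFinM poweR_EFin powRM ?powR_ge0 ?(ltW B0)// -powRrM mulfV ?lt0r_neq0// powRr1//.
    by rewrite mulrC.
  apply: lee_poweR; first by rewrite invr_gt0.
    by apply: nneseries_ge0 => n _ _; exact: poweR_ge0.
  apply: le_trans (lee_wpmul2l _ (nneseries_expr_dist_le k y01)); last by rewrite lee_fin powR_ge0.
  rewrite -nneseriesZl; last by move=> j _; rewrite lee_fin exprn_ge0// ltW.
  apply: lee_nneseries => [j _ _|j _]; first exact: poweR_ge0.
  have /andP[v0 h] := hv j.
  have -> : x `^ r ^+ dist j k = (x ^+ dist j k) `^ r.
    by rewrite -(powR_mulrn _ (powR_ge0 x r)) -(powR_mulrn _ (ltW x0)) powRAC.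
  rewrite gee0_abs// -EFinM -powRM ?exprn_ge0 ?(ltW x0)// -poweR_EFin.
  exact: lee_poweR.
exists 1 => // k M v M0 hv; rewrite mul1r; apply: Lnorm_counting_oo_le => j.
have /andP[-> h]/= := hv j; apply: (le_trans h).
by rewrite lee_fin ler_piMr// exprn_ile1 ?(ltW x0) ?(ltW x1).
Qed.

End geometric_sums.

(** * Step functions over a geometric progression *)

Section step_functions.
Variable R : realType.
Local Notation leb := (@lebesgue_measure R).
Implicit Types (T : R) (c X : nat -> R).

(** The integral of a nonnegative function is the supremum of the integrals of the
    simple functions below it. In this form it compares the integrals of the
    functional [K] and of a step function. *)
Lemma nonneg_le_integral (D : set R) (f g : R -> \bar R) :
  (forall x, D x -> 0 <= f x)%E -> (forall x, D x -> f x <= g x)%E ->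
  (\int[leb]_(x in D) f x <= \int[leb]_(x in D) g x)%E.
Proof.
move=> f0 fg; have g0 x : D x -> (0 <= g x)%E by move=> Dx; rewrite (le_trans (f0 x Dx))// fg.
rewrite !ge0_integralE//; apply: le_ereal_sup => _ [h /= hf <-]; exists h => // x.
apply: (le_trans (hf x)); rewrite /patch; case: ifPn => // xD; apply: fg.
by rewrite inE in xD.
Qed.

(** The value [X k / c k] on the interval of ends [c k] and [T * c k], summed over
    [k]: for the measure [dt / t] this interval has a mass independent of [c k]. *)
Definition step T c X (t : R) : \bar R :=
  (\sum_(k <oo) ((X k / c k) * \1_(`[c k, T * c k[) t)%:E)%E.

Section step.
Variables (T : R) (c X : nat -> R).
Hypothesis T1 : 1 < T.
Hypothesis c0 : forall k, 0 < c k.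
Hypothesis X0 : forall k, 0 <= X k.

Let term_ge0 k (t : R) : (0 <= ((X k / c k) * \1_(`[c k, T * c k[) t)%:E)%E.
Proof. by rewrite lee_fin mulr_ge0// divr_ge0// ltW. Qed.

Let term_measurable k : measurable_fun setT (fun t : R => ((X k / c k) * \1_(`[c k, T * c k[) t)%:E).
Proof. by apply/measurable_EFinP; apply: measurable_funM => //; apply: measurable_indic. Qed.

Lemma step_ge0 t : (0 <= step T c X t)%E.
Proof. by apply: nneseries_ge0 => k _ _; exact: term_ge0. Qed.

Lemma measurable_step : measurable_fun setT (step T c X).
Proof.
apply: ge0_emeasurable_sum => [k t _ _|k _]; [exact: term_ge0|exact: term_measurable].
Qed.

Lemma step_ge k t : c k <= t < T * c k -> ((X k / c k)%:E <= step T c X t)%E.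
Proof.
move=> ht; apply: le_trans (nneseries_ge_term k (fun k => term_ge0 k t)).
by rewrite indicE mem_set ?mulr1//= in_itv.
Qed.

Lemma step_le (Y : \bar R) t : (0 <= Y)%E ->
  (forall k l, c k <= t < T * c k -> c l <= t < T * c l -> k = l) ->
  (forall k, c k <= t < T * c k -> ((X k / c k)%:E <= Y)%E) -> (step T c X t <= Y)%E.
Proof.
move=> Y0 disj hY; apply: nneseries_le_ub => [k|n]; first exact: term_ge0.
have [[k [kn hk]]|no] := pselect (exists k, (k < n)%N /\ c k <= t < T * c k).
  rewrite big_mkord (bigD1 (Ordinal kn))//= big1 ?adde0 => [|i /eqP ik].
    by rewrite indicE mem_set ?mulr1 ?hY//= in_itv.
  rewrite indicE memNset ?mulr0//= in_itv/= => hi.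
  by apply: ik; apply: val_inj => /=; exact: disj.
rewrite big_mkord big1// => i _; rewrite indicE memNset ?mulr0//= in_itv/= => hi.
by apply: no; exists i.
Qed.

Lemma integral_step : (\int[leb]_(t in `]0%R, +oo[) step T c X t =
  \sum_(k <oo) ((T - 1) * X k)%:E)%E.
Proof.
have mD : measurable (`]0, +oo[%classic : set R) by exact: measurable_itv.
have mt k : measurable_fun (`]0, +oo[%classic : set R) (fun t : R => ((X k / c k) * \1_(`[c k, T * c k[) t)%:E).
  by apply: (measurable_funS measurableT) => //; exact: term_measurable.
rewrite /step (integral_nneseries leb mD mt (fun k t _ => term_ge0 k t)).
apply: eq_eseriesr => k _.
under eq_integral do rewrite EFinM.
rewrite ge0_integralZl//; last 2 first.
- by apply/measurable_EFinP; apply: (measurable_funS measurableT) => //; apply: measurable_indic; exact: measurable_itv.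
- by rewrite lee_fin divr_ge0// ltW.
rewrite integral_indic// setIidl; last first.
  by move=> t /=; rewrite !in_itv/= andbT => /andP[h _]; exact: lt_le_trans h.
have mI : (leb `[c k, (T * c k)%R[ = (T * c k - c k)%:E)%E.
  by rewrite lebesgue_measure_itv/= lte_fin -[X in (X < _)%R]mul1r ltr_pM2r// T1 -EFinB.
transitivity ((X k / c k)%:E * (T * c k - c k)%:E)%E; first by congr (_ * _)%E; exact: mI.
rewrite -EFinM; congr _%:E; have ck : c k != 0 by rewrite gt_eqF.
by field.
Qed.

End step.

Lemma exprV_lt T t : 1 < T -> 0 < t -> exists n, T ^- n < t.
Proof.
move=> T1 t0; have T0 : 0 < T by exact: lt_trans T1.
have TV : `|T^-1| < 1 by rewrite ger0_norm ?invr_ge0 ?(ltW T0)// invf_lt1.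
have /cvgr0Pnorm_lt/(_ t t0)[N _ hN] := cvg_expr TV; exists N.
by have := hN N (leqnn N); rewrite /= ger0_norm ?exprn_ge0 ?invr_ge0 ?(ltW T0)// exprVn.
Qed.

Lemma floor_expr T t : 1 < T -> 1 <= t -> exists k, T ^+ k <= t < T * T ^+ k.
Proof.
move=> T1 t1; have t0 : 0 < t by exact: lt_le_trans t1.
have T0 n : 0 < T ^+ n by rewrite exprn_gt0// (lt_trans _ T1).
have [n] : exists n, t < T ^+ n.
  have [|n hn] := @exprV_lt T t^-1 T1; first by rewrite invr_gt0.
  by exists n; rewrite -ltf_pV2 ?posrE.
elim: n => [|n ih] h; first by move: h; rewrite expr0 ltNge t1.
by have [le|/ih//] := leP (T ^+ n) t; exists n; rewrite le -exprS.
Qed.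

Lemma floor_exprV T t : 1 < T -> 0 < t < 1 -> exists k, T ^- k.+1 <= t < T * T ^- k.+1.
Proof.
move=> T1 /andP[t0 t1]; have T0 : 0 < T by exact: lt_trans T1.
have [n /ltW] := exprV_lt T1 t0.
elim: n => [|n ih] h; first by move: h; rewrite expr0 invr1 leNgt t1.
have [/ih//|lt] := leP (T ^- n) t; exists n; rewrite h/= exprS invfM mulrA mulfV ?mul1r//.
by rewrite gt_eqF.
Qed.

End step_functions.

Section discrete_hardy.
Variable R : realType.
Implicit Types (x r : R) (v M : nat -> R).

Lemma nneseries_shift_le (Q : nat -> \bar R) y : 0 < y < 1 -> (forall k, 0 <= Q k)%E ->
  Q 0%N \is a fin_num ->
  (\sum_(k <oo) (Q k + Q k.+1 + (y ^+ k)%:E * Q 0%N) <=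
   (2 + 2 / (1 - y))%:E * \sum_(k <oo) Q k)%E.
Proof.
move=> y01 Q0 Qfin; have /andP[y0 y1] := y01.
have D0 : 0 <= 2 / (1 - y) by rewrite divr_ge0// subr_ge0 ltW.
have yk k : (0 <= (y ^+ k)%:E)%E by rewrite lee_fin exprn_ge0// ltW.
rewrite (nneseriesD (fun k _ _ => adde_ge0 (Q0 k) (Q0 k.+1))
  (fun k _ _ => mule_ge0 (yk k) (Q0 0%N))) (nneseriesD (fun k _ _ => Q0 k) (fun k _ _ => Q0 k.+1)).
have SQ0 : (0 <= \sum_(k <oo) Q k)%E by apply: nneseries_ge0 => k _ _; exact: Q0.
rewrite EFinD ge0_muleDl ?lee_fin//; apply: leeD.
  rewrite mule_natl mule2n; apply: leeD; first exact: lexx.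
  apply: nneseries_le_ub => // n.
  apply: le_trans (nneseries_lim_ge n.+1 (fun k _ _ => Q0 k)).
  by rewrite [leRHS]big_nat_recl//= leeDr.
have -> : (\sum_(k <oo) ((y ^+ k)%:E * Q 0%N) = Q 0%N * \sum_(k <oo) (y ^+ k)%:E)%E.
  rewrite -(fineK Qfin) -nneseriesZl; last by move=> k _; exact: yk.
  by apply: eq_eseriesr => k _; rewrite muleC.
rewrite muleC; apply: lee_pmul.
- by apply: nneseries_ge0 => k _ _; exact: yk.
- exact: Q0.
- have := nneseries_expr_dist_le 0 y01; rewrite (@eq_eseriesr _ _ (fun k => (y ^+ k)%:E))//.
  by move=> k _; rewrite /dist subn0 sub0n addn0.
- exact: nneseries_ge_term.
Qed.

Lemma powRD3_le (a b c r : R) : 0 <= a -> 0 <= b -> 0 <= c -> 0 < r ->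
  (a + b + c) `^ r <= 4 `^ r * (a `^ r + b `^ r + c `^ r).
Proof.
move=> a0 b0 c0 r0; apply: le_trans (powRD_le (addr_ge0 a0 b0) c0 r0) _.
have -> : 4 = 2 * 2 :> R by rewrite -natrM.
rewrite powRM// -mulrA ler_wpM2l ?powR_ge0// mulrDr; apply: lerD; first exact: powRD_le.
rewrite ler_peMl ?powR_ge0// -[X in X <= _](powRr0 2).
by apply: ler_powR; [rewrite ler1n|exact: ltW].
Qed.

(** [M k] is the [l_r] norm in [j] of [v j * x ^+ dist j k]. The sum over [k] of its
    [r]-th powers is exchanged with the sum over [j]. The terms [M k.+1] and
    [x ^+ k * M 0] are those that bound the functional [K] between two points of
    the geometric progression and on the other half-line. *)
Lemma geometric_majorant x r : 0 < x < 1 -> 0 < r ->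
  exists2 D : R, 0 < D & forall v, (forall j, 0 <= v j) ->
  (\sum_(j <oo) (v j `^ r)%:E < +oo)%E -> exists M : nat -> R,
  [/\ forall k, 0 <= M k, forall k j, v j * x ^+ dist j k <= M k &
    (\sum_(k <oo) ((M k + M k.+1 + x ^+ k * M 0%N) `^ r)%:E <=
     D%:E * \sum_(j <oo) (v j `^ r)%:E)%E].
Proof.
move=> x01 r0; have /andP[x0 x1] := x01.
have y01 : 0 < x `^ r < 1.
  rewrite powR_gt0//= -(powRr0 x); have := gt0_ltr_powR r0 (_ : x \in Num.nneg) (_ : 1 \in Num.nneg) x1.
  by rewrite !nnegrE powRr0 powR1; apply => //; exact: ltW.
have /andP[y0 y1] := y01; pose y := x `^ r; pose D := 2 / (1 - y).
have D0 : 0 < D by rewrite divr_gt0// subr_gt0.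
have yE n : (x ^+ n) `^ r = y ^+ n.
  by rewrite -(powR_mulrn _ (ltW y0)) -(powR_mulrn _ (ltW x0)) powRAC.
exists (4 `^ r * (2 + D) * D) => [|v v0 vfin].
  apply: mulr_gt0 => //; apply: mulr_gt0; [by rewrite powR_gt0|exact: addr_gt0].
pose g k j : \bar R := ((v j * x ^+ dist j k) `^ r)%:E.
have g0 k j : (0 <= g k j)%E by rewrite lee_fin powR_ge0.
have gE k j : g k j = ((v j `^ r)%:E * (y ^+ dist j k)%:E)%E.
  by rewrite /g powRM ?exprn_ge0 ?(ltW x0)// yE.
pose Q k : \bar R := (\sum_(j <oo) g k j)%E.
have Q0 k : (0 <= Q k)%E by apply: nneseries_ge0.
have Qfin k : Q k \is a fin_num.
  rewrite ge0_fin_numE//; apply: le_lt_trans vfin; apply: lee_nneseries => // j _.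
  by rewrite gE -EFinM lee_fin ler_piMr ?powR_ge0// exprn_ile1 ?(ltW y0) ?(ltW y1).
pose M k := (fine (Q k)) `^ r^-1.
have M0 k : 0 <= M k by exact: powR_ge0.
have Mr k : (M k `^ r)%:E = Q k.
  by rewrite /M -powRrM mulVf ?gt_eqF// powRr1 ?fineK// fine_ge0.
exists M; split; [exact: M0|move=> k j|].
  rewrite -[leLHS]powRr1 ?mulr_ge0 ?exprn_ge0 ?(ltW x0)// -(mulfV (lt0r_neq0 r0)) powRrM.
  apply: ge0_ler_powR; rewrite ?invr_ge0 ?(ltW r0) ?nnegrE ?powR_ge0 ?fine_ge0//.
  by rewrite -lee_fin fineK//; exact: (nneseries_ge_term j (g0 k)).
set s := (\sum_(j <oo) (v j `^ r)%:E)%E.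
have s0 : (0 <= s)%E by apply: nneseries_ge0 => j _ _; rewrite lee_fin powR_ge0.
have SQ : (\sum_(k <oo) Q k <= D%:E * s)%E.
  rewrite /Q nneseries_interchange//.
  rewrite -nneseriesZl; last by move=> j _; rewrite lee_fin powR_ge0.
  apply: lee_nneseries => [j _ _|j _]; first exact: nneseries_ge0.
  under eq_eseriesr do rewrite gE.
  rewrite nneseriesZl; last by move=> k _; rewrite lee_fin exprn_ge0// ltW.
  rewrite muleC; apply: lee_wpmul2r; first by rewrite lee_fin powR_ge0.
  under eq_eseriesr do rewrite distC; exact: nneseries_expr_dist_le.
have Nle k : (((M k + M k.+1 + x ^+ k * M 0%N) `^ r)%:E <=
    (4 `^ r)%:E * (Q k + Q k.+1 + (y ^+ k)%:E * Q 0%N))%E.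
  have := Mr 0%N; have := Mr k.+1; have := Mr k.
  move: (Q k) (Q k.+1) (Q 0%N) => q0 q1 q2 <- <- <-.
  rewrite -[leRHS]/((4 `^ r * (M k `^ r + M k.+1 `^ r + y ^+ k * M 0%N `^ r))%:E).
  rewrite lee_fin -yE -powRM ?exprn_ge0 ?(ltW x0)//.
  by apply: powRD3_le; rewrite ?M0// mulr_ge0 ?M0// exprn_ge0// ltW.
apply: (@le_trans _ _ (\sum_(k <oo) ((4 `^ r)%:E * (Q k + Q k.+1 + (y ^+ k)%:E * Q 0%N)))%E).
  by apply: lee_nneseries => [k _ _|k _]; [rewrite lee_fin powR_ge0|exact: Nle].
have yQ0 k : (0 <= (y ^+ k)%:E * Q 0%N)%E by rewrite mule_ge0// lee_fin exprn_ge0// ltW.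
rewrite nneseriesZl; last by move=> k _; rewrite !adde_ge0.
rewrite 2!EFinM -!muleA; apply: lee_wpmul2l; first by rewrite lee_fin powR_ge0.
apply: (@le_trans _ _ ((2 + D)%:E * \sum_(k <oo) Q k)%E); last first.
  by apply: lee_wpmul2l => //; rewrite lee_fin addr_ge0// ltW.
exact: nneseries_shift_le.
Qed.

End discrete_hardy.

(** * Interpolation from a quasi-triangle inequality and a splitting *)

Section interpolation_of_blocks.
Variables (R : realType) (V : zmodType) (P : V -> Prop) (a : V -> nat -> \bar R) (K A : R).
Hypothesis K1 : 1 <= K.
Hypothesis A1 : 1 <= A.
Hypothesis a_ge0 : forall f j, (0 <= a f j)%E.
Hypothesis a0 : forall j, a 0 j = 0%E.
Hypothesis P0 : P 0.
Hypothesis PD : forall f g, P f -> P g -> P (f + g).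
Hypothesis aD : forall f g j, (a (f + g)%R j <= K%:E * (a f j + a g j))%E.
Hypothesis splitting : forall f, P f -> (forall j, a f j < +oo)%E ->
  forall J, exists f0 f1, [/\ P f0, P f1, f = f0 + f1 & forall j,
    [/\ (a f0 j <= A%:E * a f j)%E, (a f1 j <= A%:E * a f j)%E,
      ((J.+1 < j)%N -> a f0 j = 0%E) & ((j < J)%N -> a f1 j = 0%E)]].
Variables (b0 b1 b theta : R) (r r0 r1 : \bar R).
Hypothesis hr : (0 < r)%E.
Hypothesis hr0 : (0 < r0)%E.
Hypothesis hr1 : (0 < r1)%E.
Hypothesis theta0 : 0 < theta.
Hypothesis theta1 : theta < 1.
Hypothesis b01 : b0 != b1.
Hypothesis hb : b = (1 - theta) * b0 + theta * b1.

Let w (c : R) (j : nat) : R := 2 `^ (j%:R * c).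
Let nrm (c : R) (rho : \bar R) f := Lnorm counting rho (fun j => ((w c j)%:E * a f j)%E).
Let X c rho : qspace R V := QSpace [set f | P f /\ (nrm c rho f < +oo)%E] (nrm c rho).
Let Kf t f := K_functional (X b0 r0) (X b1 r1) t f.
Let u f j : \bar R := ((w b j)%:E * a f j)%E.
Let beta := b0 - b1.
Let delta := `|beta|.
Let T : R := 2 `^ delta.
(* The point at which the [j]-th terms of the two norms have the same weight. *)
Let pt (j : nat) : R := 2 `^ (j%:R * beta).
(* Half the smaller of the geometric rates of decrease on the two sides of the peak,
   so that as much remains to sum the series. *)
Let eta := Num.min theta (1 - theta) * delta / 2.
Let mu : R := 2 `^ (- eta).

Let pow2_gt0 (x : R) : 0 < 2 `^ x :> R. Proof. by rewrite powR_gt0. Qed.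

Let pow2D (x y : R) : 2 `^ (x + y) = 2 `^ x * 2 `^ y :> R.
Proof. by rewrite powRD// implybE orbC; apply/orP; left; rewrite pnatr_eq0. Qed.

Let le_pow2 (x y : R) : (2 `^ x <= 2 `^ y :> R) = (x <= y).
Proof.
apply/idP/idP => [|xy]; last by apply: ler_powR => //; rewrite ler1n.
apply: contraTT; rewrite -!ltNge => yx.
have : 2 `^ y <= 2 `^ x :> R by apply: ler_powR; rewrite ?ler1n// ltW.
rewrite lt_neqAle => ->; rewrite andbT; apply/eqP => e.
have : ln (2 `^ y) = ln (2 `^ x) :> R by rewrite e.
rewrite !ln_powR => /(mulIf _) h; have := h _; rewrite gt_eqF ?ln_gt0 ?ltr1n// => /(_ isT) yx'.
by rewrite yx' ltxx in yx.
Qed.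

Let delta0 : 0 < delta. Proof. by rewrite normr_gt0 subr_eq0. Qed.

Let T1 : 1 < T.
Proof. by rewrite ltNge -[X in _ <= X](powRr0 2) le_pow2 -ltNge. Qed.

Let T0 : 0 < T. Proof. exact: pow2_gt0. Qed.

Let eta_theta : 2 * eta <= theta * delta.
Proof. by rewrite /eta mulrCA mulfV// mulr1 ler_wpM2r ?(ltW delta0)// ge_min lexx. Qed.

Let eta_theta' : 2 * eta <= (1 - theta) * delta.
Proof. by rewrite /eta mulrCA mulfV// mulr1 ler_wpM2r ?(ltW delta0)// ge_min lexx orbT. Qed.

Let eta0 : 0 < eta.
Proof. by rewrite /eta divr_gt0// mulr_gt0// lt_min theta0 subr_gt0. Qed.

Let mu01 : 0 < mu < 1.
Proof.
by rewrite pow2_gt0/= ltNge -[X in X <= _](powRr0 2) le_pow2 oppr_ge0 -ltNge.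
Qed.

Let mu_expr n : mu ^+ n = 2 `^ (- (n%:R * eta)).
Proof. by rewrite -powR_mulrn ?(ltW (pow2_gt0 _))// /mu -powRrM mulNr mulrC. Qed.

Let pt_gt0 j : 0 < pt j. Proof. exact: pow2_gt0. Qed.

Let nrm_ge0 c rho f : (0 <= nrm c rho f)%E. Proof. exact: Lnorm_ge0. Qed.

Let nrm0 c rho : (0 < rho)%E -> nrm c rho 0 = 0%E.
Proof.
move=> rho0; rewrite /nrm (_ : (fun j => _) = cst 0%E) ?Lnorm0 ?gt_eqF//.
by apply/funext => j; rewrite a0 mule0.
Qed.

Let nrm_term c rho f j : (0 < rho)%E -> ((w c j)%:E * a f j <= nrm c rho f)%E.
Proof.
move=> rho0; apply: (@le_Lnorm_counting_term _ (fun j => (w c j)%:E * a f j)%E) => // k.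
by rewrite mule_ge0// lee_fin ltW ?pow2_gt0.
Qed.

Let Kf_ge0 t f : 0 <= t -> (0 <= Kf t f)%E.
Proof.
move=> t0; apply: le_ereal_inf_tmp => _ [f0 [f1 [_ _ _ ->]]].
by rewrite adde_ge0 ?mule_ge0 ?nrm_ge0.
Qed.

Let le_Kf t t' f : t <= t' -> (Kf t f <= Kf t' f)%E.
Proof.
move=> tt'; apply: le_ereal_inf_tmp => _ [f0 [f1 [c0 c1 -> ->]]].
apply: (@le_trans _ _ (nrm b0 r0 f0 + t%:E * nrm b1 r1 f1)%E).
  by apply: ereal_inf_lbound; exists f0, f1.
by apply: leeD => //; apply: lee_wpmul2r; rewrite ?nrm_ge0// lee_fin.
Qed.

Let w_b0 j : w b j = (pt j) `^ (- theta) * w b0 j.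
Proof. by rewrite /w /pt -powRrM -pow2D; congr (_ `^ _); rewrite hb /beta; ring. Qed.

Let w_b1 j : w b j = (pt j) `^ (- theta) * (pt j * w b1 j).
Proof. by rewrite /w /pt -powRrM -!pow2D; congr (_ `^ _); rewrite hb /beta; ring. Qed.

(** By the quasi-triangle inequality, for every decomposition of [f]. *)
Let Kf_lower f j : (u f j <= (K * (pt j) `^ (- theta))%:E * Kf (pt j) f)%E.
Proof.
have K0 : 0 < K by exact: lt_le_trans K1.
have p0 : 0 < (pt j) `^ (- theta) by rewrite powR_gt0.
rewrite -lee_pdivrMl ?mulr_gt0//; apply: le_ereal_inf_tmp => _ [f0 [f1 [_ _ -> ->]]].
rewrite lee_pdivrMl ?mulr_gt0// /u.
apply: (@le_trans _ _ ((w b j)%:E * (K%:E * (a f0 j + a f1 j)))%E).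
  by apply: lee_wpmul2l; rewrite ?aD// lee_fin ltW ?pow2_gt0.
rewrite muleCA EFinM -muleA; apply: lee_wpmul2l; first by rewrite lee_fin ltW.
rewrite ge0_muleDr// ge0_muleDr ?mule_ge0 ?nrm_ge0 ?lee_fin ?(ltW (pt_gt0 j))//; apply: leeD.
  rewrite w_b0 EFinM -muleA; apply: lee_wpmul2l; first by rewrite lee_fin ltW.
  exact: nrm_term.
rewrite w_b1 2!EFinM -!muleA; apply: lee_wpmul2l; first by rewrite lee_fin ltW.
by apply: lee_wpmul2l; rewrite ?lee_fin ?(ltW (pt_gt0 j))//; exact: nrm_term.
Qed.

(** The [j]-th term of the norm of [f'] is compared to [u f j], hence to [M]. When the
    exponents leave a factor [mu ^+ dist j J] to spare, [Lnorm_geometric] sums the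
    terms. The real [kappa] is the logarithm of the height of the peak at [j = J]. *)
Let norm_peak c rho : (0 < rho)%E -> exists2 B : R, 0 <= B & forall f f' J M kappa,
  0 <= M -> (forall j, (u f j <= (M / mu ^+ dist j J)%:E)%E) ->
  (forall j, (a f' j <= A%:E * a f j)%E) ->
  (forall j, a f' j = 0%E \/ j%:R * (c - b) <= 2 * delta + kappa - 2 * eta * (dist j J)%:R) ->
  (nrm c rho f' <= (B * 2 `^ kappa * M)%:E)%E.
Proof.
move=> rho0; have [B B0 hB] := Lnorm_geometric mu01 rho0.
have A0 : 0 <= A by exact: le_trans A1.
exists (B * (A * 2 `^ (2 * delta))) => [|f f' J M kappa M0 hu hA hk].
  by rewrite !mulr_ge0// ltW.
have -> : B * (A * 2 `^ (2 * delta)) * 2 `^ kappa * M = B * (A * 2 `^ (2 * delta) * 2 `^ kappa * M) by ring.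
have N0 : 0 <= A * 2 `^ (2 * delta) * 2 `^ kappa * M by rewrite !mulr_ge0 ?(ltW (pow2_gt0 _)).
apply: (hB J) => // j; rewrite mule_ge0 ?lee_fin ?(ltW (pow2_gt0 _))//=.
case: (hk j) => [->|hj]; first by rewrite mule0 lee_fin mulr_ge0// exprn_ge0// ltW; case/andP: mu01.
apply: (@le_trans _ _ ((w (c - b) j * A)%:E * u f j)%E).
  rewrite /u muleA -EFinM mulrAC -pow2D -mulrDr subrK EFinM -muleA.
  by apply: lee_wpmul2l; rewrite ?lee_fin ?(ltW (pow2_gt0 _)).
apply: (@le_trans _ _ ((w (c - b) j * A)%:E * (M / mu ^+ dist j J)%:E)%E).
  by apply: lee_wpmul2l; rewrite ?lee_fin ?mulr_ge0 ?(ltW (pow2_gt0 _)).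
rewrite -EFinM lee_fin.
have m0 : 0 < mu ^+ dist j J by rewrite exprn_gt0//; case/andP: mu01.
rewrite mulrA ler_pdivrMr//.
rewrite [leLHS](_ : _ = A * M * w (c - b) j); last by ring.
rewrite [leRHS](_ : _ = A * M * (2 `^ (2 * delta) * 2 `^ kappa * (mu ^+ dist j J * mu ^+ dist j J))); last by ring.
rewrite ler_wpM2l ?mulr_ge0// mu_expr -!pow2D le_pow2; apply: (le_trans hj).
by rewrite le_eqVlt; apply/orP; left; apply/eqP; ring.
Qed.

(** The low part has one block too many, [J.+1]; the summand [2 * delta] pays for it. *)
Let peak_low sigma j J : 0 < sigma < 1 -> 2 * eta <= sigma * delta -> (j <= J.+1)%N ->
  j%:R * (sigma * delta) <= 2 * delta + J%:R * (sigma * delta) - 2 * eta * (dist j J)%:R.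
Proof.
move=> /andP[s0 s1] h; rewrite leq_eqVlt => /orP[/eqP ->|].
  rewrite /dist subSnn (_ : (J - J.+1)%N = 0%N) ?addn0 ?mulr1; last by apply/eqP; rewrite subn_eq0.
  have sd : sigma * delta <= delta by rewrite ler_piMl// ltW.
  rewrite -natr1 mulrDl mul1r; lra.
rewrite ltnS => jJ; have -> : dist j J = (J - j)%N by rewrite /dist (eqP (_ : j - J == 0)%N) ?subn_eq0.
rewrite natrB//; have d0 : 0 <= J%:R - j%:R :> R by rewrite subr_ge0 ler_nat.
rewrite -subr_ge0 [X in 0 <= X](_ : _ = 2 * delta + (J%:R - j%:R) * (sigma * delta - 2 * eta)); last by ring.
apply: addr_ge0; first by rewrite mulr_ge0// ltW.
by apply: mulr_ge0 => //; rewrite subr_ge0.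
Qed.

Let peak_high sigma j J : 2 * eta <= sigma * delta -> (J <= j)%N ->
  - (j%:R * (sigma * delta)) <= 2 * delta - J%:R * (sigma * delta) - 2 * eta * (dist j J)%:R.
Proof.
move=> h jJ; have -> : dist j J = (j - J)%N by rewrite /dist (eqP (_ : J - j == 0)%N) ?subn_eq0 ?addn0.
rewrite natrB//; have d0 : 0 <= j%:R - J%:R :> R by rewrite subr_ge0 ler_nat.
rewrite -subr_ge0 [X in 0 <= X](_ : _ = 2 * delta + (j%:R - J%:R) * (sigma * delta - 2 * eta)); last by ring.
apply: addr_ge0; first by rewrite mulr_ge0// ltW.
by apply: mulr_ge0 => //; rewrite subr_ge0.
Qed.

Let K_le t f g0 g1 x y : 0 <= t -> P g0 -> P g1 -> f = g0 + g1 ->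
  (nrm b0 r0 g0 <= x%:E)%E -> (nrm b1 r1 g1 <= y%:E)%E -> (Kf t f <= (x + t * y)%:E)%E.
Proof.
move=> t0 Pg0 Pg1 fE h0 h1.
apply: (@le_trans _ _ (nrm b0 r0 g0 + t%:E * nrm b1 r1 g1)%E).
  apply: ereal_inf_lbound; exists g0, g1; split=> //; split=> //.
    by apply: le_lt_trans h0 _; exact: ltry.
  by apply: le_lt_trans h1 _; exact: ltry.
by rewrite EFinD EFinM; apply: leeD => //; apply: lee_wpmul2l.
Qed.

Let u_fin f j (x : R) : (u f j <= x%:E)%E -> (a f j < +oo)%E.
Proof.
move=> h; have [e|] := eqVneq (a f j) +oo%E; last by rewrite -ltey.
by move: h; rewrite /u e gt0_muley ?lte_fin ?pow2_gt0// leye_eq.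
Qed.

(** The splitting at the block [J]. The space with the larger exponent receives the
    low part. *)
Let K_split : exists2 B : R, 0 <= B & forall f M J, P f -> 0 <= M ->
  (forall j, (u f j <= (M / mu ^+ dist j J)%:E)%E) ->
  (Kf (pt J) f <= (B * pt J `^ theta * M)%:E)%E.
Proof.
have [B B0 hB] := norm_peak b0 hr0; have [B' B'0 hB'] := norm_peak b1 hr1.
have th' : 0 < 1 - theta < 1 by rewrite subr_gt0 theta1 gtrBl theta0.
exists (B + B') => [|f M J Pf M0 hu]; first exact: addr_ge0.
have [g0 [g1 [Pg0 Pg1 fE hg]]] := splitting Pf (fun j => u_fin (hu j)) J.
have E0 : pt J `^ theta = 2 `^ (J%:R * (theta * beta)).
  by rewrite /pt -powRrM; congr (_ `^ _); ring.
have E1 : pt J * 2 `^ (J%:R * ((theta - 1) * beta)) = pt J `^ theta.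
  by rewrite E0 /pt -pow2D; congr (_ `^ _); ring.
have -> : (B + B') * pt J `^ theta * M =
    B * 2 `^ (J%:R * (theta * beta)) * M + pt J * (B' * 2 `^ (J%:R * ((theta - 1) * beta)) * M).
  by rewrite -E0 -E1; ring.
have [beta0|beta0|/eqP] := ltgtP beta 0; last by rewrite subr_eq0 (negbTE b01).
- have dE : beta = - delta by rewrite /delta ltr0_norm// opprK.
  apply: (K_le (ltW (pt_gt0 J)) Pg1 Pg0); first by rewrite addrC.
    apply: (hB f _ J _ _ M0 hu) => [j|j]; first by have [] := hg j.
    have [_ _ _ z] := hg j; have [/z|jJ] := ltnP j J; [by left|right].
    rewrite (_ : b0 - b = theta * beta); last by rewrite hb /beta; ring.
    by rewrite dE !mulrN; exact: peak_high.
  apply: (hB' f _ J _ _ M0 hu) => [j|j]; first by have [] := hg j.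
  have [_ _ z _] := hg j; have [/z|jJ] := ltnP J.+1 j; [by left|right].
  rewrite (_ : b1 - b = (1 - theta) * - beta); last by rewrite hb /beta; ring.
  rewrite (_ : (theta - 1) * beta = (1 - theta) * - beta); last by ring.
  by rewrite dE opprK; exact: peak_low.
- have dE : beta = delta by rewrite /delta gtr0_norm.
  apply: (K_le (ltW (pt_gt0 J)) Pg0 Pg1) => //.
    apply: (hB f _ J _ _ M0 hu) => [j|j]; first by have [] := hg j.
    have [_ _ z _] := hg j; have [/z|jJ] := ltnP J.+1 j; [by left|right].
    rewrite (_ : b0 - b = theta * beta); last by rewrite hb /beta; ring.
    by rewrite dE; apply: peak_low => //; rewrite theta0.
  apply: (hB' f _ J _ _ M0 hu) => [j|j]; first by have [] := hg j.
  have [_ _ _ z] := hg j; have [/z|jJ] := ltnP j J; [by left|right].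
  rewrite (_ : b1 - b = - ((1 - theta) * beta)); last by rewrite hb /beta; ring.
  rewrite (_ : (theta - 1) * beta = - ((1 - theta) * beta)); last by ring.
  by rewrite dE !mulrN; exact: peak_high.
Qed.

(** The trivial decompositions [f = f + 0] and [f = 0 + f]. *)
Let K_far : exists2 B : R, 0 <= B & forall f M t, P f -> 0 <= M -> 0 <= t ->
  (forall j, (u f j <= (M / mu ^+ dist j 0)%:E)%E) ->
  (Kf t f <= ((if 0 < beta then t else 1) * (B * M))%:E)%E.
Proof.
have [B B0 hB] := norm_peak b0 hr0; have [B' B'0 hB'] := norm_peak b1 hr1.
have aA f j : (a f j <= A%:E * a f j)%E.
  by rewrite -[leLHS]mul1e; apply: lee_wpmul2r => //; rewrite lee_fin.
exists (B + B') => [|f M t Pf M0 t0 hu]; first exact: addr_ge0.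
have BM : 0 <= B * M by rewrite mulr_ge0.
have B'M : 0 <= B' * M by rewrite mulr_ge0.
case: ifPn => beta0.
  have dE : beta = delta by rewrite /delta gtr0_norm.
  have n1 : (nrm b1 r1 f <= (B' * M)%:E)%E.
    rewrite -[B']mulr1 -[X in B' * X](powRr0 2); apply: (hB' f f 0%N M 0 M0 hu (aA f)) => j; right.
    rewrite (_ : b1 - b = - ((1 - theta) * beta)); last by rewrite hb /beta; ring.
    by rewrite dE mulrN; have := @peak_high (1 - theta) j 0 eta_theta' isT; rewrite mul0r oppr0 addr0.
  have n0 : (nrm b0 r0 0 <= 0%:E)%E by rewrite nrm0.
  have fE : f = 0 + f by rewrite add0r.
  apply: le_trans (K_le t0 P0 Pf fE n0 n1) _; rewrite add0r lee_fin ler_wpM2l//.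
  by rewrite mulrDl lerDr.
have bn : beta < 0.
  by rewrite lt_neqAle leNgt beta0 subr_eq0 b01.
have dE : beta = - delta by rewrite /delta ltr0_norm// opprK.
have n0 : (nrm b0 r0 f <= (B * M)%:E)%E.
  rewrite -[B]mulr1 -[X in B * X](powRr0 2); apply: (hB f f 0%N M 0 M0 hu (aA f)) => j; right.
  rewrite (_ : b0 - b = theta * beta); last by rewrite hb /beta; ring.
  by rewrite dE !mulrN; have := @peak_high theta j 0 eta_theta isT; rewrite mul0r oppr0 addr0.
have n1 : (nrm b1 r1 0 <= 0%:E)%E by rewrite nrm0.
have fE : f = f + 0 by rewrite addr0.
apply: le_trans (K_le t0 Pf P0 fE n0 n1) _; rewrite mulr0 addr0 lee_fin mul1r.
by rewrite mulrDl lerDl.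
Qed.

Let T_expr k : T ^+ k = 2 `^ (k%:R * delta).
Proof. by rewrite -powR_mulrn ?(ltW T0)// /T -powRrM mulrC. Qed.

Let T_exprV k : T ^- k = 2 `^ (- (k%:R * delta)).
Proof. by rewrite T_expr powRN. Qed.

Let powR_opp_le (x y sigma : R) : 0 < x -> x <= y -> 0 <= sigma -> y `^ (- sigma) <= x `^ (- sigma).
Proof.
move=> x0 xy s0; rewrite !powRN lef_pV2 ?posrE ?powR_gt0 ?(lt_le_trans x0)//.
by apply: ge0_ler_powR; rewrite ?nnegrE ?(ltW x0)// (le_trans (ltW x0)).
Qed.

Let inv_powR (x sigma : R) : 0 < x -> x^-1 `^ (- sigma) = x `^ sigma.
Proof. by move=> x0; rewrite -(powR_inv1 (ltW x0)) -powRrM mulN1r opprK. Qed.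

Let F t f : \bar R := ((t `^ (- theta))%:E * Kf t f)%E.

(** The points [pt J] are in progression of ratio [T] or [T^-1], and [F] varies by at
    most the factor [T `^ theta] between [pt J / T] and [pt J]. *)
Let F_near : exists2 B : R, 0 <= B & forall f M J t, P f -> 0 <= M ->
  (forall j, (u f j <= (M / mu ^+ dist j J)%:E)%E) ->
  pt J / T <= t <= pt J -> (F t f <= (B * M)%:E)%E.
Proof.
have [B B0 hB] := K_split; exists (T `^ theta * B) => [|f M J t Pf M0 hu /andP[t1 t2]].
  by rewrite mulr_ge0// powR_ge0.
have ptT : 0 < pt J / T by rewrite divr_gt0.
have t0 : 0 < t by exact: lt_le_trans t1.
have h1 : t `^ (- theta) <= T `^ theta * pt J `^ (- theta).
  apply: le_trans (powR_opp_le ptT t1 (ltW theta0)) _.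
  rewrite le_eqVlt; apply/orP; left; apply/eqP; rewrite powRM ?invr_ge0 ?(ltW (pt_gt0 J)) ?(ltW T0)//.
  by rewrite mulrC inv_powR.
apply: (@le_trans _ _ ((T `^ theta * pt J `^ (- theta))%:E * (B * pt J `^ theta * M)%:E)%E).
  apply: lee_pmul; rewrite ?lee_fin ?powR_ge0 ?Kf_ge0 ?(ltW t0)//.
  by apply: le_trans (le_Kf f t2) _; exact: hB.
rewrite -EFinM lee_fin.
have e : pt J `^ (- theta) * pt J `^ theta = 1 by rewrite powRN mulVf// gt_eqF// powR_gt0.
move: (T `^ theta) (pt J `^ (- theta)) (pt J `^ theta) e => x y z e.
rewrite [leLHS](_ : _ = x * B * M * (y * z)); last by ring.
by rewrite e mulr1.
Qed.

(** One of the two half-lines separated by 1 is covered by the points [pt J], where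
    [F_near] applies. On the other one [K_far] gives a geometric decrease. *)
Let F_bound : exists2 B : R, 0 <= B & forall f (M : nat -> R), P f -> (forall J, 0 <= M J) ->
  (forall J j, (u f j <= (M J / mu ^+ dist j J)%:E)%E) ->
  forall k t, (T ^+ k <= t < T * T ^+ k) || (T ^- k.+1 <= t < T * T ^- k.+1) ->
  (F t f <= (B * (M k + M k.+1 + mu ^+ k * M 0%N))%:E)%E.
Proof.
have [B B0 hB] := F_near; have [B' B'0 hB'] := K_far.
exists (B + B') => [|f M Pf M0 hu k t ht]; first exact: addr_ge0.
have mu0 : 0 <= mu ^+ k by rewrite exprn_ge0// ltW//; case/andP: mu01.
have near J : J \in [:: k; k.+1] -> (F t f <= (B * M J)%:E)%E ->
    (F t f <= ((B + B') * (M k + M k.+1 + mu ^+ k * M 0%N))%:E)%E.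
  move=> hJ /le_trans; apply; rewrite lee_fin; apply: ler_pM => //; first by rewrite lerDl.
  move: hJ; rewrite !inE => /orP[/eqP ->|/eqP ->].
    by rewrite -addrA lerDl addr_ge0// mulr_ge0.
  by rewrite addrAC lerDr addr_ge0// mulr_ge0.
have far : (F t f <= (mu ^+ k * (B' * M 0%N))%:E)%E ->
    (F t f <= ((B + B') * (M k + M k.+1 + mu ^+ k * M 0%N))%:E)%E.
  move=> /le_trans; apply; rewrite lee_fin mulrCA; apply: ler_pM => //.
  - by rewrite mulr_ge0.
  - by rewrite lerDr.
  - by rewrite lerDr addr_ge0.
have TS : T * T ^- k.+1 = T ^- k by rewrite exprS invfM mulrA mulfV ?mul1r// gt_eqF.
have Tk0 : 0 < T ^+ k by rewrite exprn_gt0.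
have hF (x : R) : 0 < t -> ((if 0 < beta then t else 1) * t `^ (- theta) <= x) -> (F t f <= (x * (B' * M 0%N))%:E)%E.
  move=> t0 hx; apply: (@le_trans _ _ ((t `^ (- theta))%:E * ((if 0 < beta then t else 1) * (B' * M 0%N))%:E)%E).
    by apply: lee_wpmul2l; rewrite ?lee_fin ?powR_ge0//; apply: hB' => //; exact: ltW.
  rewrite -EFinM lee_fin.
  rewrite [leLHS](_ : _ = ((if 0 < beta then t else 1) * t `^ (- theta)) * (B' * M 0%N)); last by ring.
  by rewrite ler_wpM2r// mulr_ge0.
have [beta0|beta0|/eqP] := ltgtP beta 0; last by rewrite subr_eq0 (negbTE b01).
- have dE : beta = - delta by rewrite /delta ltr0_norm// opprK.
  have ptE : pt k = T ^- k by rewrite T_exprV /pt dE mulrN.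
  case/orP: ht => /andP[t1 t2].
    have t0 : 0 < t by exact: lt_le_trans t1.
    apply: far; apply: hF => //; rewrite ltNge (ltW beta0)/= mul1r.
    apply: le_trans (powR_opp_le Tk0 t1 (ltW theta0)) _.
    rewrite mu_expr T_expr -powRrM le_pow2 mulrN lerN2 -mulrA ler_wpM2l//.
    by rewrite [_ * theta]mulrC; apply: le_trans eta_theta; rewrite mulr2n mulrDl mul1r lerDl ltW.
  apply: (near k); rewrite ?inE ?eqxx//; apply: (hB _ _ k) => //.
  by rewrite ptE -TS [T * _]mulrC mulfK ?gt_eqF// mulrC t1 ltW.
- have dE : beta = delta by rewrite /delta gtr0_norm.
  have ptE : pt k.+1 = T ^+ k.+1 by rewrite T_expr /pt dE.
  case/orP: ht => /andP[t1 t2].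
    apply: (near k.+1); rewrite ?inE ?eqxx ?orbT//; apply: (hB _ _ k.+1) => //.
    by rewrite ptE exprS [T * _]mulrC mulfK ?gt_eqF// t1 mulrC ltW.
  have t0 : 0 < t by apply: lt_le_trans t1; rewrite invr_gt0 exprn_gt0.
  apply: far; apply: hF => //.
  rewrite beta0; have -> : t * t `^ (- theta) = t `^ (1 - theta).
    by rewrite -[X in X * _](powRr1 (ltW t0)) -powRD// (gt_eqF t0) implybT.
  apply: (@le_trans _ _ ((T ^- k) `^ (1 - theta))).
    apply: ge0_ler_powR; rewrite ?nnegrE ?subr_ge0 ?(ltW theta1) ?(ltW t0) ?invr_ge0 ?(ltW Tk0)//.
    by rewrite -TS ltW.
  rewrite mu_expr T_exprV -powRrM le_pow2 mulNr lerN2 -mulrA ler_wpM2l//.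
  by rewrite [_ * (1 - theta)]mulrC; apply: le_trans eta_theta'; rewrite mulr2n mulrDl mul1r lerDl ltW.
Qed.

(** The intervals have length [delta] in logarithmic scale, like the steps from one
    [pt k] to the next. *)
Let pt_disjoint t k l : pt k <= t < T * pt k -> pt l <= t < T * pt l -> k = l.
Proof.
have key i j : pt i <= t < T * pt i -> pt j <= t < T * pt j -> (i%:R - j%:R) * beta < delta.
  move=> /andP[h1 _] /andP[_ h2]; rewrite mulrBl ltrBlDr ltNge -le_pow2 pow2D -ltNge.
  exact: le_lt_trans h1 h2.
move=> hk hl; have h1 := key _ _ hk hl; have h2 := key _ _ hl hk.
have h : `|k%:R - l%:R : R| < 1.
  have : `|(k%:R - l%:R) * beta| < delta.
    by rewrite ltr_norml h1 andbT ltrNl -mulNr opprB.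
  by rewrite normrM -/delta -[X in _ < X]mul1r ltr_pM2r.
move: h; rewrite ltr_norml => /andP[h3 h4].
have lk : (l < k.+1)%N by rewrite -(ltr_nat R) -natr1; lra.
have kl : (k < l.+1)%N by rewrite -(ltr_nat R) -natr1; lra.
by apply/eqP; rewrite eqn_leq -ltnS kl -ltnS lk.
Qed.

Let interp f : \bar R := interp_norm (X b0 r0) (X b1 r1) theta r f.

Let F_ge0 t f : 0 <= t -> (0 <= F t f)%E.
Proof. by move=> t0; rewrite mule_ge0 ?lee_fin ?powR_ge0 ?Kf_ge0. Qed.

Let u_ge0 f j : (0 <= u f j)%E.
Proof. by rewrite mule_ge0// lee_fin ltW// pow2_gt0. Qed.

Let F_lower : exists2 B : R, 0 < B & forall f j t, pt j <= t < T * pt j ->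
  (B%:E * u f j <= F t f)%E.
Proof.
have K0 : 0 < K by exact: lt_le_trans K1.
exists (T `^ (- theta) / K) => [|f j t /andP[t1 t2]]; first by rewrite divr_gt0// powR_gt0.
have t0 : 0 < t by exact: lt_le_trans t1.
apply: (@le_trans _ _ ((T `^ (- theta) / K)%:E * ((K * (pt j) `^ (- theta))%:E * Kf (pt j) f))%E).
  by apply: lee_wpmul2l; rewrite ?lee_fin ?divr_ge0 ?powR_ge0 ?(ltW K0).
rewrite muleA -EFinM; apply: lee_pmul; rewrite ?lee_fin ?Kf_ge0 ?(ltW (pt_gt0 j)) ?le_Kf//.
  by rewrite !mulr_ge0 ?powR_ge0 ?invr_ge0 ?(ltW K0).
rewrite mulrA mulfVK ?gt_eqF// -powRM ?(ltW T0) ?(ltW (pt_gt0 j))//.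
by apply: powR_opp_le => //; exact: ltW.
Qed.

Let interp_lower : exists2 B : R, 0 < B & forall f, (forall j, a f j < +oo)%E ->
  (B%:E * nrm b r f <= interp f)%E.
Proof.
have [B B0 hB] := F_lower.
rewrite /interp /interp_norm /nrm; move: hr; case: r => [r'||]// r'0; last first.
  exists B => // f _; rewrite -lee_pdivlMl//; apply: Lnorm_counting_oo_le => j.
  rewrite u_ge0/= lee_pdivlMl//; apply: le_trans (hB f j (pt j) _) _.
    by rewrite lexx/= -[X in X < _]mul1r ltr_pM2r.
  by apply: ereal_sup_ubound; exists (pt j) => //=; rewrite in_itv/= pt_gt0.
have r1' : 0 < r' by rewrite -lte_fin.
pose B1 := ((T - 1) / T) `^ r'^-1 * B.
have TT : 0 < (T - 1) / T by rewrite divr_gt0// subr_gt0.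
exists B1 => [|f ffin]; first by rewrite mulr_gt0// powR_gt0.
have ufin j : u f j \is a fin_num.
  by rewrite fin_numM// ge0_fin_numE.
pose Xs j := (B * fine (u f j)) `^ r' / T.
have X0 j : 0 <= Xs j by rewrite divr_ge0 ?powR_ge0 ?ltW.
rewrite Lnorm_counting//.
have -> : (B1%:E * (\sum_(k <oo) `|u f k| `^ r') `^ r'^-1 =
    (\sum_(k <oo) ((T - 1) * Xs k)%:E) `^ r'^-1)%E.
  have uk0 k : 0 <= fine (u f k) by rewrite fine_ge0 ?u_ge0.
  have -> : (\sum_(k <oo) ((T - 1) * Xs k)%:E =
      ((T - 1) / T * B `^ r')%:E * \sum_(k <oo) `|u f k| `^ r')%E.
    rewrite -nneseriesZl; last by move=> k _; exact: poweR_ge0.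
    apply: eq_eseriesr => k _; rewrite gee0_abs ?u_ge0// -[in RHS](fineK (ufin k)) poweR_EFin -EFinM.
    by rewrite /Xs powRM ?(ltW B0)//; congr _%:E; ring.
  rewrite poweRM; last 2 first.
  - by rewrite lee_fin mulr_ge0 ?powR_ge0 ?(ltW TT).
  - by apply: nneseries_ge0 => n _ _; exact: poweR_ge0.
  rewrite poweR_EFin; congr (_%:E * _)%E.
  by rewrite /B1 (powRM _ (ltW TT) (powR_ge0 B r')) -powRrM mulfV ?gt_eqF// powRr1// ltW.
apply: lee_poweR; first by rewrite invr_gt0.
  by apply: nneseries_ge0 => n _ _; rewrite lee_fin mulr_ge0// subr_ge0 ltW.
rewrite -(integral_step T1 pt_gt0 X0); apply: nonneg_le_integral => t.
  by move=> _; exact: step_ge0.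
rewrite /= in_itv/= andbT => t0; apply: step_le => //.
- by rewrite mule_ge0 ?poweR_ge0// lee_fin invr_ge0 ltW.
- by move=> k l; exact: pt_disjoint.
move=> k hk; have /andP[hk1 hk2] := hk.
rewrite /Xs -mulrA -invfM EFinM; apply: lee_pmul; rewrite ?lee_fin ?powR_ge0 ?invr_ge0 ?mulr_ge0
   ?(ltW T0) ?(ltW (pt_gt0 k))//; last first.
  by rewrite lef_pV2 ?posrE ?mulr_gt0// ltW.
rewrite -poweR_EFin; apply: lee_poweR => //.
  by rewrite lee_fin mulr_ge0 ?(ltW B0)// fine_ge0 ?u_ge0.
by rewrite EFinM fineK//; exact: hB.
Qed.

Let sum_fine f : (nrm b r f < +oo)%E -> forall j, u f j \is a fin_num.
Proof.
move=> fin j; rewrite ge0_fin_numE ?u_ge0//.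
exact: le_lt_trans (nrm_term b f j hr) fin.
Qed.

Let le_div_mu (x : \bar R) (M : R) n : (x * (mu ^+ n)%:E <= M%:E)%E -> (x <= (M / mu ^+ n)%:E)%E.
Proof.
by rewrite EFinM lee_pdivlMr ?exprn_gt0//; case/andP: mu01.
Qed.

Let decomposable f (M : R) : P f -> 0 <= M ->
  (forall j, (u f j <= (M / mu ^+ dist j 0)%:E)%E) ->
  exists f0 f1, [/\ carrier (X b0 r0) f0, carrier (X b1 r1) f1 & f = f0 + f1].
Proof.
move=> Pf M0 hu; have [B B0 hB] := K_split.
have /ereal_inf_lt[_ [f0 [f1 [h0 h1 fE _]]] _] : (Kf (pt 0) f < +oo)%E.
  by apply: le_lt_trans (hB f M 0%N Pf M0 hu) _; exact: ltry.
by exists f0, f1.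
Qed.

Let interp_upper : exists2 B : R, 0 < B & forall f, P f -> (nrm b r f < +oo)%E ->
  (interp f <= B%:E * nrm b r f)%E /\
  exists f0 f1, [/\ carrier (X b0 r0) f0, carrier (X b1 r1) f1 & f = f0 + f1].
Proof.
have [B B0 hB] := F_bound; have /andP[mu0 mu1] := mu01.
move: (sum_fine); rewrite /interp /interp_norm /nrm; move: hr nrm_term.
case: r => [r'||]// r'0 term ufin; last first.
  exists (B * 3 + 1) => [|f Pf fin]; first by rewrite ltr_wpDl// mulr_ge0.
  have Nfin : Lnorm counting +oo (u f) \is a fin_num by rewrite ge0_fin_numE// Lnorm_ge0.
  pose M := fine (Lnorm counting +oo (u f)).
  have M0 : 0 <= M by rewrite fine_ge0// Lnorm_ge0.
  have hu J j : (u f j <= (M / mu ^+ dist j J)%:E)%E.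
    apply: (@le_trans _ _ M%:E); first by rewrite fineK//; exact: term.
    by rewrite lee_fin ler_peMr// invf_ge1 ?exprn_gt0// exprn_ile1// ltW.
  split; last exact: decomposable Pf M0 (hu 0%N).
  apply: ge_ereal_sup => _ [t t0 <-]; have {}t0 : 0 < t by move: t0; rewrite /= in_itv/= andbT.
  have [k hk] : exists k, (T ^+ k <= t < T * T ^+ k) || (T ^- k.+1 <= t < T * T ^- k.+1).
    have [t1|t1] := leP 1 t; first by have [k hk] := floor_expr T1 t1; exists k; rewrite hk.
    have [|k hk] := @floor_exprV _ T t T1; first by rewrite t0 t1.
    by exists k; rewrite hk orbT.
  apply: le_trans (hB f (fun=> M) Pf (fun=> M0) hu k t hk) _.
  rewrite -[X in (_ <= _ * X)%E](fineK Nfin) -/M -EFinM lee_fin mulrDl mul1r -mulrA.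
  rewrite ler_wpDr// ler_wpM2l// (_ : 3 * M = M + M + M); last by ring.
  by rewrite lerD2l ler_piMl// exprn_ile1// ltW.
have r1' : 0 < r' by rewrite -lte_fin.
have [D D0 hD] := geometric_majorant mu01 r1'.
pose B1 := (2 * (T - 1) * B `^ r' * D) `^ r'^-1.
have B10 : 0 <= B1 by exact: powR_ge0.
exists (B1 + 1) => [|f Pf fin]; first by rewrite ltr_wpDl.
have fu j : u f j \is a fin_num by exact: ufin.
pose v j := fine (u f j).
have v0 j : 0 <= v j by rewrite fine_ge0 ?u_ge0.
have vE : (\sum_(j <oo) `|u f j| `^ r' = \sum_(j <oo) (v j `^ r')%:E)%E.
  by apply: eq_eseriesr => j _; rewrite gee0_abs ?u_ge0// -[in LHS](fineK (fu j)) poweR_EFin.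
have vfin : (\sum_(j <oo) (v j `^ r')%:E < +oo)%E.
  rewrite -vE; move: fin; rewrite Lnorm_counting//; apply: lty_poweRy.
  by rewrite invr_eq0 gt_eqF.
have [M [M0 hM sM]] := hD v v0 vfin.
have hu J j : (u f j <= (M J / mu ^+ dist j J)%:E)%E.
  by apply: le_div_mu; rewrite -[u f j](fineK (fu j)) -EFinM lee_fin; exact: hM J j.
split; last exact: decomposable Pf (M0 0%N) (hu 0%N).
pose N k := M k + M k.+1 + mu ^+ k * M 0%N.
have N0 k : 0 <= N k by rewrite !addr_ge0 ?M0// mulr_ge0 ?M0// exprn_ge0// ltW.
pose Xs k := (B * N k) `^ r'.
have X0 k : 0 <= Xs k by exact: powR_ge0.
pose cu k := T ^+ k; pose cd k := T ^- k.+1.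
have cu0 k : 0 < cu k by rewrite exprn_gt0.
have cd0 k : 0 < cd k by rewrite invr_gt0 exprn_gt0.
have bound c k t : 0 < c -> c <= t -> (F t f <= (B * N k)%:E)%E ->
    (F t f `^ r' * (t^-1)%:E <= (Xs k / c)%:E)%E.
  move=> c0 ct hF; have t0 : 0 < t by exact: lt_le_trans ct.
  rewrite EFinM; apply: lee_pmul; rewrite ?poweR_ge0 ?lee_fin ?invr_ge0 ?(ltW t0)//; last first.
    by rewrite lef_pV2.
  by rewrite -poweR_EFin; apply: lee_poweR => //; apply: F_ge0; exact: ltW.
have I : (\int[lebesgue_measure]_(t in `]0%R, +oo[) (F t f `^ r' * (t^-1)%:E) <=
    \int[lebesgue_measure]_(t in `]0%R, +oo[) (step T cu Xs t + step T cd Xs t))%E.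
  apply: nonneg_le_integral => t; rewrite /= in_itv/= andbT => t0.
    by rewrite mule_ge0 ?poweR_ge0// lee_fin invr_ge0 ltW.
  have [t1|t1] := leP 1 t.
    have [k hk] := floor_expr T1 t1; have /andP[hk1 _] := hk.
    apply: le_trans (bound (cu k) k t (cu0 k) hk1 _) _; first by apply: hB; rewrite ?hk.
    apply: le_trans (step_ge cu0 X0 hk) _; rewrite leeDl//; exact: step_ge0.
  have [|k hk] := @floor_exprV _ T t T1; first by rewrite t0 t1.
  have /andP[hk1 _] := hk.
  apply: le_trans (bound (cd k) k t (cd0 k) hk1 _) _; first by apply: hB; rewrite ?hk ?orbT.
  apply: le_trans (step_ge cd0 X0 hk) _; rewrite leeDr//; exact: step_ge0.
have SX : (\sum_(k <oo) ((T - 1) * Xs k)%:E <=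
    ((T - 1) * B `^ r' * D)%:E * \sum_(j <oo) (v j `^ r')%:E)%E.
  have TB : (0 <= ((T - 1) * B `^ r')%:E)%E.
    by rewrite lee_fin mulr_ge0 ?powR_ge0// subr_ge0 ltW.
  rewrite EFinM -muleA; apply: le_trans (lee_wpmul2l TB sM).
  rewrite -nneseriesZl; last by move=> k _; rewrite lee_fin powR_ge0.
  apply: lee_nneseries => [k _ _|k _]; first by rewrite lee_fin mulr_ge0// subr_ge0 ltW.
  by rewrite -EFinM lee_fin /Xs powRM// mulrA.
rewrite Lnorm_counting// vE; set s := (\sum_(j <oo) (v j `^ r')%:E)%E in vfin sM SX *.
have s0 : (0 <= s)%E by apply: nneseries_ge0 => j _ _; rewrite lee_fin powR_ge0.
apply: (@le_trans _ _ (B1%:E * s `^ r'^-1)%E); last first.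
  by apply: lee_wpmul2r; rewrite ?poweR_ge0// lee_fin lerDl.
rewrite /B1 -poweR_EFin -poweRM//; last first.
  by rewrite lee_fin !mulr_ge0 ?powR_ge0 ?(ltW D0)// subr_ge0 ltW.
apply: lee_poweR; first by rewrite invr_gt0.
  apply: integral_ge0 => t; rewrite /= in_itv/= andbT => t0.
  by rewrite mule_ge0 ?poweR_ge0// lee_fin invr_ge0 ltW.
apply: (le_trans I); rewrite ge0_integralD//; last 4 first.
- by move=> t _; exact: step_ge0.
- by apply: (measurable_funS measurableT) => //; exact: measurable_step.
- by move=> t _; exact: step_ge0.
- by apply: (measurable_funS measurableT) => //; exact: measurable_step.
rewrite !integral_step//; apply: (le_trans (leeD SX SX)).
rewrite -mule2n -mule_natl muleA -EFinM.
by rewrite le_eqVlt; apply/orP; left; apply/eqP; congr (_%:E * _)%E; ring.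
Qed.

Theorem interpolation_of_blocks : qspace_equiv (real_interp (X b0 r0) (X b1 r1) theta r) (X b r).
Proof.
have [B1 B10 lower] := interp_lower; have [B2 B20 upper] := interp_upper.
have afin c rho f : (0 < rho)%E -> (nrm c rho f < +oo)%E -> forall j, (a f j < +oo)%E.
  move=> rho0 fin j; have := le_lt_trans (nrm_term c f j rho0) fin.
  have [->|] := eqVneq (a f j) +oo%E; last by rewrite -ltey.
  by rewrite gt0_muley ?lte_fin ?pow2_gt0.
split.
  apply/seteqP; split=> f /=.
    move=> [[f0 [f1 [[Pf0 n0] [Pf1 n1] fE]]] fin]; split; first by rewrite fE; exact: PD.
    have aff j : (a f j < +oo)%E.
      rewrite fE; apply: le_lt_trans (aD f0 f1 j) _.
      rewrite lte_mul_pinfty ?lee_fin ?(le_trans ler01)//.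
      by rewrite lte_add_pinfty//; [exact: afin n0 j|exact: afin n1 j].
    have := le_lt_trans (lower f aff) fin.
    have [e|] := eqVneq (nrm b r f) +oo%E; last by rewrite -ltey.
    by rewrite e gt0_muley ?lte_fin.
  move=> [Pf fin]; have [le ex] := upper f Pf fin; split=> //.
  apply: le_lt_trans le _; rewrite lte_mul_pinfty ?lee_fin ?(ltW B20)//.
exists B1, B2; split=> // f [Pf fin]; rewrite lower/=; last exact: afin fin.
by have [] := upper f Pf fin.
Qed.

End interpolation_of_blocks.

Theorem theorem4p14 (R : realType) (d : nat) (phi0 : 'rV[R]_d -> R[i])
    (p s b0 b1 b theta : R) (q r r0 r1 : \bar R)
    (hd : (0 < d)%N) (hphi0 : resolution_generator phi0)
    (hp : 1 < p) (hq : (0 < q)%E) (hr : (0 < r)%E)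
    (hr0 : (0 < r0)%E) (hr1 : (0 < r1)%E)
    (htheta0 : 0 < theta) (htheta1 : theta < 1)
    (hb01 : b0 != b1) (hb01_gt0 : 0 < b0 * b1)
    (hb : b = (1 - theta) * b0 + theta * b1) :
  qspace_equiv
    (real_interp (TF phi0 b0 r0 s p q) (TF phi0 b1 r1 s p q) theta r)
    (TF phi0 b r s p q).
Proof.
have [A A1 split_f] := block_splitting hphi0 s hp hq.
have bn0 j : block_norm phi0 s p q 0 j = 0%E.
  apply: block_norm_eq0 => // nu _; apply/funext => psi.
  have := congr1 (fun T => T psi) (pieceD phi0 nu 0 0); rewrite addr0 => /esym/eqP.
  by rewrite -subr_eq0 addrK => /eqP.
have := interpolation_of_blocks (lq_cst_ge1 hq) A1 (block_norm_ge0 phi0 s p q) bn0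
  (tempered0 R d) (@temperedD R d) (block_normD phi0 s hp hq) split_f hr hr0 hr1 htheta0 htheta1 hb01 hb.
exact.
Qed.
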